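(* Let $\mu$ be a probability measure over $\mathbb{R}^d$ and $F\subset\mathbb{R}^d$ a closed domain. Then for all $x,y\in\mathbb{R}^d$ there exists a path $\gamma\in\Gamma_F(x,y)$ such that $D_{\mu,F}(x,y)=D_\mu(\gamma)$.
   Context: $\mathbb{R}^d$ carries the Euclidean norm $\|\cdot\|$; $B(x,r)$ is the open ball. Fixed real parameters: $m\in(0,1]$, $p\ge 1$, $\beta\ge 1$. For a probability measure $\mu$ on $\mathbb{R}^d$, $\delta_{\mu,u}(x)=\inf\{r>0:\mu(B(x,r))>u\}$ and the distance-to-measure is $d_\mu(x)=\left(\frac1m\int_0^m\delta_{\mu,u}(x)^p\,du\right)^{1/p}$. It is finite everywhere when $m<1$ or when $\mu$ has compact support; when $m=1$, $\mu$ is assumed to be such that $d_\mu$ is finite. A rectifiable path is a continuous $\gamma:[0,1]\to\mathbb{R}^d$ of finite Euclidean length $|\gamma|=\int_0^1\|\dot\gamma(t)\|\,dt$, parametrized so as to be Lipschitz (always possible, e.g. with constant speed). Its FDTM length is $D_\mu(\gamma)=\int_0^1 d_\mu(\gamma(t))^\beta\|\dot\gamma(t)\|\,dt$. For a closed set $F\subset\mathbb{R}^d$ (the domain) and $x,y\in\mathbb{R}^d$, $\Gamma_F(x,y)$ is the set of rectifiable paths $\gamma$ with $\gamma(0)=x$, $\gamma(1)=y$ such that for every open interval $I\subset[0,1]$ with $\gamma(I)\subset\mathbb{R}^d\setminus F$ there is a unit vector $u\in\mathbb{R}^d$ with $\dot\gamma(t)=\|\dot\gamma(t)\|u$ for all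 $t\in I$ where $\dot\gamma$ is defined. The Fermat distance-to-measure is $D_{\mu,F}(x,y)=\inf_{\gamma\in\Gamma_F(x,y)}D_\mu(\gamma)$. *)

(* Defs.v *)
From mathcomp Require Import all_boot all_order all_algebra.
From mathcomp Require Import all_classical all_reals all_analysis.

Set Implicit Arguments.
Unset Strict Implicit.
Unset Printing Implicit Defensive.

Import Order.TTheory GRing.Theory Num.Theory.
Import numFieldNormedType.Exports.

Local Open Scope classical_set_scope.
Local Open Scope ring_scope.

(* The library norm `|x| on row vectors is the sup norm.  It induces the usual
   topology of R^d, so the library's open, closed, continuous and derivative
   apply as they stand; only lengths and balls need the Euclidean norm. *)
Definition enorm (R : realType) (d : nat) (x : 'rV[R]_d) : R :=
  Num.sqrt (\sum_(i < d) x 0 i ^+ 2).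

Definition eball (R : realType) (d : nat) (x : 'rV[R]_d) (r : R)
    : set 'rV[R]_d :=
  [set y | enorm (y - x) < r].

(* R^d with its Borel sigma-algebra. *)
Definition borelRd (R : realType) (d : nat) :=
  g_sigma_algebraType (@open 'rV[R]_d).

(* delta_{mu,u}(x); the infimum of the empty set is +oo. *)
Definition delta (R : realType) (d : nat) (mu : probability (borelRd R d) R)
    (u : R) (x : 'rV[R]_d) : \bar R :=
  ereal_inf [set r%:E | r in [set r : R | 0 < r /\
                                          (u%:E < mu (eball x r))%E]].

Definition dtm (R : realType) (d : nat) (mu : probability (borelRd R d) R)
    (m p : R) (x : 'rV[R]_d) : \bar R :=
  ((m^-1%:E * \int[@lebesgue_measure R]_(u in `[0%R, m]) (delta mu u x `^ p))
     `^ p^-1)%E.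

(* A path is given by a function on R of which only the values on [0, 1]
   matter.  Integrals along it are taken over ]0, 1[ because a derivative at an
   endpoint would involve values outside [0, 1].  At the other points where a
   Lipschitz path is not derivable, a null set, the library derivative takes a
   default value. *)
Definition path_length (R : realType) (d : nat) (gamma : R -> 'rV[R]_d)
    : \bar R :=
  (\int[@lebesgue_measure R]_(t in `]0%R, 1%R[) (enorm (derive1 gamma t))%:E)%E.

Definition rectifiable_path (R : realType) (d : nat) (gamma : R -> 'rV[R]_d)
    : Prop :=
  [/\ {within `[0, 1], continuous gamma},
      (path_length gamma < +oo)%E &
      exists L : R, forall s t : R, 0 <= s <= 1 -> 0 <= t <= 1 ->
        enorm (gamma s - gamma t) <= L * `|s - t| ].

Definition fdtm_length (R : realType) (d : nat)
    (mu : probability (borelRd R d) R) (m p beta : R)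
    (gamma : R -> 'rV[R]_d) : \bar R :=
  (\int[@lebesgue_measure R]_(t in `]0%R, 1%R[)
     (dtm mu m p (gamma t) `^ beta * (enorm (derive1 gamma t))%:E))%E.

Definition Gamma (R : realType) (d : nat) (F : set 'rV[R]_d)
    (x y : 'rV[R]_d) : set (R -> 'rV[R]_d) :=
  [set gamma | [/\ rectifiable_path gamma, gamma 0 = x, gamma 1 = y &
    forall a b : R, 0 <= a -> a < b -> b <= 1 ->
      (forall t : R, a < t < b -> ~ F (gamma t)) ->
      exists u : 'rV[R]_d, enorm u = 1 /\
        forall t : R, a < t < b -> derivable gamma t 1 ->
          derive1 gamma t = enorm (derive1 gamma t) *: u ]].

Definition fermat_dtm (R : realType) (d : nat)
    (mu : probability (borelRd R d) R) (m p beta : R) (F : set 'rV[R]_d)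
    (x y : 'rV[R]_d) : \bar R :=
  ereal_inf [set fdtm_length mu m p beta gamma | gamma in Gamma F x y].

(* Main.v *)
Require Import Defs.
From HB Require Import structures.
From mathcomp Require Import all_boot all_order all_algebra.
From mathcomp Require Import all_classical all_reals all_analysis.
From mathcomp Require Import ring lra zify measurable_realfun.

Set Implicit Arguments.
Unset Strict Implicit.
Unset Printing Implicit Defensive.

Import Order.TTheory GRing.Theory Num.Theory.
Import numFieldNormedType.Exports.

Local Open Scope classical_set_scope.
Local Open Scope ring_scope.

(* The weight w = d_mu^beta may vanish, so a D_mu-minimizing sequence need not
   have bounded Euclidean length.  Minimizing first among the N-Lipschitz paths,
   for which compactness is available, the point is that the length of such a
   minimizer is bounded independently of N; parametrizing it by arc length
   then gives a competitor with a Lipschitz constant independent of N, and the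
   minimizer for that constant is a global one.

   The length bound rests on a dichotomy at each point a.  The function d_mu is
   1-Lipschitz (Minkowski), and a small ball around z <> a of radius |z - a| has
   mass < m/2, so that d_mu(z) >= c |z - a| near a.  Hence near a the weight is
   comparable either to |z - a|^beta or to a positive constant, in both cases to
   W(|z - a|) with W doubling.  Between two visits of F a minimizer costs no more
   than a segment, i.e. at most W(rho) times the distance inside the ball of
   radius rho, while it pays at least a multiple of W(rho) per unit length in the
   annulus between rho/2 and rho.  Its length there is thus O(rho), which sums
   over dyadic annuli; compactness of a large ball does the rest, because w is
   bounded below at infinity and the minimizer stays in that ball. *)

(** The direction condition of [Gamma] speaks of derivatives, which do not pass to limits. It is
    replaced by equality in the triangle inequality ([straight]), which involves only values of the
    path; for Lipschitz paths the two conditions are equivalent once a unit vector exists, that is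
    when [d] is positive. Weighted lengths are likewise reached through values: Riemann sums built
    on chords depend continuously on finitely many points of the path, lie below the weighted length
    up to an error uniform over N-Lipschitz paths from [x], and for each path come above it up to
    any error for arbitrarily fine grids. Together these facts give lower semicontinuity without
    weak convergence of derivatives.

    A minimizer among N-Lipschitz paths may only be compared with N-Lipschitz paths. The comparison
    therefore replaces a piece between two corners (times in F, or an end of the path) by a segment
    run at constant speed during the same time, which does not increase the Lipschitz constant. This
    is why the length estimate is made on chains of corners, and transferred to the length
    afterwards. *)

Lemma normed_lipschitz_continuous {R : realType} (V W : normedModType R) (f : V -> W) (N : R) :
  (forall x y, `|f x - f y| <= N * `|x - y|) -> continuous f.
Proof.
move=> fN x; apply/cvgrPdist_le => e e0.
have N0 : 0 < `|N| + 1 by rewrite ltr_wpDl.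
near=> y; rewrite (le_trans (fN _ _))//.
rewrite (@le_trans _ _ ((`|N| + 1) * `|x - y|))//.
  by rewrite ler_wpM2r// (le_trans (ler_norm _))// lerDl.
rewrite -ler_pdivlMl//; near: y.
apply: cvgr_dist_le; first exact: cvg_id.
by rewrite mulr_gt0// invr_gt0.
Unshelve. all: by end_near. Qed.

(** * Lipschitz functions and paths *)

Section lipschitz_FTC.
Context {R : realType}.
Notation mu := (@lebesgue_measure R).

(** The two Stieltjes measures add up to Lebesgue measure on half-open intervals, hence on all Borel
    sets by uniqueness; a set that is null for a sum of two measures is null for each of them. *)
Lemma cumulative_dominated (F G : cumulative R R) :
  (forall x, F x + G x = x) ->
  lebesgue_stieltjes_measure F `<< mu.
Proof.
move=> FG; apply/null_content_dominatesP => A mA muA0.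
have H X : ocitv X -> mu X =
    measure_add (lebesgue_stieltjes_measure F) (lebesgue_stieltjes_measure G) X.
  move=> oX; have mX : R.-ocitv.-measurable X by [].
  rewrite measure_addE /lebesgue_measure/= /lebesgue_stieltjes_measure/=.
  rewrite /measure_extension/= !measurable_mu_extE//.
  case: oX => -[a b] _ /= <-; have [ab|ba] := leP a b.
    by rewrite !wlength_itv_bnd//= -EFinD -[in LHS](FG a) -[in LHS](FG b); congr EFin; lra.
  by rewrite set_itv_ge ?bnd_simp -?leNgt ?(ltW ba)// !wlength0 adde0.
have E := etrans (lebesgue_measure_unique H mA) (measure_addE _ _ _).
move: E; rewrite [LHS]muA0 => /esym/eqP.
by rewrite padde_eq0 ?measure_ge0// => /andP[/eqP].
Qed.

Lemma cumulative_FTC (F G : cumulative R R) :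
  (forall x, F x + G x = x) -> exists g : R -> R,
  [/\ mu.-integrable setT (EFin \o g),
      (forall a b, 0 <= a -> a <= b -> b <= 1 ->
         F b - F a = \int[mu]_(t in `]a, b]) g t) &
      {ae mu, forall x, 0 < x < 1 -> derivable F x 1 /\ derive1 F x = g x}].
Proof.
move=> FG; pose nu0 : {measure set (measurableTypeR R) -> \bar R} :=
    lebesgue_stieltjes_measure F.
have nu0E a b : a <= b -> nu0 `]a, b]%classic = (F b - F a)%:E.
  move=> ab; rewrite /nu0/=.
  have mab : R.-ocitv.-measurable `]a, b]%classic by exact: is_ocitv.
  rewrite /lebesgue_stieltjes_measure /measure_extension/=.
  by rewrite measurable_mu_extE//= wlength_itv_bnd.
have mD : measurable (`]0%R, 1%R]%classic : set (measurableTypeR R)) by exact: measurable_itv.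
have Dfin : (nu0 `]0%R, 1%R]%classic < +oo)%E by rewrite nu0E// ltry.
(* The Stieltjes measure of the whole line may be infinite; restricted to ]0, 1] it has an
   integrable Radon-Nikodym density. *)
pose nu : {finite_measure set (measurableTypeR R) -> \bar R} := mfrestr mD Dfin.
have nuE A : nu A = nu0 (A `&` `]0, 1]) by [].
have nudom : nu `<< mu.
  apply/null_content_dominatesP => A mA muA0; rewrite nuE.
  have := cumulative_dominated FG => /null_content_dominatesP; apply.
    exact: measurableI.
  apply/eqP; rewrite eq_le measure_ge0 andbT -[X in (_ <= X)%E]muA0.
  by apply: le_measure; rewrite ?inE//; exact: measurableI.
have [h [h0 hfin hint hE]] := radon_nikodym_sigma_finite nudom.
pose g : R -> R := fun x => fine (h x).
have hg : h = EFin \o g by apply/funext => x; rewrite /g/= fineK.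
have inth A : measurable A -> mu.-integrable A (EFin \o g).
  by move=> mA; rewrite -hg; exact: integrableS hint.
have gE A : measurable A -> (\int[mu]_(t in A) g t)%:E = nu A.
  move=> mA; rewrite hE// hg /Rintegral fineK//.
  by apply: integrable_fin_num => //; exact: inth.
exists g; split.
- exact: inth.
- move=> a b a0 ab b1; apply: EFin_inj; rewrite gE// nuE setIidl ?nu0E//.
  move=> t /=; rewrite !in_itv/= => /andP[ta tb].
  by rewrite (le_lt_trans a0)//= (le_trans tb).
(* On ]0, 1[ this indefinite integral differs from [F] by the constant [F 0], so Lebesgue
   differentiation applies to [F] as well. *)
- pose Phi (x : R) : R := (\int[mu]_(t in `]-oo, x]) g t)%R.
  have : {ae mu, forall x, derivable Phi x 1 /\ derive1 Phi x = g x}.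
    apply: FTC1Ny; first by move=> y; exact: inth.
    by apply: open_integrable_locally; [exact: openT|exact: inth].
  apply: filterS; first exact: (ae_filter_ringOfSetsType mu).
  move=> x [dx dE] /andP[x0 x1].
  have nearE : {near x, (Phi \+ cst (F 0)) =1 F}.
    near=> y.
    have y0 : 0 < y by near: y; exact: lt_nbhsr.
    have y1 : y < 1 by near: y; exact: lt_nbhsl.
    rewrite /= -[RHS](subrK (F 0)); congr (_ + _).
    apply: EFin_inj; rewrite gE// nuE (_ : _ `&` _ = `]0, y]%classic) ?nu0E ?(ltW y0)//.
    apply/seteqP; split => z /=; rewrite !in_itv/=.
      by move=> [-> /andP[->]].
    by move=> /andP[-> zy]; rewrite zy (le_trans zy) ?(ltW y1).
  have dPhi : is_derive x 1 Phi (g x) by exact: (DeriveDef dx (etrans (esym (derive1E _ _)) dE)).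
  have dc : is_derive x (1 : R) (cst (F 0) : R -> R) 0 by exact: is_derive_cst.
  have [dPsi EPsi] := is_deriveD dPhi dc.
  split; first exact: (near_eq_derivable nearE dPsi).
  by rewrite derive1E -[RHS]addr0 -EPsi (near_eq_derive _ nearE).
Unshelve. all: by end_near. Qed.

Lemma lipschitz_FTC (f : R -> R) (N : R) :
  (forall s t, `|f s - f t| <= N * `|s - t|) -> exists g : R -> R,
  [/\ measurable_fun setT g, mu.-integrable `[0, 1] (EFin \o g),
      (forall a b, 0 <= a -> a <= b -> b <= 1 ->
         f b - f a = \int[mu]_(t in `]a, b]) g t) &
      {ae mu, forall x, 0 < x < 1 -> derivable f x 1 /\ derive1 f x = g x}].
Proof.
move=> fN; have fc : continuous f by exact: (@normed_lipschitz_continuous _ R^o R^o _ N).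
pose K := `|N| + 1; have K0 : 0 < K by rewrite ltr_wpDl.
have fK s t : s <= t -> `|f t - f s| <= K * (t - s).
  move=> st; rewrite (le_trans (fN _ _))// ger0_norm ?subr_ge0//.
  by rewrite ler_wpM2r ?subr_ge0// /K (le_trans (ler_norm _))// lerDl.
(* Both are nondecreasing and their Stieltjes measures add up to the Lebesgue
   measure, so that of [F0] is absolutely continuous. *)
pose F0 x := x / 2 + f x / (2 * K); pose G0 x := x / 2 - f x / (2 * K).
have K2 : 0 < 2 * K by rewrite mulr_gt0.
have bnd s t : s <= t -> `|(f t - f s) / (2 * K)| <= (t - s) / 2.
  move=> st; rewrite normrM normfV (gtr0_norm K2) ler_pdivrMr//.
  by rewrite (le_trans (fK _ _ st))// le_eqVlt; apply/orP; left; apply/eqP; field.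
have Fnd : nondecreasing F0.
  move=> s t st; move: (bnd _ _ st); rewrite /F0 ler_norml mulrBl => /andP[h1 h2].
  by lra.
have Gnd : nondecreasing G0.
  move=> s t st; move: (bnd _ _ st); rewrite /G0 ler_norml mulrBl => /andP[h1 h2].
  by lra.
have hc : continuous (fun x : R => x / 2).
  by move=> x; apply: cvgMl; exact: cvg_id.
have fKc : continuous (fun x : R => f x / (2 * K)).
  by move=> x; apply: cvgMl; exact: fc.
have Fc : right_continuous F0.
  by apply: right_continuousW => x; apply: cvgD; [exact: hc|exact: fKc].
have Gc : right_continuous G0.
  by apply: right_continuousW => x; apply: cvgB; [exact: hc|exact: fKc].
pose F : cumulative R R := HB.pack F0 (isCumulative.Build R _ R F0 Fnd Fc).
pose G : cumulative R R := HB.pack G0 (isCumulative.Build R _ R G0 Gnd Gc).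
have FG x : F x + G x = x by rewrite /= /F0 /G0; lra.
have [g [ig gE dg]] := cumulative_FTC FG.
have mg : measurable_fun setT g by apply/measurable_EFinP; exact: measurable_int ig.
have igS A : measurable A -> mu.-integrable A (EFin \o g).
  by move=> mA; exact: integrableS ig.
have i1 : mu.-integrable `[0, 1] (EFin \o cst K).
  by apply: continuous_compact_integrable; [exact: segment_compact|exact: cst_continuous].
have i2 A : measurable A -> mu.-integrable A (EFin \o (fun x => 2 * K * g x)).
  by move=> mA; apply: eq_integrable (integrableZl mA (2 * K) (igS _ mA)).
have fE x : f x = 2 * K * F x - K * x.
  by rewrite /= /F0; field; rewrite gt_eqF.
exists (fun x => 2 * K * g x - K); split.
- by apply: measurable_funB => //; apply: measurable_funM.
- have mI : measurable (`[0%R, 1%R]%classic : set (measurableTypeR R)).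
    exact: measurable_itv.
  have := integrableB mI (i2 _ mI) i1.
  by apply: eq_integrable.
- move=> a b a0 ab b1; have sab : `]a, b]%classic `<=` `[0, 1]%classic.
    move=> t /=; rewrite !in_itv/= => /andP[ta tb].
    by rewrite (le_trans a0 (ltW ta)) (le_trans tb).
  rewrite RintegralB//; [|exact: i2|exact: integrableS i1].
  rewrite RintegralZl//; last exact: igS.
  rewrite -gE// (_ : \int[mu]_(_ in _) K = K * (b - a)); first by rewrite !fE; ring.
  rewrite Rintegral_cst//; congr (_ * _).
  rewrite (congr1 fine (lebesgue_measure_itv `]a, b])) /= lte_fin.
  case: ltP => [//|ba]; have -> : a = b by apply/le_anti; rewrite ab ba.
  by rewrite subrr.
- apply: filterS dg; first exact: (ae_filter_ringOfSetsType mu).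
  move=> x dFx x01; have [dx dE] := dFx x01.
  have dF : is_derive x 1 F (g x) := DeriveDef dx (etrans (esym (derive1E _ _)) dE).
  have fEf : f = ((2 * K) \*: (F : R -> R)) - (K \*: (@idfun R)).
    by apply/funext => y; rewrite fE.
  have [df dfE] := is_deriveB (is_deriveZ (2 * K) dF) (is_deriveZ K (is_derive_id x (1 : R))).
  rewrite fEf; split => //.
  by rewrite derive1E dfE [K%:A]mulr1.
Unshelve. all: by end_near. Qed.

End lipschitz_FTC.

(** * The Euclidean norm and its comparison with the sup norm *)

Section euclidean_norm.
Context {R : realType} {d : nat}.
Implicit Types x y z u : 'rV[R]_d.

Definition dotr x y : R := \sum_(i < d) x 0 i * y 0 i.

Lemma dotrC x y : dotr x y = dotr y x.
Proof. by apply: eq_bigr => i _; rewrite mulrC. Qed.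

Lemma dotrDl x y z : dotr (x + y) z = dotr x z + dotr y z.
Proof. by rewrite -big_split; apply: eq_bigr => i _; rewrite mxE mulrDl. Qed.

Lemma dotrZl c x y : dotr (c *: x) y = c * dotr x y.
Proof. by rewrite mulr_sumr; apply: eq_bigr => i _; rewrite mxE mulrA. Qed.

Lemma dotrNl x y : dotr (- x) y = - dotr x y.
Proof. by rewrite -scaleN1r dotrZl mulN1r. Qed.

Lemma dotrBl x y z : dotr (x - y) z = dotr x z - dotr y z.
Proof. by rewrite dotrDl dotrNl. Qed.

Lemma dotrDr x y z : dotr x (y + z) = dotr x y + dotr x z.
Proof. by rewrite dotrC dotrDl !(dotrC x). Qed.

Lemma dotrZr c x y : dotr x (c *: y) = c * dotr x y.
Proof. by rewrite dotrC dotrZl (dotrC x). Qed.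

Lemma dotrBr x y z : dotr x (y - z) = dotr x y - dotr x z.
Proof. by rewrite dotrC dotrBl !(dotrC x). Qed.

Lemma dotr_ge0 x : 0 <= dotr x x.
Proof. by apply: sumr_ge0 => i _; rewrite -expr2 sqr_ge0. Qed.

Lemma enormE x : enorm x = Num.sqrt (dotr x x).
Proof. by rewrite /enorm; congr Num.sqrt; apply: eq_bigr => i _; rewrite expr2. Qed.

Lemma enorm_ge0 x : 0 <= enorm x.
Proof. exact: sqrtr_ge0. Qed.
Hint Resolve enorm_ge0 : core.

Lemma sqr_enorm x : enorm x ^+ 2 = dotr x x.
Proof. by rewrite enormE sqr_sqrtr// dotr_ge0. Qed.

Lemma ler_coord_enorm x i : `|x 0 i| <= enorm x.
Proof.
rewrite -(@ler_pXn2r _ 2)// ?nnegrE// sqr_enorm /dotr (bigD1 i)//=.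
by rewrite real_normK ?num_real// -expr2 lerDl sumr_ge0// => j _; rewrite -expr2 sqr_ge0.
Qed.

Lemma enorm_eq0 x : enorm x = 0 -> x = 0.
Proof.
move=> x0; apply/rowP => i; rewrite mxE; apply/eqP.
by rewrite -normr_le0 -x0 ler_coord_enorm.
Qed.

Lemma enormZ c x : enorm (c *: x) = `|c| * enorm x.
Proof.
by rewrite !enormE dotrZl dotrZr mulrA -expr2 sqrtrM ?sqr_ge0// sqrtr_sqr.
Qed.

Lemma enorm0 : enorm (0 : 'rV[R]_d) = 0.
Proof. by rewrite -(scale0r 0) enormZ normr0 mul0r. Qed.

Lemma enormN x : enorm (- x) = enorm x.
Proof. by rewrite -scaleN1r enormZ normrN1 mul1r. Qed.

Lemma enormBC x y : enorm (x - y) = enorm (y - x).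
Proof. by rewrite -enormN opprB. Qed.

Lemma cauchy_schwarz x y : dotr x y <= enorm x * enorm y.
Proof.
have [/eqP x0|xn0] := boolP (enorm x == 0).
  by rewrite (enorm_eq0 x0) -(scale0r 0) dotrZl mul0r enormZ normr0 !mul0r.
have [/eqP y0|yn0] := boolP (enorm y == 0).
  by rewrite (enorm_eq0 y0) -(scale0r 0) dotrZr mul0r enormZ normr0 mul0r mulr0.
have xy0 : 0 < enorm x * enorm y by rewrite mulr_gt0// lt_neqAle eq_sym ?xn0 ?yn0/=.
have := dotr_ge0 (enorm y *: x - enorm x *: y).
rewrite !dotrBl !dotrBr !dotrZl !dotrZr -!sqr_enorm (dotrC y x) => h.
rewrite -(ler_pM2l xy0); nra.
Qed.

Lemma ler_enormD x y : enorm (x + y) <= enorm x + enorm y.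
Proof.
rewrite -(@ler_pXn2r _ 2)// ?nnegrE// ?addr_ge0// sqr_enorm.
rewrite dotrDl !dotrDr -!sqr_enorm (dotrC y x).
by have := cauchy_schwarz x y; nra.
Qed.

Lemma ler_enorm_dist y x z : enorm (x - z) <= enorm (x - y) + enorm (y - z).
Proof. by rewrite -[x - z](subrKA y) ler_enormD. Qed.

Lemma ler_enormB x y : enorm (x - y) <= enorm x + enorm y.
Proof. by rewrite (le_trans (ler_enormD _ _))// enormN. Qed.

Lemma lerB_enorm x y : enorm x - enorm y <= enorm (x - y).
Proof. by rewrite lerBlDr -[x in leLHS](subrK y) ler_enormD. Qed.

Lemma ler_dist_enorm x y : `|enorm x - enorm y| <= enorm (x - y).
Proof. by rewrite ler_norml lerB_enorm lerNl opprB enormBC lerB_enorm. Qed.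

(** Squaring turns the equality case of the triangle inequality into that of Cauchy-Schwarz, and
    then the squared norm of the difference of the two sides expands to 0. *)
Lemma enormD_eq x y : enorm (x + y) = enorm x + enorm y ->
  enorm y *: x = enorm x *: y.
Proof.
move=> /(congr1 (fun r => r ^+ 2)); rewrite sqr_enorm.
rewrite dotrDl !dotrDr -!sqr_enorm (dotrC y x) => h.
have {}h : dotr x y = enorm x * enorm y by nra.
apply/eqP; rewrite -subr_eq0; apply/eqP/enorm_eq0/eqP.
rewrite -sqrf_eq0 sqr_enorm !dotrBl !dotrBr !dotrZl !dotrZr -!sqr_enorm.
by rewrite (dotrC y x) h; apply/eqP; ring.
Qed.

Lemma ler_norm_enorm x : `|x| <= enorm x.
Proof.
rewrite [leLHS]/Num.norm/= mx_normrE; apply/bigmax_leP; split=> // -[i j] _ /=.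
by rewrite ord1 ler_coord_enorm.
Qed.

Lemma ler_coord_norm x i : `|x 0 i| <= `|x|.
Proof. by rewrite [leRHS]/Num.norm/= mx_normrE; exact: (le_bigmax _ _ (0, i)). Qed.

Lemma enorm_ler_norm x : enorm x <= d%:R * `|x|.
Proof.
rewrite -(@ler_pXn2r _ 2)// ?nnegrE ?mulr_ge0// sqr_enorm exprMn.
rewrite (@le_trans _ _ (d%:R * `|x| ^+ 2))//; last first.
  by rewrite ler_wpM2r ?sqr_ge0// -natrX ler_nat; case: (d) => // n; rewrite -mulnn leq_pmulr.
have -> : d%:R * `|x| ^+ 2 = \sum_(i < d) `|x| ^+ 2.
  by rewrite sumr_const card_ord mulr_natl.
apply: ler_sum => i _.
by rewrite -expr2 -[x 0 i ^+ 2]real_normK ?num_real// lerXn2r ?nnegrE// ler_coord_norm.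
Qed.

Lemma enorm_gt0 x : x != 0 -> 0 < enorm x.
Proof.
by move=> x0; rewrite lt_neqAle enorm_ge0 andbT eq_sym; apply: contra_neq x0; exact: enorm_eq0.
Qed.

End euclidean_norm.

#[global] Hint Extern 0 (is_true (0 <= enorm _)) => exact: enorm_ge0 : core.

(** * Integrals of nonnegative functions that are not known to be measurable *)

Section lower_integral.
Context d (T : measurableType d) (R : realType) (mu : {measure set T -> \bar R}).
Implicit Types f g : T -> \bar R.
Local Open Scope ereal_scope.

(** Needed for integrands such as [enorm (derive1 gamma t)], whose measurability is not
    established. *)
Lemma ge0_le_lower_integral (D : set T) f g :
  (forall x, D x -> 0 <= f x) -> (forall x, D x -> f x <= g x) ->
  \int[mu]_(x in D) f x <= \int[mu]_(x in D) g x.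
Proof.
move=> f0 fg; have g0 x : D x -> 0 <= g x by move=> Dx; exact: le_trans (f0 _ Dx) (fg _ Dx).
rewrite !ge0_integralE//; apply: ereal_sup_le => _ [h /= hf <-]; exists h => // x.
rewrite (le_trans (hf x))// /patch; case: ifPn => // /set_mem Dx; exact: fg.
Qed.

(* [f] need not be measurable: its integral is the supremum over the simple functions below. *)
Lemma ge0_ae_eq_lower_integral (D : set T) f g : measurable D ->
  (forall x, D x -> 0 <= f x) -> (forall x, D x -> 0 <= g x) ->
  measurable_fun D g -> {ae mu, forall x, D x -> f x = g x} ->
  \int[mu]_(x in D) f x = \int[mu]_(x in D) g x.
Proof.
move=> mD f0 g0 mg [A [mA muA0 fgA]].
have fgE x : D x -> ~ A x -> f x = g x.
  by move=> Dx nAx; apply: contrapT => fg; apply: nAx; apply: fgA => /= /(_ Dx).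
have ae_off (h : T -> \bar R)
  : (forall x, ~ A x -> D x -> g x = h x) -> {ae mu, forall x, D x -> g x = h x}.
  move=> gh; exists A; split => // x /= xgh; apply: contrapT => nAx; apply: xgh => Dx.
  exact: gh.
have mAC : measurable (~` A) by exact: measurableC.
apply/eqP; rewrite eq_le; apply/andP; split.
(* [g] outside the null set and +oo on it: measurable, almost everywhere equal to [g], and above [f]
   everywhere. *)
- pose h := (g \_ (~` A)) \+ (cst +oo \_ A).
  have hA x : A x -> h x = +oo.
    move=> Ax; rewrite /h /patch/=; case: ifPn => [/set_mem//|_].
    by rewrite mem_set// add0e.
  have hNA x : ~ A x -> h x = g x.
    move=> nAx; rewrite /h /patch/=; case: ifPn => [_|/negP[]]; last by rewrite inE.
    by rewrite memNset// adde0.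
  have -> : \int[mu]_(x in D) g x = \int[mu]_(x in D) h x.
    apply: ge0_ae_eq_integral => //.
    + by apply: emeasurable_funD; apply/measurable_restrict => //; exact: measurable_funS mg.
    + by move=> x Dx; have [/hA->//|/hNA->] := pselect (A x); exact: g0.
    + by apply: ae_off => x nAx Dx; rewrite hNA.
  apply: ge0_le_lower_integral => // x Dx.
  have [/hA->|nAx] := pselect (A x); first exact: leey.
  by rewrite hNA// fgE.
(* In the other direction, [g] set to 0 on the null set lies below [f] everywhere. *)
- have -> : \int[mu]_(x in D) g x = \int[mu]_(x in D) (g \_ (~` A)) x.
    apply: ge0_ae_eq_integral => //.
    + by apply/measurable_restrict => //; exact: measurable_funS mg.
    + by move=> x Dx; rewrite /patch; case: ifP => // _; exact: g0.
    + by apply: ae_off => x nAx Dx; rewrite /patch mem_set.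
  apply: ge0_le_lower_integral => x Dx; rewrite /patch; case: ifPn => //.
  + by move=> _; exact: g0.
  + by move=> /set_mem nAx; rewrite fgE.
  + by move=> _; exact: f0.
Qed.

End lower_integral.

(** * The velocity of a Lipschitz path *)

Section lipschitz_paths.
Context {R : realType} {d : nat}.
Notation mu := (@lebesgue_measure R).
Implicit Types (gamma : R -> 'rV[R]_d) (w : 'rV[R]_d -> R) (a b N : R).

Definition lipschitz_path gamma N := forall s t, 0 <= s <= 1 -> 0 <= t <= 1 ->
  enorm (gamma s - gamma t) <= N * `|s - t|.

Lemma derive1_approx gamma t : derivable gamma t 1 ->
  forall e, 0 < e -> exists2 r, 0 < r & forall h, `|h| < r ->
    enorm (gamma (t + h) - gamma t - h *: derive1 gamma t) <= e * `|h|.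
Proof.
move=> dg e e0.
have cg : h^-1 *: (gamma (h + t) - gamma t) @[h --> 0^'] --> derive1 gamma t.
  rewrite derive1E; move: dg => /cvg_ex[/= l gl].
  have -> : 'D_1 gamma t = l by apply: cvg_lim.
  by move: gl; under [X in X @ _ --> _ -> _]eq_fun do rewrite [_%:A]mulr1.
have d0 : 0 < d%:R + 1 :> R by rewrite ltr_wpDl.
have ed0 : 0 < e / (d%:R + 1) by rewrite divr_gt0.
have /cvgrPdist_le/(_ _ ed0) := cg.
rewrite near_withinE => /nbhs_normP[r /= r0 hr].
exists r => // h hr'; have [->|h0] := eqVneq h 0.
  by rewrite addr0 subrr scale0r subr0 enorm0 normr0 mulr0.
have hn0 : 0 < `|h| by rewrite normr_gt0.
rewrite (le_trans (enorm_ler_norm _))//.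
have := hr h; rewrite /= sub0r normrN => /(_ hr' h0).
rewrite distrC => hh.
have -> : gamma (t + h) - gamma t - h *: derive1 gamma t =
    h *: (h^-1 *: (gamma (h + t) - gamma t) - derive1 gamma t).
  by rewrite scalerBr scalerA divff// scale1r (addrC h).
rewrite normrZ (@le_trans _ _ ((d%:R + 1) * (`|h| * (e / (d%:R + 1)))))//; last first.
  by rewrite le_eqVlt; apply/orP; left; apply/eqP; field; rewrite gt_eqF.
by apply: ler_pM => //; [rewrite lerDl|rewrite ler_pM2l].
Qed.

Lemma derive1_lipschitz gamma a b N t :
  (forall s r, a <= s <= b -> a <= r <= b -> enorm (gamma s - gamma r) <= N * `|s - r|) ->
  a < t < b -> derivable gamma t 1 -> enorm (derive1 gamma t) <= N.
Proof.
move=> gN /andP[ta tb] dg; apply/ler_addgt0Pr => e e0.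
have [r r0 hr] := derive1_approx dg e0.
pose h := Num.min (r / 2) (b - t).
have h0 : 0 < h by rewrite lt_min divr_gt0//= subr_gt0.
have hr2 : h < r by rewrite gt_min ltr_pdivrMr// ltr_pMr// ltr1n.
have ht : h <= b - t by rewrite ge_min lexx orbT.
have := hr h; rewrite gtr0_norm// => /(_ hr2) hh.
have : enorm (gamma (t + h) - gamma t) <= N * `|(t + h) - t|.
  by apply: gN; apply/andP; split; lra.
rewrite addrAC subrr add0r gtr0_norm// => hN.
rewrite -(ler_pM2l h0) -[h in leLHS](gtr0_norm h0) -enormZ.
rewrite -[_ *: _](subrK (gamma (t + h) - gamma t)).
rewrite (le_trans (ler_enormD _ _))// [enorm (_ - (_ - _))]enormBC; lra.
Qed.

(** Nothing is known about a path outside [0, 1]. Composing with this 1-Lipschitz retraction makes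
    it continuous on the whole line without changing it on [0, 1]. *)
Definition clamp01 (t : R) : R := Num.max 0 (Num.min 1 t).

Lemma clamp01_id t : 0 <= t <= 1 -> clamp01 t = t.
Proof. by move=> /andP[t0 t1]; rewrite /clamp01 (min_idPr t1) (max_idPr t0). Qed.

Lemma clamp01_itv t : 0 <= clamp01 t <= 1.
Proof. by rewrite /clamp01 le_max lexx/= ge_max ler01 ge_min lexx. Qed.

Lemma clamp01_lip s t : `|clamp01 s - clamp01 t| <= `|s - t|.
Proof.
have H x : [\/ x <= 0 /\ clamp01 x = 0, 1 <= x /\ clamp01 x = 1 |
    (0 <= x /\ x <= 1) /\ clamp01 x = x].
  have [x0|x0] := leP x 0.
    by constructor 1; rewrite /clamp01 (min_idPr _) ?(max_idPl x0)// (le_trans x0).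
  have [x1|x1] := leP 1 x; first by constructor 2; rewrite /clamp01 (min_idPl x1) (max_idPr _).
  by constructor 3; split; [split; exact: ltW|rewrite clamp01_id// !ltW].
have h1 := ler_norm (s - t); have h2 := ler_norm (t - s); rewrite distrC in h2.
by case: (H s) => -[]; [move=> ? ->|move=> ? ->|move=> [? ?] ->];
  case: (H t) => -[]; try (move=> [? ?] ->; rewrite ler_norml; apply/andP; split; lra);
  move=> ? ->; rewrite ler_norml; apply/andP; split; lra.
Qed.

Lemma lipschitz_path_ge0 gamma N : lipschitz_path gamma N -> 0 <= N.
Proof.
move=> /(_ 0 1); rewrite !lexx ler01 sub0r normrN1 mulr1 => /(_ isT isT).
exact: le_trans.
Qed.

(** Each clamped coordinate is a Lipschitz function on the line; there are finitely many, so almost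
    every time is good for all of them at once. *)
Lemma lipschitz_path_speed gamma N : lipschitz_path gamma N ->
  exists G : R -> 'rV[R]_d,
  [/\ (forall i, measurable_fun setT (fun t => G t 0 i)),
      {ae mu, forall t, 0 < t < 1 -> derivable gamma t 1 /\ derive1 gamma t = G t} &
      forall u a b, 0 <= a -> a <= b -> b <= 1 ->
        mu.-integrable `]a, b] (EFin \o (fun t => dotr u (G t))) /\
        dotr u (gamma b - gamma a) = \int[mu]_(t in `]a, b]) dotr u (G t)].
Proof.
move=> gN; have N0 := lipschitz_path_ge0 gN.
pose f i t := gamma (clamp01 t) 0 i.
have fN i s t : `|f i s - f i t| <= N * `|s - t|.
  have -> : f i s - f i t = (gamma (clamp01 s) - gamma (clamp01 t)) 0 i by rewrite !mxE.
  rewrite (le_trans (ler_coord_enorm _ _))// (le_trans (gN _ _ _ _)) ?clamp01_itv//.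
  by rewrite ler_wpM2l// clamp01_lip.
have [g gP] := choice (fun i => lipschitz_FTC (fN i)).
pose G t := \row_i g i t.
have GE i t : G t 0 i = g i t by rewrite mxE.
exists G; split.
- move=> i; have [mg _ _ _] := gP i.
  by under eq_fun do rewrite GE.
- have FF : Filter (almost_everywhere mu) by exact: (ae_filter_ringOfSetsType mu).
  have : {ae mu, forall t, forall i, 0 < t < 1 -> derivable (f i) t 1 /\ derive1 (f i) t = g i t}.
    by apply: filter_forall => i; have [_ _ _] := gP i.
  apply: filterS => t dfi t01.
  have [t0 t1] := andP t01.
  have nearE : {near t, gamma \o clamp01 =1 gamma}.
    near=> y; rewrite /= clamp01_id//.
    apply/andP; split; apply/ltW; near: y; [exact: lt_nbhsr|exact: lt_nbhsl].
  have dgc : derivable (gamma \o clamp01) t 1.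
    by apply/derivable_mxP => i j; rewrite ord1; have [] := dfi j t01.
  split; first exact: (near_eq_derivable nearE dgc).
  rewrite derive1E -(near_eq_derive _ nearE) derive_mx//.
  by apply/rowP => j; rewrite !mxE -derive1E; have [] := dfi j t01.
- move=> u a b a0 ab b1.
  have sab : `]a, b]%classic `<=` `[0, 1]%classic.
    move=> t /=; rewrite !in_itv/= => /andP[ta tb].
    by rewrite (le_trans a0 (ltW ta)) (le_trans tb).
  have mab : measurable (`]a, b]%classic : set (measurableTypeR R)) by exact: measurable_itv.
  have ig i : mu.-integrable `]a, b] (EFin \o g i).
    by have [_ ig _ _] := gP i; apply: integrableS ig => //; exact: measurable_itv.
  have iug i : mu.-integrable `]a, b] (fun t => (u 0 i * g i t)%:E).
    by apply: eq_integrable (integrableZl mab (u 0 i) (ig i)).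
  have dE t : (dotr u (G t))%:E = (\sum_(i < d) (u 0 i * g i t)%:E)%E.
    by rewrite sumEFin; congr EFin; apply: eq_bigr => i _; rewrite GE.
  split.
    have := @integrable_sum _ _ _ mu _ mab _ (index_enum _) xpredT _ (fun i _ => iug i).
    by apply: eq_integrable => // t _; rewrite /= dE.
  rewrite /Rintegral; under eq_integral do rewrite dE.
  rewrite integral_sum// -sum_fine; last first.
    by move=> i _; exact: integrable_fin_num (iug i).
  apply: eq_bigr => i _; rewrite -/(Rintegral _ _ _) RintegralZl//.
  have [_ _ gE _] := gP i.
  by rewrite -gE// !mxE /f !clamp01_id// ?a0 ?b1 ?(le_trans ab) ?(le_trans a0).
Unshelve. all: by end_near. Qed.

Lemma measurable_enorm (G : R -> 'rV[R]_d) :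
  (forall i, measurable_fun setT (fun t => G t 0 i)) ->
  measurable_fun setT (fun t => enorm (G t)).
Proof.
move=> mG; have mS : measurable_fun setT (fun t => \sum_(i < d) G t 0 i ^+ 2).
  by apply: measurable_sum => i; apply: measurable_funX; exact: mG.
exact: measurableT_comp (continuous_measurable_fun (@sqrt_continuous R)) mS.
Qed.

(** The velocity is set to 0 where it exceeds [N]. This happens only on a null set, and the bound
    then holds at every time, which makes all later integrands bounded. *)
Lemma lipschitz_path_bounded_speed gamma N : lipschitz_path gamma N ->
  exists G : R -> 'rV[R]_d,
  [/\ (forall i, measurable_fun setT (fun t => G t 0 i)),
      (forall t, enorm (G t) <= N),
      {ae mu, forall t, 0 < t < 1 -> derivable gamma t 1 /\ derive1 gamma t = G t} &
      forall u a b, 0 <= a -> a <= b -> b <= 1 ->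
        dotr u (gamma b - gamma a) = \int[mu]_(t in `]a, b[) dotr u (G t)].
Proof.
move=> gN; have N0 := lipschitz_path_ge0 gN.
have [G [mG aeG GE]] := lipschitz_path_speed gN.
pose G' t := if enorm (G t) <= N then G t else 0.
have FF : Filter (almost_everywhere mu) by exact: (ae_filter_ringOfSetsType mu).
have aeG' : {ae mu, forall t, 0 < t < 1 ->
    [/\ derivable gamma t 1, derive1 gamma t = G t & G t = G' t]}.
  apply: filterS aeG => t dG t01; have [dg gG] := dG t01; split=> //.
  by rewrite /G' -gG (derive1_lipschitz gN).
have G'E i t : G' t 0 i = if enorm (G t) <= N then G t 0 i else 0.
  by rewrite /G'; case: ifP => //; rewrite mxE.
have mG' i : measurable_fun setT (fun t => G' t 0 i).
  under eq_fun do rewrite G'E.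
  apply: measurable_fun_ifT => //.
  by apply: measurable_fun_ler => //; exact: measurable_enorm.
exists G'; split => //.
- by move=> t; rewrite /G'; case: ifP => //; rewrite enorm0.
- by apply: filterS aeG' => t h /h[? -> ->].
- move=> u a b a0 ab b1.
  have mdot (H : R -> 'rV[R]_d) : (forall i, measurable_fun setT (fun t => H t 0 i)) ->
      measurable_fun setT (fun t => dotr u (H t)).
    by move=> mH; apply: measurable_sum => i; apply: measurable_funM.
  have [iG ->] := GE u a b a0 ab b1.
  rewrite -Rintegral_itv_bndo_bndc; last first.
    by apply: integrableS iG => //; exact: subset_itv_oo_oc.
  rewrite /Rintegral; congr fine; apply: ae_eq_integral => //.
  + by apply: measurable_funTS; apply/measurable_EFinP; exact: mdot.
  + by apply: measurable_funTS; apply/measurable_EFinP; exact: mdot.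
  + apply: filterS aeG' => t + /=; rewrite in_itv/= => h /andP[ta tb].
    by have [|_ _ ->] := h; first by rewrite (le_lt_trans a0 ta) (lt_le_trans tb b1).
Qed.

End lipschitz_paths.

(** * Weighted length *)

Section weighted_length.
Context {R : realType} {d : nat}.
Notation mu := (@lebesgue_measure R).
Implicit Types (gamma : R -> 'rV[R]_d) (w : 'rV[R]_d -> R) (a b N : R).

(** A real number, so that lengths can be added and subtracted; by [wlenE] nothing is lost in [fine]
    for a Lipschitz path on a subinterval of [0, 1]. The Euclidean length is the case of the
    constant weight 1. *)
Definition wlen w gamma a b : R :=
  fine (\int[mu]_(t in `]a, b[) (w (gamma t) * enorm (derive1 gamma t))%:E)%E.

Definition weight w := continuous w /\ forall z, 0 <= w z.

Lemma weight1 : weight (fun=> 1).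
Proof. by split=> // z; exact: cst_continuous. Qed.

Lemma lipschitz_path_clamp_continuous gamma N : lipschitz_path gamma N ->
  continuous (gamma \o clamp01).
Proof.
move=> gN; have N0 := lipschitz_path_ge0 gN.
apply: (@normed_lipschitz_continuous _ R^o 'rV[R]_d _ N) => s t.
rewrite (le_trans (ler_norm_enorm _))// (le_trans (gN _ _ _ _)) ?clamp01_itv//.
by rewrite ler_wpM2l// clamp01_lip.
Qed.

Lemma lipschitz_path_comp_continuous w gamma N : weight w -> lipschitz_path gamma N ->
  {within `[0, 1], continuous (w \o gamma)}.
Proof.
move=> [wc _] gN.
have cc : continuous (w \o (gamma \o clamp01)).
  move=> t; apply: continuous_comp; last exact: wc.
  exact: lipschitz_path_clamp_continuous gN t.
apply: (subspace_eq_continuous (f := w \o (gamma \o clamp01))).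
  by move=> t; rewrite inE/= in_itv/= => t01; rewrite /= clamp01_id.
exact: continuous_subspaceT.
Qed.

Lemma bounded_integrable_itv (D : set R) (f : R -> R) (C a b : R) :
  D = `]a, b[%classic -> measurable_fun D f -> (forall t, D t -> `|f t| <= C) ->
  mu.-integrable D (EFin \o f).
Proof.
move=> -> mf fC; apply: measurable_bounded_integrable => //.
- by rewrite [X in (X < _)%E]lebesgue_measure_itv/=; case: ifP => _; rewrite ?ltry// -EFinB ltry.
- exists C; split; first exact: num_real.
  by move=> x hx t Dt /=; rewrite (le_trans (fC t Dt))// ltW.
Qed.

(** A single measurable and bounded version [v] of the speed serves all weights and all
    subintervals; the properties of [wlen] below are read off from it. *)
Lemma wlen_repr gamma N : lipschitz_path gamma N -> exists v : R -> R,
  [/\ measurable_fun setT v, (forall t, 0 <= v t <= N),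
      {ae mu, forall t, 0 < t < 1 ->
         derivable gamma t 1 /\ enorm (derive1 gamma t) = v t},
      (forall w a b, weight w -> 0 <= a -> a <= b -> b <= 1 ->
        mu.-integrable `]a, b[ (EFin \o (fun t => w (gamma t) * v t)) /\
        (\int[mu]_(t in `]a, b[) (w (gamma t) * enorm (derive1 gamma t))%:E)%E =
        (\int[mu]_(t in `]a, b[) (w (gamma t) * v t))%:E) &
      forall a b, 0 <= a -> a <= b -> b <= 1 ->
        enorm (gamma b - gamma a) <= \int[mu]_(t in `]a, b[) v t].
Proof.
move=> gN; have [G [mG GN aeG GE]] := lipschitz_path_bounded_speed gN.
have mv := measurable_enorm mG.
have FF : Filter (almost_everywhere mu) by exact: (ae_filter_ringOfSetsType mu).
have wcc w : weight w -> {within `[0, 1], continuous (w \o gamma)}.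
  by move=> hw; exact: lipschitz_path_comp_continuous gN.
have bnd w : weight w -> exists C, forall t, 0 <= t <= 1 -> w (gamma t) <= C.
  move=> hw; have [c _ cmax] := EVT_max ler01 (wcc w hw).
  by exists (w (gamma c)) => t t01; apply: cmax; rewrite in_itv.
have iw w a b : weight w -> 0 <= a -> a <= b -> b <= 1 ->
    mu.-integrable `]a, b[ (EFin \o (fun t => w (gamma t) * enorm (G t))).
  move=> hw a0 ab b1; have [C hC] := bnd w hw.
  have sab : `]a, b[%classic `<=` `[0, 1]%classic.
    move=> t /=; rewrite !in_itv/= => /andP[ta tb].
    by rewrite (le_trans a0 (ltW ta)) (le_trans (ltW tb)).
  apply: (@bounded_integrable_itv _ _ (C * N) a b) => //.
  - apply: measurable_funM; last exact: measurable_funTS.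
    apply: measurable_funS sab _ => //.
    by apply: subspace_continuous_measurable_fun; [exact: measurable_itv|exact: wcc].
  - move=> t /sab; rewrite /= in_itv/= => t01; have [_ w0] := hw.
    by rewrite ger0_norm ?mulr_ge0// ler_pM//; exact: hC.
exists (fun t => enorm (G t)); split => //.
- by move=> t; rewrite enorm_ge0 GN.
- by apply: filterS aeG => t h /h[? ->].
- move=> w a b hw a0 ab b1; have ii := iw w a b hw a0 ab b1; split => //.
  rewrite /Rintegral fineK; last by apply: integrable_fin_num => //; exact: measurable_itv.
  have [_ w0] := hw.
  apply: ge0_ae_eq_lower_integral.
  + exact: measurable_itv.
  + by move=> t _; rewrite lee_fin mulr_ge0.
  + by move=> t _; rewrite lee_fin mulr_ge0.
  + exact: measurable_int ii.
  + apply: filterS aeG => t + /=; rewrite in_itv/= => h /andP[ta tb].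
    by have [|_ ->//] := h; rewrite (le_lt_trans a0 ta) (lt_le_trans tb b1).
(* Testing the velocity against the chord [u] itself: |u|^2 is the integral of [dotr u (G t)], hence
   at most |u| times the integral of the speed. *)
- move=> a b a0 ab b1; set u := gamma b - gamma a.
  have [u0|un0] := eqVneq u 0.
    by rewrite u0 enorm0; apply: Rintegral_ge0 => t _.
  have u_gt0 : 0 < enorm u by exact: enorm_gt0.
  rewrite -(ler_pM2l u_gt0) -expr2 sqr_enorm (GE u a b)//.
  have i1 : mu.-integrable `]a, b[ (EFin \o (fun t => enorm (G t))).
    by have := iw _ a b weight1 a0 ab b1; apply: eq_integrable => [|t _ /=]; rewrite ?mul1r//;
      exact: measurable_itv.
  rewrite -RintegralZl//.
  have mI : measurable (`]a, b[%classic : set (measurableTypeR R)) by exact: measurable_itv.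
  apply: le_Rintegral => //.
  + apply: (@bounded_integrable_itv _ _ (enorm u * N) a b) => //.
      apply: measurable_funTS; apply: measurable_sum => i; exact: measurable_funM.
    move=> t _; rewrite ler_norml lerNl -dotrNl -[enorm u in X in X && _]enormN.
    by rewrite !(le_trans (cauchy_schwarz _ _))// ler_wpM2l.
  + by apply: eq_integrable (integrableZl mI (enorm u) i1).
  + by move=> t _; exact: cauchy_schwarz.
Qed.

Section wlen_theory.
Variables (gamma : R -> 'rV[R]_d) (N : R).
Hypothesis gN : lipschitz_path gamma N.

Lemma wlenE w a b : weight w -> 0 <= a -> a <= b -> b <= 1 ->
  (\int[mu]_(t in `]a, b[) (w (gamma t) * enorm (derive1 gamma t))%:E)%E =
  (wlen w gamma a b)%:E.
Proof.
move=> hw a0 ab b1; have [v [_ _ _ vE _]] := wlen_repr gN.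
by have [_ E] := vE w a b hw a0 ab b1; rewrite /wlen E.
Qed.

Lemma wlen_ge0 w a b : weight w -> 0 <= wlen w gamma a b.
Proof.
move=> [_ w0]; apply/fine_ge0/integral_ge0 => t _.
by rewrite lee_fin mulr_ge0.
Qed.

Lemma wlen_refl w a : wlen w gamma a a = 0.
Proof. by rewrite /wlen set_itv_ge ?integral_set0// bnd_simp ltxx. Qed.

Lemma wlenD w a b c : weight w -> 0 <= a -> a <= b -> b <= c -> c <= 1 ->
  wlen w gamma a c = wlen w gamma a b + wlen w gamma b c.
Proof.
move=> hw a0 ab; rewrite le_eqVlt => /predU1P[-> _|bc c1].
  by rewrite wlen_refl addr0.
have [v [_ _ _ vE _]] := wlen_repr gN.
have [ac b0 b1] : [/\ a <= c, 0 <= b & b <= 1].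
  by split; rewrite ?(le_trans ab) ?(le_trans a0) ?(le_trans _ c1) ?(ltW bc).
have [iac] := vE w a c hw a0 ac c1; rewrite /wlen => ->.
have [iab ->] := vE w a b hw a0 ab b1.
have [ibc ->] := vE w b c hw b0 (ltW bc) c1; rewrite [LHS]/= [fine _ in RHS]/=.
rewrite -(Rintegral_itvB (x := b) iac) ?bnd_simp//= [X in _ = _ + (_ - X)]/=.
by rewrite (Rintegral_itv_bndo_bndc iab) addrC subrK.
Qed.

Lemma wlen_lb w a b (c : R) : weight w -> 0 <= a -> a <= b -> b <= 1 ->
  (forall t, a < t < b -> c <= w (gamma t)) ->
  c * wlen (fun=> 1) gamma a b <= wlen w gamma a b.
Proof.
move=> hw a0 ab b1 cw; have [v [_ v0 _ vE _]] := wlen_repr gN.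
have [i1 E1] := vE _ a b weight1 a0 ab b1; have [iw Ew] := vE w a b hw a0 ab b1.
have mI : measurable (`]a, b[%classic : set (measurableTypeR R)) by exact: measurable_itv.
rewrite /wlen E1 Ew [fine _]/= [fine _ in leRHS]/= -RintegralZl//; apply: le_Rintegral => //.
  by apply: eq_integrable (integrableZl mI c i1).
move=> t; rewrite /= in_itv/= => /andP[ta tb]; rewrite mul1r ler_wpM2r//.
  by have /andP[] := v0 t.
by apply: cw; rewrite ta tb.
Qed.

Lemma wlen_ub w a b (c : R) : weight w -> 0 <= a -> a <= b -> b <= 1 ->
  (forall t, a <= t <= b -> w (gamma t) <= c) ->
  wlen w gamma a b <= c * wlen (fun=> 1) gamma a b.
Proof.
move=> hw a0 ab b1 cw; have [v [_ v0 _ vE _]] := wlen_repr gN.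
have [i1 E1] := vE _ a b weight1 a0 ab b1; have [iw Ew] := vE w a b hw a0 ab b1.
have mI : measurable (`]a, b[%classic : set (measurableTypeR R)) by exact: measurable_itv.
rewrite /wlen E1 Ew [fine _]/= [fine _ in leRHS]/= -RintegralZl//; apply: le_Rintegral => //.
  by apply: eq_integrable (integrableZl mI c i1).
move=> t; rewrite /= in_itv/= => /andP[ta tb]; rewrite mul1r ler_wpM2r//.
  by have /andP[] := v0 t.
by apply: cw; rewrite !ltW.
Qed.

Lemma chord_le_wlen a b : 0 <= a -> a <= b -> b <= 1 ->
  enorm (gamma b - gamma a) <= wlen (fun=> 1) gamma a b.
Proof.
move=> a0 ab b1; have [v [_ v0 _ vE hv]] := wlen_repr gN.
have [i1 E1] := vE _ a b weight1 a0 ab b1.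
rewrite (le_trans (hv _ _ a0 ab b1))// /wlen E1/=.
by under [leRHS]eq_Rintegral do rewrite mul1r.
Qed.

Lemma wlen1_le a b (K : R) : 0 <= a -> a <= b -> b <= 1 ->
  (forall s t, a <= s <= b -> a <= t <= b -> enorm (gamma s - gamma t) <= K * `|s - t|) ->
  wlen (fun=> 1) gamma a b <= K * (b - a).
Proof.
move=> a0 ab b1 gK; have [v [mv v0 aev vE hv]] := wlen_repr gN.
have FF : Filter (almost_everywhere mu) by exact: (ae_filter_ringOfSetsType mu).
have [->|neq_ab] := eqVneq a b.
  by rewrite wlen_refl subrr mulr0.
have {}ab : a < b by rewrite lt_neqAle neq_ab.
have K0 : 0 <= K.
  have := gK a b; rewrite !lexx (ltW ab) => /(_ isT isT) /(le_trans (enorm_ge0 _)).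
  by rewrite pmulr_lge0// normr_gt0 subr_eq0.
rewrite -lee_fin -wlenE ?(ltW ab)//; last exact: weight1.
have -> : (K * (b - a))%:E = (\int[mu]_(t in `]a, b[) (cst K%:E) t)%E.
  rewrite integral_cst// [X in (_ * X)%E](lebesgue_measure_itv `]a, b[) /= lte_fin ab.
  by rewrite -EFinB -EFinM.
(* [K] is a Lipschitz constant on [a, b] only, so [v] is at most [K] almost everywhere there;
   truncation makes this hold everywhere. *)
pose f t := (Num.min (v t) K)%:E.
rewrite (@ge0_ae_eq_lower_integral _ _ _ mu _ _ f)//.
- apply: ge0_le_lower_integral => t _; rewrite /f lee_fin.
    by rewrite le_min K0 andbT; have /andP[] := v0 t.
  by rewrite ge_min lexx orbT.
- by move=> t _; rewrite lee_fin mul1r.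
- by move=> t _; rewrite /f lee_fin le_min K0 andbT; have /andP[] := v0 t.
- apply/measurable_EFinP; apply: measurable_funTS; exact: measurable_minr.
- apply: filterS aev => t + /=; rewrite in_itv/= => h /andP[ta tb].
  have [|dg E] := h; first by rewrite (le_lt_trans a0 ta) (lt_le_trans tb b1).
  rewrite /f mul1r -E.
  by rewrite (min_idPl _)// (derive1_lipschitz gK)// ta.
Qed.

Lemma wlen1_lip a b : 0 <= a -> a <= b -> b <= 1 ->
  wlen (fun=> 1) gamma a b <= N * (b - a).
Proof.
move=> a0 ab b1; apply: wlen1_le => // s t /andP[sa sb] /andP[ta tb].
by apply: gN; rewrite (le_trans a0) ?(le_trans _ b1).
Qed.

Lemma wlen_sum w (tau : nat -> R) n : weight w -> 0 <= tau 0%N -> tau n <= 1 ->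
  (forall i, (i < n)%N -> tau i <= tau i.+1) ->
  \sum_(i < n) wlen w gamma (tau i) (tau i.+1) = wlen w gamma (tau 0%N) (tau n).
Proof.
move=> hw t0; elim: n => [|n IH] t1 tS.
  by rewrite big_ord0 wlen_refl.
have tn : tau n <= 1 by rewrite (le_trans (tS n _)).
have t0n : tau 0%N <= tau n.
  elim: (n) tS => // k IHk tS; rewrite (le_trans (IHk _)) ?tS// => i ik.
  by apply: tS; rewrite ltnW.
rewrite big_ord_recr/= IH//; last by move=> i ik; apply: tS; rewrite ltnW.
by rewrite -wlenD// tS.
Qed.

(** On each cell the weight is at least its value at the left end minus [e], and the length is at
    least the chord. The subdivision is arbitrary because [admissible_reparam] applies this to a
    non-uniform one. *)
Lemma riemann_le_wlen w (tau : nat -> R) n (e : R) : weight w ->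
  0 <= tau 0%N -> tau n <= 1 -> (forall i, (i < n)%N -> tau i <= tau i.+1) ->
  (forall i t, (i < n)%N -> tau i <= t <= tau i.+1 -> w (gamma (tau i)) <= w (gamma t) + e) ->
  \sum_(i < n) w (gamma (tau i)) * enorm (gamma (tau i.+1) - gamma (tau i)) <=
  wlen w gamma (tau 0%N) (tau n) + e * wlen (fun=> 1) gamma (tau 0%N) (tau n).
Proof.
move=> hw t0 t1 tS we; rewrite -!(wlen_sum (n := n))//; last exact: weight1.
rewrite mulr_sumr -big_split/=; apply: ler_sum => i _.
have [_ w0] := hw.
have mono k j : (k <= j <= n)%N -> tau k <= tau j.
  move=> /andP[kj jn]; rewrite -(subnKC kj) in jn *; elim: (j - k)%N jn => [|m IH] jn.
    by rewrite addn0.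
  by rewrite addnS in jn *; rewrite (le_trans (IH _)) ?tS// ltnW.
have i0 : 0 <= tau i by apply: (le_trans t0); apply: mono; rewrite /= ltnW.
have i1 : tau i.+1 <= 1 by apply: le_trans t1; apply: mono; rewrite leqnn ltn_ord.
have iS : tau i <= tau i.+1 by exact: tS.
apply: (@le_trans _ _ (w (gamma (tau i)) * wlen (fun=> 1) gamma (tau i) (tau i.+1))).
  by rewrite ler_wpM2l// chord_le_wlen.
rewrite -lerBlDr -mulrBl; apply: wlen_lb => // t /andP[ht1 ht2].
by rewrite lerBlDr; apply: we => //; rewrite !ltW.
Qed.

End wlen_theory.

End weighted_length.

(** * Approximation of weighted lengths by chord sums; straight paths *)

Section riemann_sums.
Context {R : realType} {d : nat}.
Notation mu := (@lebesgue_measure R).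
Implicit Types (gamma : R -> 'rV[R]_d) (w : 'rV[R]_d -> R) (a b N : R).
Lemma limn_einf_le (u : (\bar R)^nat) (c : \bar R) n0 :
  (forall n, (n0 <= n)%N -> (u n <= c)%E) -> (limn_einf u <= c)%E.
Proof.
move=> uc; rewrite limn_einf_lim; apply: lime_le; first exact: is_cvg_einfs.
near=> n; apply: le_trans (uc n _); last by near: n; exact: nbhs_infty_ge.
by apply: ereal_inf_lbound; exists n => /=.
Unshelve. all: by end_near. Qed.

Lemma eq_wlen w gamma1 gamma2 a b :
  (forall t, a <= t <= b -> gamma1 t = gamma2 t) ->
  wlen w gamma1 a b = wlen w gamma2 a b.
Proof.
move=> g12; apply: (congr1 fine); apply: eq_integral => t.
rewrite inE/= in_itv/= => /andP[ta tb].
have nearE : {near t, gamma1 =1 gamma2}.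
  near=> y; apply: g12; apply/andP; split; apply/ltW; near: y.
    exact: lt_nbhsr.
  exact: lt_nbhsl.
have -> : gamma1 t = gamma2 t by apply: g12; rewrite (ltW ta) (ltW tb).
have -> // : derive1 gamma1 t = derive1 gamma2 t.
by rewrite (derive1E gamma1) (derive1E gamma2); exact: near_eq_derive.
Unshelve. all: by end_near. Qed.

Definition riemann_sum w gamma n : R :=
  \sum_(i < n) w (gamma (i%:R / n%:R)) *
    enorm (gamma (i.+1%:R / n%:R) - gamma (i%:R / n%:R)).

(** The secants straddle [t] instead of starting there: the remainders at the two ends are at most
    [e] times their distances to [t], and these distances add up to the length of the interval. *)
Lemma derive1_secants gamma t (r s : nat -> R) : derivable gamma t 1 ->
  (forall n, r n <= t <= s n) -> (forall n, s n - r n = n.+1%:R^-1) ->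
  n.+1%:R * enorm (gamma (s n) - gamma (r n)) @[n --> \oo] --> enorm (derive1 gamma t).
Proof.
move=> dg rts sr; apply/cvgrPdist_le => e e0.
have [h h0 hh] := derive1_approx dg e0.
near=> n.
have nh : n.+1%:R^-1 < h by near: n; exact: near_infty_natSinv_lt (PosNum h0).
have n0 : 0 < n.+1%:R :> R by [].
have /andP[rt ts] := rts n; have srn := sr n.
have hs := hh (s n - t); rewrite ger0_norm ?subr_ge0// subrKC in hs.
have hr := hh (r n - t); rewrite ler0_norm ?subr_le0// subrKC opprB in hr.
have {}hs := hs (le_lt_trans (_ : _ <= n.+1%:R^-1) nh).
have {}hr := hr (le_lt_trans (_ : _ <= n.+1%:R^-1) nh).
have {}hs : enorm (gamma (s n) - gamma t - (s n - t) *: derive1 gamma t) <= e * (s n - t).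
  by apply: hs; rewrite -srn lerD2l lerN2.
have {}hr : enorm (gamma (r n) - gamma t - (r n - t) *: derive1 gamma t) <= e * (t - r n).
  by apply: hr; rewrite -srn lerD2r.
rewrite -[n.+1%:R]gtr0_norm// -enormZ (le_trans (ler_dist_enorm _ _))//.
have -> : derive1 gamma t - n.+1%:R *: (gamma (s n) - gamma (r n)) =
   n.+1%:R *: ((gamma (r n) - gamma t - (r n - t) *: derive1 gamma t) -
     (gamma (s n) - gamma t - (s n - t) *: derive1 gamma t)).
  apply/rowP => i; rewrite !mxE.
  have E : n.+1%:R * (s n - r n) = 1 :> R by rewrite srn divff ?gt_eqF.
  by rewrite -[X in X - _ = _]mul1r -[X in X * _ - _]E; ring.
rewrite enormZ gtr0_norm// -ler_pdivlMl//.
rewrite (le_trans (ler_enormB _ _))// (le_trans (lerD hr hs))// -mulrDr.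
rewrite (_ : t - r n + (s n - t) = n.+1%:R^-1) 1?mulrC// -srn; ring.
Unshelve. all: by end_near. Qed.

(** Half-open, so that each time of [0, 1[ lies in exactly one cell. *)
Definition riemann_cell (n i : nat) : set R := `[i%:R / n.+1%:R, i.+1%:R / n.+1%:R[%classic.

(** The step function whose integral is the Riemann sum; the factor [n.+1] compensates the length of
    a cell and turns chords into difference quotients. *)
Definition riemann_step w gamma n (t : R) : R := \sum_(i < n.+1)
  (n.+1%:R * (w (gamma (i%:R / n.+1%:R)) *
    enorm (gamma (i.+1%:R / n.+1%:R) - gamma (i%:R / n.+1%:R)))) *
  \1_(riemann_cell n i) t.

Lemma riemann_cellP n i t : 0 <= t -> riemann_cell n i t <-> Num.truncn (t * n.+1%:R) = i.
Proof.
move=> t0; rewrite /riemann_cell/= in_itv/=.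
have n0 : 0 < n.+1%:R :> R by [].
rewrite ler_pdivrMr// ltr_pdivlMr//; split.
  by move=> h; apply: truncn_def.
by move=> <-; apply: truncn_itv; rewrite mulr_ge0.
Qed.

Lemma riemann_stepE w gamma n t : 0 < t < 1 ->
  let i := Num.truncn (t * n.+1%:R) in
  riemann_step w gamma n t = w (gamma (i%:R / n.+1%:R)) *
    (n.+1%:R * enorm (gamma (i.+1%:R / n.+1%:R) - gamma (i%:R / n.+1%:R))).
Proof.
move=> /andP[t0 t1] i.
have n0 : 0 < n.+1%:R :> R by [].
have i_n : (i < n.+1)%N.
  rewrite -(ltr_nat R); have /(riemann_cellP n i (ltW t0)) : Num.truncn (t * n.+1%:R) = i by [].
  rewrite /riemann_cell/= in_itv/= ler_pdivrMr// => /andP[h _].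
  by rewrite (le_lt_trans h)// gtr_pMl.
rewrite /riemann_step (bigD1 (Ordinal i_n))//= [X in _ + X]big1 ?addr0 => [|j ji].
  rewrite indicE mem_set ?mulr1; first by ring.
  by apply/(riemann_cellP n i (ltW t0)).
rewrite indicE memNset ?mulr0// => /(riemann_cellP n j (ltW t0)) E.
by move/eqP: ji; apply; apply/val_inj; rewrite /= -E.
Qed.

Lemma riemann_step_ge0 w gamma n t : weight w -> 0 <= riemann_step w gamma n t.
Proof.
by move=> [_ w0]; apply: sumr_ge0 => i _; rewrite !mulr_ge0// indicE.
Qed.

Lemma measurable_riemann_step w gamma n D : measurable_fun D (riemann_step w gamma n).
Proof.
apply: measurable_funTS; apply: measurable_sum => i; apply: measurable_funM => //.
by apply: measurable_indic; exact: measurable_itv.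
Qed.

Lemma integral_riemann_step w gamma n : weight w ->
  (\int[mu]_t (riemann_step w gamma n t)%:E)%E = (riemann_sum w gamma n.+1)%:E.
Proof.
move=> [_ w0]; have n0 : 0 < n.+1%:R :> R by [].
rewrite /riemann_step; under eq_integral do rewrite -sumEFin.
have mc i : measurable (riemann_cell n i : set (measurableTypeR R)) by exact: measurable_itv.
rewrite ge0_integral_sum//; last 2 first.
- by move=> i; apply/measurable_EFinP; apply: measurable_funM.
- by move=> i t _; rewrite lee_fin !mulr_ge0// indicE.
rewrite /riemann_sum -sumEFin; apply: eq_bigr => i _.
set c := (X in n.+1%:R * X); have c0 : 0 <= c by rewrite mulr_ge0.
rewrite -/c; apply: (etrans (@integralZl_indic _ (measurableTypeR R) _ mu setT measurableT
    (fun=> riemann_cell n i) (n.+1%:R * c) _ (mc i))).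
  by move=> /lt_geF; rewrite mulr_ge0.
rewrite integral_indic// setIT.
rewrite [X in (_ * X)%E](lebesgue_measure_itv `[i%:R / n.+1%:R, i.+1%:R / n.+1%:R[) /=.
rewrite lte_fin ltr_pM2r ?invr_gt0// ltr_nat ltnSn -EFinB -EFinM; congr EFin.
by rewrite -mulrBl -natrB// subSnn; field; rewrite gt_eqF.
Qed.

Lemma riemann_step_cvg w gamma N t : lipschitz_path gamma N -> weight w ->
  0 < t < 1 -> derivable gamma t 1 ->
  riemann_step w gamma n t @[n --> \oo] --> w (gamma t) * enorm (derive1 gamma t).
Proof.
move=> gN [wc _] t01 dg; have /andP[t0 t1] := t01.
pose i n := Num.truncn (t * n.+1%:R).
pose r n : R := (i n)%:R / n.+1%:R; pose s n : R := (i n).+1%:R / n.+1%:R.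
have n0 n : 0 < n.+1%:R :> R by [].
have rts n : r n <= t <= s n.
  have /(riemann_cellP n (i n) (ltW t0)) : Num.truncn (t * n.+1%:R) = i n by [].
  by rewrite /riemann_cell/= in_itv/= => /andP[-> /ltW].
have srn n : s n - r n = n.+1%:R^-1.
  by rewrite /s /r -mulrBl -natrB// subSnn mul1r.
rewrite (_ : (fun n => _) = (fun n
  => w (gamma (r n)) * (n.+1%:R * enorm (gamma (s n) - gamma (r n))))); last first.
  by apply/funext => n; rewrite riemann_stepE.
apply: cvgM; last exact: derive1_secants.
apply: (@continuous_cvg _ _ _ _ _ _ w); first exact: wc.
apply/cvgrPdist_le => e e0.
have N0 := lipschitz_path_ge0 gN.
have N1 : 0 < N + 1 by rewrite ltr_wpDl.
have h0 : 0 < (N + 1)^-1 * e by rewrite mulr_gt0 ?invr_gt0.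
near=> n.
have r01 : 0 <= r n <= 1.
  rewrite divr_ge0//=; have /andP[rt _] := rts n.
  by rewrite (le_trans rt)// ltW.
rewrite (le_trans (ler_norm_enorm _))// (le_trans (gN _ _ _ _))// ?(ltW t0) ?(ltW t1)//.
have /andP[rt ts] := rts n.
rewrite ger0_norm ?subr_ge0// (@le_trans _ _ ((N + 1) * n.+1%:R^-1))//.
  by apply: ler_pM => //; rewrite ?subr_ge0// ?lerDl// -srn lerD2r.
rewrite -ler_pdivlMl//; apply: ltW.
near: n; exact: near_infty_natSinv_lt (PosNum h0).
Unshelve. all: by end_near. Qed.

(** Otherwise all sums from [n0] on would be at most the weighted length minus [e]. The step
    functions converge almost everywhere to the integrand, and Fatou's lemma would give the same
    bound for the weighted length itself. *)
Lemma wlen_le_riemann w gamma N (e : R) n0 : lipschitz_path gamma N -> weight w ->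
  0 < e -> exists2 n, (n0 <= n)%N & wlen w gamma 0 1 <= riemann_sum w gamma n.+1 + e.
Proof.
move=> gN hw e0; apply: contrapT => nh.
have [v [mv v0 aev vE _]] := wlen_repr gN.
have FF : Filter (almost_everywhere mu) by exact: (ae_filter_ringOfSetsType mu).
have h n : (n0 <= n)%N -> riemann_sum w gamma n.+1 <= wlen w gamma 0 1 - e.
  by move=> n0n; rewrite lerBrDr leNgt; apply/negP => /ltW h; apply: nh; exists n.
suff : ((wlen w gamma 0 1)%:E <= (wlen w gamma 0 1 - e)%:E)%E.
  by rewrite lee_fin; lra.
have [i01 E01] := vE w 0 1 hw (lexx 0) ler01 (lexx 1).
have [_ w0] := hw.
rewrite -(wlenE gN)// E01 -[leLHS]/(_%:E) /Rintegral fineK; last first.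
  by apply: integrable_fin_num => //; exact: measurable_itv.
have mI : measurable (`]0%R, 1%R[%classic : set (measurableTypeR R)) by exact: measurable_itv.
pose g n t := (riemann_step w gamma n t)%:E.
have mg n D : measurable_fun D (g n).
  by apply/measurable_EFinP; exact: measurable_riemann_step.
apply: (@le_trans _ _ (\int[mu]_(t in `]0%R, 1%R[) limn_einf (g ^~ t))%E).
  rewrite le_eqVlt; apply/orP; left; apply/eqP/esym.
  apply: ge0_ae_eq_lower_integral => //.
  - move=> t _; rewrite limn_einf_lim; apply: lime_ge; first exact: is_cvg_einfs.
    apply: nearW => n; apply: le_ereal_inf_tmp => _ [k _ <-].
    by rewrite lee_fin riemann_step_ge0.
  - by move=> t _; rewrite lee_fin mulr_ge0//; have /andP[] := v0 t.
  - exact: measurable_int i01.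
  - apply: filterS aev => t + /=; rewrite in_itv/= => hv t01.
    have [dg <-] := hv t01.
    apply: (@cvg_limn_einf_sup _ (g ^~ t) (w (gamma t) * enorm (derive1 gamma t))%:E _).1.
    by apply: cvg_EFin; [exact: nearW|exact: riemann_step_cvg gN hw t01 dg].
apply: (le_trans (fatou _ mI (fun n => mg n _) _)).
  by move=> n t _; rewrite lee_fin riemann_step_ge0.
apply: (limn_einf_le (n0 := n0)) => n n0n.
apply: (@le_trans _ _ (\int[mu]_t g n t)%E); last by rewrite integral_riemann_step// lee_fin h.
have g0 t : setT t -> (0 <= g n t)%E by rewrite lee_fin riemann_step_ge0.
exact: (@ge0_subset_integral _ _ _ mu _ _ mI measurableT _ (mg n _) g0).
Qed.

(* The direction condition of [Gamma] in a form that passes to pointwise limits. *)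
Definition straight gamma a b := forall s t r, a < s -> s <= t -> t <= r -> r < b ->
  enorm (gamma r - gamma s) = enorm (gamma t - gamma s) + enorm (gamma r - gamma t).

(** When the velocity is its norm times [u], the length of a piece equals the dot product of [u]
    with its chord and so is at most that chord. Lengths are additive and bound chords from above,
    which leaves no room for a strict triangle inequality. *)
Lemma straight_of_direction gamma N a b u : lipschitz_path gamma N ->
  0 <= a -> b <= 1 -> enorm u = 1 ->
  (forall t, a < t < b -> derivable gamma t 1 ->
     derive1 gamma t = enorm (derive1 gamma t) *: u) ->
  straight gamma a b.
Proof.
move=> gN a0 b1 u1 gu s t r las st tr rb.
have [s0 r1 sr] : [/\ 0 <= s, r <= 1 & s <= r].
  by split; [rewrite (le_trans a0)// ltW|rewrite (le_trans _ b1)// ltW|exact: le_trans tr].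
have [t0 t1] : 0 <= t /\ t <= 1 by split; [exact: le_trans st|exact: le_trans r1].
apply: le_anti; apply/andP; split; first by rewrite [leRHS]addrC ler_enorm_dist.
apply: le_trans (lerD (chord_le_wlen gN s0 st t1) (chord_le_wlen gN t0 tr r1)) _.
rewrite -(wlenD gN)//; last exact: weight1.
suff -> : wlen (fun=> 1) gamma s r = dotr u (gamma r - gamma s).
  by rewrite (le_trans (cauchy_schwarz _ _))// u1 mul1r.
have FF : Filter (almost_everywhere mu) by exact: (ae_filter_ringOfSetsType mu).
have [G [mG GN aeG GE]] := lipschitz_path_bounded_speed gN.
have mI : measurable (`]s, r[%classic : set (measurableTypeR R)) by exact: measurable_itv.
have mE : measurable_fun `]s, r[ (fun t => (enorm (G t))%:E).
  by apply/measurable_EFinP; apply: measurable_funTS; exact: measurable_enorm.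
have mdot : measurable_fun `]s, r[ (fun t => (dotr u (G t))%:E).
  by apply/measurable_EFinP; apply: measurable_funTS; apply: measurable_sum => i;
    apply: measurable_funM.
have srab x : `]s, r[%classic x -> a < x < b /\ 0 < x < 1.
  rewrite /= in_itv/= => /andP[sx xr].
  rewrite (lt_trans las sx) (lt_trans xr rb) (le_lt_trans s0 sx).
  by rewrite (lt_le_trans xr r1).
rewrite GE// /wlen /Rintegral; apply: (congr1 fine).
transitivity (\int[mu]_(x in `]s, r[) (enorm (G x))%:E)%E.
  apply: ge0_ae_eq_lower_integral => //.
  - by move=> x _; rewrite lee_fin mul1r.
  - by move=> x _; rewrite lee_fin.
  - apply: filterS aeG => x hx /srab[_ x01].
    by have [_ ->] := hx x01; rewrite mul1r.
apply: ae_eq_integral => //.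
apply: filterS aeG => x hx /srab[xab x01] /=.
have [dg E] := hx x01; have := gu x xab dg; rewrite E => {2}->.
by rewrite dotrZr -sqr_enorm u1 expr1n mulr1.
Qed.

(** Cutting the chord from [m] to [M] at [s] and [t] is an equality case of the triangle inequality
    between the middle chord and the sum of the outer two; hence every inner chord is positively
    parallel to the outer one. *)
Lemma straight_sub gamma a b m s t M : straight gamma a b ->
  a < m -> m <= s -> s <= t -> t <= M -> M < b ->
  enorm (gamma M - gamma m) *: (gamma t - gamma s) =
  enorm (gamma t - gamma s) *: (gamma M - gamma m).
Proof.
move=> st am ms le_st tM Mb.
have E1 : enorm (gamma M - gamma m) = enorm (gamma s - gamma m) + enorm (gamma M - gamma s).
  by apply: st => //; exact: le_trans tM.
have E2 : enorm (gamma M - gamma s) = enorm (gamma t - gamma s) + enorm (gamma M - gamma t).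
  by apply: st => //; exact: lt_le_trans ms.
set x := gamma t - gamma s; pose y := (gamma s - gamma m) + (gamma M - gamma t).
have Vxy : gamma M - gamma m = x + y by apply/rowP => i; rewrite !mxE; ring.
have xyD : enorm (x + y) = enorm x + enorm y.
  apply: le_anti; rewrite ler_enormD/= -Vxy E1 E2 -/x.
  by have := ler_enormD (gamma s - gamma m) (gamma M - gamma t); rewrite -/y; lra.
have := enormD_eq xyD => yx.
by rewrite Vxy xyD scalerDl yx [RHS]scalerDr.
Qed.

Lemma direction_of_straight gamma a b : (0 < d)%N -> straight gamma a b ->
  exists u, enorm u = 1 /\ forall t, a < t < b -> derivable gamma t 1 ->
    derive1 gamma t = enorm (derive1 gamma t) *: u.
Proof.
move=> d0 st.
suff [u [u1 hu]] : exists u, enorm u = 1 /\ forall s t, a < s -> s <= t -> t < b ->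
    gamma t - gamma s = enorm (gamma t - gamma s) *: u.
  exists u; split => // t /andP[ta tb] dg; apply/eqP; rewrite -subr_eq0.
  apply/eqP/enorm_eq0/le_anti; rewrite enorm_ge0 andbT.
  apply/ler_addgt0Pr => e e0; rewrite add0r.
  have e20 : 0 < e / 2 by rewrite divr_gt0.
  have [r r0 hr] := derive1_approx dg e20.
  pose h := Num.min (r / 2) ((b - t) / 2).
  have h0 : 0 < h by rewrite lt_min !divr_gt0//= subr_gt0.
  have hr2 : h < r by rewrite gt_min ltr_pdivrMr// ltr_pMr// ltr1n.
  have ht : t + h < b.
    have : h <= (b - t) / 2 by rewrite ge_min lexx orbT.
    lra.
  have := hr h; rewrite gtr0_norm// => /(_ hr2).
  set D := derive1 gamma t; rewrite (hu t (t + h)) ?lerDl ?(ltW h0)//.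
  set x := enorm (gamma (t + h) - gamma t) => hh.
  have hh2 : `|x - h * enorm D| <= e / 2 * h.
    apply: le_trans hh; have := ler_dist_enorm (x *: u) (h *: D).
    by rewrite !enormZ u1 mulr1 (gtr0_norm h0) (ger0_norm (enorm_ge0 _)).
  rewrite -(ler_pM2l h0) -[X in X * enorm _](gtr0_norm h0) -enormZ.
  (* The last term is the first-order remainder, and the coefficient of [u] is the difference of the
     norms of its two parts, so both are at most [e / 2 * h]. *)
  have -> : h *: (D - enorm D *: u) = (x - h * enorm D) *: u - (x *: u - h *: D).
    by rewrite scalerBr scalerBl scalerA; apply/rowP => i; rewrite !mxE; ring.
  rewrite (le_trans (ler_enormB _ _))// enormZ u1 mulr1.
  by rewrite (le_trans (lerD hh2 hh))//; lra.
have [const|nconst] := pselect (forall s t, a < s -> s <= t -> t < b -> gamma t = gamma s).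
  (* For a constant path any unit vector will do; the first basis vector exists since [0 < d]. *)
  exists (\row_i (i == Ordinal d0)%:R); split.
    rewrite enormE /dotr (bigD1 (Ordinal d0))//= mxE eqxx mulr1 big1 ?addr0 ?sqrtr1//
      => i /negbTE i0.
    by rewrite mxE i0 mul0r.
  by move=> s t sa le_st tb; rewrite (const s t)// subrr enorm0 scale0r.
have [s0 [r0 [sa le_sr rb neq]]] : exists s r, [/\ a < s, s <= r, r < b & gamma r - gamma s != 0].
  apply: contrapT => h; apply: nconst => s t sa le_st tb; apply/eqP; rewrite -subr_eq0.
  by apply/negPn/negP => h'; apply: h; exists s, t.
pose D0 := gamma r0 - gamma s0; have D0_gt0 : 0 < enorm D0 by exact: enorm_gt0.
exists ((enorm D0)^-1 *: D0); split.
  by rewrite enormZ gtr0_norm ?invr_gt0// mulVf// gt_eqF.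
move=> s t las le_st tb.
(* A chord spanning both the given times and the reference times is parallel to each of the two
   chords. *)
pose m := Num.min s s0; pose M := Num.max t r0.
have [ms ms0 tM r0M] : [/\ m <= s, m <= s0, t <= M & r0 <= M].
  by rewrite /m /M !ge_min !le_max !lexx !orbT.
have am : a < m by rewrite lt_min las sa.
have Mb : M < b by rewrite gt_max tb rb.
have h1 := straight_sub st am ms le_st tM Mb.
have h2 := straight_sub st am ms0 le_sr r0M Mb.
set V := gamma M - gamma m in h1 h2.
have V0 : enorm V != 0.
  rewrite gt_eqF// (lt_le_trans D0_gt0)// /V (st m s0 M)//; last exact: le_trans r0M.
  by rewrite (st s0 r0 M)// -/D0 addrCA lerDl addr_ge0.
have VE : V = (enorm D0)^-1 *: (enorm V *: D0).
  by rewrite h2 scalerA mulVf ?scale1r// gt_eqF.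
by apply: (scalerI V0); rewrite h1 {1}VE !scalerA; congr (_ *: _); ring.
Qed.

End riemann_sums.

(** * Existence of a shortest path for an abstract weight *)

Section admissible_paths.
Context {R : realType} {d : nat}.
Variables (w : 'rV[R]_d -> R) (F : set 'rV[R]_d) (x y : 'rV[R]_d).
Hypotheses (hw : weight w) (Fcl : closed F).
Implicit Types (gamma : R -> 'rV[R]_d) (a b s t N C : R).

(** Fixing the Lipschitz constant [N] makes this class compact, and [straight] makes it closed under
    limits. *)
Definition admissible N gamma := [/\ lipschitz_path gamma N,
  gamma 0 = x, gamma 1 = y &
  forall a b, 0 <= a -> a < b -> b <= 1 ->
    (forall t, a < t < b -> ~ F (gamma t)) -> straight gamma a b].

(* Between two such times a path may be replaced by a segment. *)
Definition corner gamma t := [\/ F (gamma t), t = 0 | t = 1].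

(** * Replacing a piece of a path by a segment *)

Definition shortcut gamma s0 t0 (t : R) : 'rV[R]_d :=
  if s0 <= t <= t0 then gamma s0 + ((t - s0) / (t0 - s0)) *: (gamma t0 - gamma s0)
  else gamma t.

Lemma shortcut_out gamma s0 t0 t : s0 < t0 -> t <= s0 \/ t0 <= t ->
  shortcut gamma s0 t0 t = gamma t.
Proof.
rewrite /shortcut => st0 ht; case: ifPn => // /andP[h1 h2].
case: ht => ht.
  have -> : t = s0 by apply/le_anti; rewrite h1 ht.
  by rewrite subrr mul0r scale0r addr0.
have -> : t = t0 by apply/le_anti; rewrite h2 ht.
by rewrite divff ?subr_eq0 ?gt_eqF// scale1r addrC subrK.
Qed.

Lemma shortcut_in gamma s0 t0 t : s0 <= t <= t0 ->
  shortcut gamma s0 t0 t = gamma s0 + ((t - s0) / (t0 - s0)) *: (gamma t0 - gamma s0).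
Proof. by rewrite /shortcut => ->. Qed.

Lemma shortcut_dist gamma s0 t0 s t : s0 < t0 -> s0 <= s <= t0 -> s0 <= t <= t0 ->
  enorm (shortcut gamma s0 t0 s - shortcut gamma s0 t0 t) =
  enorm (gamma t0 - gamma s0) / (t0 - s0) * `|s - t|.
Proof.
move=> st0 hs ht; rewrite !shortcut_in//.
have -> : gamma s0 + ((s - s0) / (t0 - s0)) *: (gamma t0 - gamma s0) -
   (gamma s0 + ((t - s0) / (t0 - s0)) *: (gamma t0 - gamma s0)) =
   ((s - t) / (t0 - s0)) *: (gamma t0 - gamma s0).
  by apply/rowP => i; rewrite !mxE; ring.
rewrite enormZ normrM (ger0_norm (_ : 0 <= (t0 - s0)^-1)) ?invr_ge0 ?subr_ge0 ?ltW//.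
by rewrite mulrC mulrA -mulrA (mulrC (`|_|)) mulrA.
Qed.

(** The segment is run at constant speed during the same time interval, so its speed is a chord of
    [gamma] divided by the elapsed time, at most [N]. The pieces are then glued at [s0] and [t0]. *)
Lemma shortcut_lipschitz gamma N s0 t0 : lipschitz_path gamma N ->
  0 <= s0 -> s0 < t0 -> t0 <= 1 -> lipschitz_path (shortcut gamma s0 t0) N.
Proof.
move=> gN s00 st0 t01.
have s01 : s0 <= 1 by rewrite (le_trans (ltW st0)).
have t00 : 0 <= t0 by rewrite (le_trans s00)// ltW.
suff H s t : 0 <= s -> s <= t -> t <= 1 ->
    enorm (shortcut gamma s0 t0 s - shortcut gamma s0 t0 t) <= N * (t - s).
  move=> s t /andP[hs0 hs1] /andP[ht0 ht1]; have [st|ts] := leP s t.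
    by rewrite ler0_norm ?subr_le0// opprB; exact: H.
  by rewrite gtr0_norm ?subr_gt0// enormBC; apply: H => //; exact: ltW.
have inn u v : s0 <= u -> u <= v -> v <= t0 ->
    enorm (shortcut gamma s0 t0 u - shortcut gamma s0 t0 v) <= N * (v - u).
  move=> hu uv hv; rewrite shortcut_dist//; last 2 first.
  - by rewrite hu (le_trans uv).
  - by rewrite hv (le_trans hu).
  rewrite ler0_norm ?subr_le0// opprB ler_wpM2r ?subr_ge0//.
  rewrite ler_pdivrMr ?subr_gt0//.
  have := gN t0 s0; rewrite s00 s01 t00 t01 gtr0_norm ?subr_gt0//; exact.
have outl u v : 0 <= u -> u <= v -> v <= s0 ->
    enorm (shortcut gamma s0 t0 u - shortcut gamma s0 t0 v) <= N * (v - u).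
  move=> hu uv hv; rewrite !shortcut_out//; try by left => //; exact: le_trans hv.
  have := gN u v; rewrite hu (le_trans hu uv) (le_trans hv s01) (le_trans uv (le_trans hv s01)).
  by rewrite ler0_norm ?subr_le0// opprB; exact.
have outr u v : t0 <= u -> u <= v -> v <= 1 ->
    enorm (shortcut gamma s0 t0 u - shortcut gamma s0 t0 v) <= N * (v - u).
  move=> hu uv hv; rewrite !shortcut_out//; try by right => //; exact: le_trans uv.
  have := gN u v; rewrite hv (le_trans uv hv) (le_trans t00 hu) (le_trans t00 (le_trans hu uv)).
  by rewrite ler0_norm ?subr_le0// opprB; exact.
have glue r u v : enorm (shortcut gamma s0 t0 u - shortcut gamma s0 t0 r) <= N * (r - u) ->
   enorm (shortcut gamma s0 t0 r - shortcut gamma s0 t0 v) <= N * (v - r) ->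
   enorm (shortcut gamma s0 t0 u - shortcut gamma s0 t0 v) <= N * (v - u).
  move=> h1 h2; rewrite (le_trans (ler_enorm_dist (shortcut gamma s0 t0 r) _ _))//; lra.
move=> hs st ht.
have [ss0|s0s] := leP s s0.
  have [ts0|s0t] := leP t s0; first exact: outl.
  apply: (glue s0); first exact: outl.
  have [tt0|t0t] := leP t t0; first by apply: inn => //; exact: ltW.
  by apply: (glue t0); [apply: inn => //; exact: ltW|apply: outr => //; exact: ltW].
have [st0'|t0s] := leP s t0; last first.
  by apply: outr => //; exact: ltW.
have [tt0|t0t] := leP t t0; first by apply: inn => //; exact: ltW.
by apply: (glue t0); [apply: inn => //; exact: ltW|apply: outr => //; exact: ltW].
Qed.

Lemma eq_straight gamma1 gamma2 a b : (forall t, a < t < b -> gamma1 t = gamma2 t) ->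
  straight gamma1 a b -> straight gamma2 a b.
Proof.
move=> g12 st s t r las le_st tr rb; rewrite -!g12; first exact: st.
- by rewrite (lt_le_trans las le_st) (le_lt_trans tr rb).
- by rewrite las (le_lt_trans le_st (le_lt_trans tr rb)).
- by rewrite rb (lt_le_trans las (le_trans le_st tr)).
Qed.

(** An open interval on which the new path avoids F cannot contain [s0] or [t0], because these are
    corners and the path is unchanged there. So the interval lies either in the unchanged part or
    inside the segment. *)
Lemma admissible_shortcut N gamma s0 t0 : admissible N gamma ->
  corner gamma s0 -> corner gamma t0 -> 0 <= s0 -> s0 < t0 -> t0 <= 1 ->
  admissible N (shortcut gamma s0 t0).
Proof.
move=> [gN g0 g1 gst] cs ct s00 st0 t01; split.
- exact: shortcut_lipschitz.
- by rewrite shortcut_out//; left.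
- by rewrite shortcut_out//; right.
move=> a b a0 ab b1 gF.
have nin u : corner gamma u -> (u = s0 \/ u = t0) -> u <= a \/ b <= u.
  move=> cu hu; have [|au] := leP u a; first by left.
  have [|ub] := leP b u; first by right.
  case: cu => [Fu|u0|u1].
  - case: (gF u); rewrite ?au// shortcut_out//.
    by case: hu => ->; [left|right].
  - by move: au; rewrite u0 ltNge a0.
  - by move: ub; rewrite u1 ltNge b1.
have [sa|bs] := nin s0 cs (or_introl erefl); last first.
  have out t : a < t < b -> shortcut gamma s0 t0 t = gamma t.
    by move=> /andP[_ tb]; rewrite shortcut_out//; left; rewrite ltW// (lt_le_trans tb).
  apply: (@eq_straight gamma); first by move=> t /out.
  by apply: gst => // t tab; rewrite -out//; exact: gF.
have [ta|bt] := nin t0 ct (or_intror erefl).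
  have out t : a < t < b -> shortcut gamma s0 t0 t = gamma t.
    by move=> /andP[at_ _]; rewrite shortcut_out//; right; rewrite ltW// (le_lt_trans ta).
  apply: (@eq_straight gamma); first by move=> t /out.
  by apply: gst => // t tab; rewrite -out//; exact: gF.
move=> s t r las le_st tr rb.
have [hs ht hr] : [/\ s0 <= s <= t0, s0 <= t <= t0 & s0 <= r <= t0].
  by split; apply/andP; split; lra.
rewrite !shortcut_dist// !ger0_norm ?subr_ge0 ?(le_trans le_st)//; ring.
Qed.

Lemma wlen_shortcut N gamma s0 t0 C : admissible N gamma ->
  (forall gamma', admissible N gamma' -> wlen w gamma 0 1 <= wlen w gamma' 0 1) ->
  corner gamma s0 -> corner gamma t0 -> 0 <= s0 -> s0 <= t0 -> t0 <= 1 -> 0 <= C ->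
  (forall l, 0 <= l <= 1 -> w (gamma s0 + l *: (gamma t0 - gamma s0)) <= C) ->
  wlen w gamma s0 t0 <= C * enorm (gamma t0 - gamma s0).
Proof.
move=> adm gmin cs ct s00; rewrite le_eqVlt => /predU1P[-> _ C0 _|st0 t01 C0 wC].
  by rewrite wlen_refl mulr_ge0.
have adm' := admissible_shortcut adm cs ct s00 st0 t01.
have := gmin _ adm'; have [gN _ _ _] := adm; have [gN' _ _ _] := adm'.
have s01 : s0 <= 1 by rewrite (le_trans (ltW st0)).
have t00 : 0 <= t0 by rewrite (le_trans s00)// ltW.
rewrite (wlenD gN hw (lexx 0) s00 s01)// (wlenD gN hw s00 (ltW st0) t01)//.
rewrite (wlenD gN' hw (lexx 0) s00 s01)// (wlenD gN' hw s00 (ltW st0) t01)//.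
have -> : wlen w (shortcut gamma s0 t0) 0 s0 = wlen w gamma 0 s0.
  by apply: eq_wlen => t /andP[_ ts]; rewrite shortcut_out//; left.
have -> : wlen w (shortcut gamma s0 t0) t0 1 = wlen w gamma t0 1.
  by apply: eq_wlen => t /andP[ts _]; rewrite shortcut_out//; right.
rewrite lerD2l lerD2r => /le_trans; apply.
apply: le_trans (wlen_ub gN' (c := C) hw s00 (ltW st0) t01 _) _.
  move=> t ht; rewrite shortcut_in//; apply: wC.
  have /andP[h1 h2] := ht.
  by rewrite divr_ge0 ?subr_ge0 ?(ltW st0)//= ler_pdivrMr ?subr_gt0// mul1r lerD2r.
rewrite ler_wpM2l//.
have K : enorm (gamma t0 - gamma s0) = enorm (gamma t0 - gamma s0) / (t0 - s0) * (t0 - s0).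
  by rewrite divfK// subr_eq0 gt_eqF.
rewrite [leRHS]K; apply: (wlen1_le gN' s00 (ltW st0) t01) => s t hs ht.
by rewrite shortcut_dist.
Qed.

(** * Visits of closed sets and crossings of annuli *)

Lemma closed_visits gamma N (P : set 'rV[R]_d) a b : lipschitz_path gamma N ->
  closed P -> 0 <= a -> b <= 1 -> compact [set t | a <= t <= b /\ P (gamma t)].
Proof.
move=> gN Pcl a0 b1.
have cg : continuous (gamma \o clamp01) by exact: lipschitz_path_clamp_continuous gN.
rewrite (_ : [set t | _] = [set` `[a, b]] `&` (gamma \o clamp01) @^-1` P).
  apply: compact_closedI; first exact: segment_compact.
  by apply: closed_comp => // t _; exact: cg.
have cl t : a <= t -> t <= b -> clamp01 t = t.
  by move=> at_ tb; apply: clamp01_id; rewrite (le_trans a0) ?(le_trans tb).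
by apply/seteqP; split => t /=; rewrite in_itv/= => -[/andP[at_ tb]]; rewrite cl// at_ tb.
Qed.

Lemma last_visit gamma N (P : set 'rV[R]_d) a b t : lipschitz_path gamma N ->
  closed P -> 0 <= a -> b <= 1 -> a <= t <= b -> P (gamma t) ->
  exists t1, [/\ a <= t1 <= b, P (gamma t1) & forall s, a <= s <= b -> P (gamma s) -> s <= t1].
Proof.
move=> gN Pcl a0 b1 tab Pt.
have [||t1 + h] := compact_EVT_max (f := (@idfun R^o)) _ (closed_visits gN Pcl a0 b1).
- by exists t.
- by apply: continuous_subspaceT => z; exact: cvg_id.
- by rewrite inE /= => -[h1 h2]; exists t1; split => // s sab Ps; apply: h; rewrite inE.
Qed.

Lemma first_visit gamma N (P : set 'rV[R]_d) a b t : lipschitz_path gamma N ->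
  closed P -> 0 <= a -> b <= 1 -> a <= t <= b -> P (gamma t) ->
  exists t1, [/\ a <= t1 <= b, P (gamma t1) & forall s, a <= s <= b -> P (gamma s) -> t1 <= s].
Proof.
move=> gN Pcl a0 b1 tab Pt.
have [||t1 + h] := compact_EVT_min (f := (@idfun R^o)) _ (closed_visits gN Pcl a0 b1).
- by exists t.
- by apply: continuous_subspaceT => z; exact: cvg_id.
- by rewrite inE /= => -[h1 h2]; exists t1; split => // s sab Ps; apply: h; rewrite inE.
Qed.

Lemma enorm_sub_continuous (z : 'rV[R]_d) : continuous (fun p : 'rV[R]_d => enorm (p - z)).
Proof.
apply: (@normed_lipschitz_continuous _ 'rV[R]_d R^o _ d%:R) => p q.
rewrite (le_trans (ler_dist_enorm _ _))// (le_trans (enorm_ler_norm _))//.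
by rewrite opprB addrA subrK.
Qed.

Lemma closed_eball_le (z : 'rV[R]_d) r : closed [set p | enorm (p - z) <= r].
Proof.
exact: (@preimage_closed 'rV[R]_d R (fun p => enorm (p - z)) [set q : R | q <= r]
  (fun p _ => @enorm_sub_continuous z p) (@closed_le _ r)).
Qed.

Lemma closed_eball_ge (z : 'rV[R]_d) r : closed [set p | r <= enorm (p - z)].
Proof.
exact: (@preimage_closed 'rV[R]_d R (fun p => enorm (p - z)) [set q : R | r <= q]
  (fun p _ => @enorm_sub_continuous z p) (@closed_ge _ r)).
Qed.

Lemma wlen_mono gamma N a s t b : lipschitz_path gamma N ->
  0 <= a -> a <= s -> s <= t -> t <= b -> b <= 1 ->
  wlen w gamma s t <= wlen w gamma a b.
Proof.
move=> gN a0 as_ st tb b1; have s0 := le_trans a0 as_; have sb := le_trans st tb.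
rewrite (wlenD gN hw a0 as_ sb b1) (wlenD gN hw s0 st tb b1).
by rewrite addrCA lerDl addr_ge0// (wlen_ge0 _ _ _ hw).
Qed.

(** Outwards, take the first time at distance at least [be] and the last time before it at distance
    at most [al]; inwards, the last far time and then the first near one. Between the two times the
    path stays in the annulus, where [w] is at least [c], and their chord is at least [be - al]. *)
Lemma wlen_crossing gamma N z al be c a b : lipschitz_path gamma N ->
  0 <= a -> a <= b -> b <= 1 -> 0 <= c ->
  (forall p, al <= enorm (p - z) <= be -> c <= w p) ->
  (enorm (gamma a - z) <= al /\ be <= enorm (gamma b - z)) \/
  (enorm (gamma b - z) <= al /\ be <= enorm (gamma a - z)) ->
  c * (be - al) <= wlen w gamma a b.
Proof.
move=> gN a0 ab b1 c0 wc.
have [|albe] := leP be al.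
  by move=> h _; rewrite (le_trans _ (wlen_ge0 _ _ _ hw))// mulr_ge0_le0// subr_le0.
have main s t : a <= s -> s <= t -> t <= b ->
    (forall q, s < q < t -> al < enorm (gamma q - z) < be) ->
    be - al <= enorm (gamma t - gamma s) -> c * (be - al) <= wlen w gamma a b.
  move=> as_ st tb hq hst.
  have s0 := le_trans a0 as_; have t1 := le_trans tb b1.
  apply: le_trans (wlen_mono gN a0 as_ st tb b1).
  apply: (@le_trans _ _ (c * wlen (fun=> 1) gamma s t)).
    by rewrite ler_wpM2l// (le_trans hst)// (chord_le_wlen gN).
  by apply: (wlen_lb gN) => // q /hq /andP[h1 h2]; apply: wc; rewrite !ltW.
case=> -[h1 h2].
- have [|t [/andP[at_ tb] Pt ht]] := first_visit gN (@closed_eball_ge z be) a0 b1 (t := b) _ h2.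
    by rewrite ab lexx.
  have t1 := le_trans tb b1.
  have [|s [/andP[as_ st] Ps hs]] := last_visit gN (@closed_eball_le z al) a0 t1 (t := a) _ h1.
    by rewrite at_ lexx.
  apply: (main s t) => //.
    move=> q /andP[sq qt]; rewrite !ltNge; apply/andP; split; apply/negP => hq.
      by have := hs q; rewrite (le_trans as_ (ltW sq)) (ltW qt) => /(_ isT hq); rewrite leNgt sq.
    have := ht q; rewrite (le_trans as_ (ltW sq)) (le_trans (ltW qt) tb) => /(_ isT hq).
    by rewrite leNgt qt.
  have := ler_enorm_dist (gamma s) (gamma t) z; move: Ps Pt => /=; lra.
- have [|s [/andP[as_ sb] Ps hs]] := last_visit gN (@closed_eball_ge z be) a0 b1 (t := a) _ h2.
    by rewrite ab lexx.
  have s0 := le_trans a0 as_.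
  have [|t [/andP[st tb] Pt ht]] := first_visit gN (@closed_eball_le z al) s0 b1 (t := b) _ h1.
    by rewrite sb lexx.
  apply: (main s t) => //.
    move=> q /andP[sq qt]; rewrite !ltNge; apply/andP; split; apply/negP => hq.
      have := ht q; rewrite (ltW sq) (le_trans (ltW qt) tb) => /(_ isT hq).
      by rewrite leNgt qt.
    have := hs q; rewrite (le_trans as_ (ltW sq)) (le_trans (ltW qt) tb) => /(_ isT hq).
    by rewrite leNgt sq.
  have := ler_enorm_dist (gamma t) (gamma s) z; rewrite [enorm (gamma s - gamma t)]enormBC.
  by move: Ps Pt => /=; lra.
Qed.

(* Both the zeros of [w] (with [W u] a power of [u]) and its other points (with
   [W] constant) will satisfy this. *)
Definition doubling_at (a : 'rV[R]_d) := exists (r c M : R) (W : R -> R),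
  [/\ [/\ 0 < r, 0 < c & 0 < M],
      (forall u v, 0 <= u -> u <= v -> W u <= W v),
      (forall u, 0 < u -> 0 < W u),
      (forall u, 0 <= u -> W (2 * u) <= M * W u) &
      forall z, enorm (z - a) < r -> c * W (enorm (z - a)) <= w z <= W (enorm (z - a))].

(** * Bounds on chord sums along the corners of a minimal path *)

Definition minimal_path N gamma := admissible N gamma /\
  forall gamma', admissible N gamma' -> wlen w gamma 0 1 <= wlen w gamma' 0 1.

Definition corner_chain gamma n (tau : nat -> R) :=
  [/\ 0 <= tau 0%N, tau n <= 1, (forall i, (i < n)%N -> tau i <= tau i.+1) &
      forall i, (i <= n)%N -> corner gamma (tau i)].

Section corner_chains.
Variables (N : R) (gamma : R -> 'rV[R]_d) (n : nat) (tau : nat -> R).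
Hypotheses (gmin : minimal_path N gamma) (tauP : corner_chain gamma n tau).

Let gN : lipschitz_path gamma N. Proof. by case: gmin => -[]. Qed.

Lemma corner_chain_mono i j : (i <= j)%N -> (j <= n)%N -> tau i <= tau j.
Proof.
have [_ _ tS _] := tauP.
elim: j => [|j IH]; first by rewrite leqn0 => /eqP->.
rewrite leq_eqVlt => /predU1P[->//|ij] jn.
by rewrite (le_trans (IH _ (ltnW jn)))// tS.
Qed.

Lemma corner_chain_itv i : (i <= n)%N -> 0 <= tau i <= 1.
Proof.
have [t0 t1 _ _] := tauP => i_n.
by rewrite (le_trans t0) ?corner_chain_mono// (le_trans _ t1)// corner_chain_mono.
Qed.

(** All selected pieces lie between the first and the last selected index, so a single shortcut
    controls them together, whatever the path does in between. *)
Lemma sum_wlen_corner_chain (P : pred 'I_n) (l0 : 'I_n) : P l0 ->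
  exists i j : 'I_n, [/\ P i, P j, (i <= j)%N &
    \sum_(l < n | P l) wlen w gamma (tau l) (tau l.+1) <= wlen w gamma (tau i) (tau j.+1)].
Proof.
move=> Pl0.
case: (arg_minnP (fun i : 'I_n => i : nat) Pl0) => i Pi imin.
case: (arg_maxnP (fun i : 'I_n => i : nat) Pl0) => j Pj jmax.
have ij : (i <= j)%N by exact: imin.
exists i, j; split => //.
(* The index is clamped to [i, j.+1], so that the sum over all of ['I_n] telescopes to this
   range. *)
pose s l := tau (minn (maxn l i) j.+1).
have sE0 : s 0%N = tau i by rewrite /s max0n (minn_idPl _)// (leq_trans ij).
have sEn : s n = tau j.+1 by rewrite /s (maxn_idPl (ltnW (ltn_ord i))) (minn_idPr (ltn_ord j)).
rewrite -sE0 -sEn -(wlen_sum gN (n := n)) //; last 3 first.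
- by rewrite sE0; have /andP[] := corner_chain_itv (ltnW (ltn_ord i)).
- by rewrite sEn; have /andP[] := corner_chain_itv (ltn_ord j).
- move=> l ln; apply: corner_chain_mono.
    by lia.
  by rewrite geq_min (ltn_ord j) orbT.
rewrite big_mkcond/=; apply: ler_sum => l _; case: ifPn => [Pl|_]; last exact: wlen_ge0.
have il := imin _ Pl; have lj := jmax _ Pl.
by rewrite /s (maxn_idPl il) (maxn_idPl (leqW il)) (minn_idPl (leqW lj)) (minn_idPl (_
  : l < j.+1)%N).
Qed.

(** Each selected piece has an end at distance between [rho / 2] and [rho] from [a], where it pays
    at least [k] times its chord. Together the pieces cost no more than one segment in the ball, at
    most [W rho * (2 * rho)]. Dividing by [k] gives the constant 16. *)
Lemma sum_corner_annulus (a : 'rV[R]_d) (r c M : R) (W : R -> R) (rho : R) (P : pred 'I_n) :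
  [/\ 0 < r, 0 < c & 0 < M] -> (forall u v, 0 <= u -> u <= v -> W u <= W v) ->
  (forall u, 0 < u -> 0 < W u) ->
  (forall u, 0 <= u -> W (2 * u) <= M * W u) ->
  (forall z, enorm (z - a) < r -> c * W (enorm (z - a)) <= w z <= W (enorm (z - a))) ->
  0 < rho -> rho <= r / 2 ->
  (forall l, P l -> [/\ enorm (gamma (tau l) - a) <= rho, enorm (gamma (tau l.+1) - a) <= rho &
     rho / 2 <= enorm (gamma (tau l) - a) \/ rho / 2 <= enorm (gamma (tau l.+1) - a)]) ->
  \sum_(l < n | P l) enorm (gamma (tau l.+1) - gamma (tau l)) <= 16 * M ^+ 2 / c * rho.
Proof.
move=> [r0 c0 M0] Wnd Wp W2 wW rho0 rho_r hP.
have [_ _ _ tc] := tauP.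
have W_rho := Wp _ rho0.
have C0 : 0 <= 16 * M ^+ 2 / c * rho by rewrite !mulr_ge0 ?invr_ge0// ltW// ?exprn_gt0.
case: (pickP P) => [l0 Pl0|P0]; last by rewrite big_pred0.
have [i [j [Pi Pj ij S]]] := sum_wlen_corner_chain Pl0.
(* Within [rho / 4] of the far end the weight is at least [c * W (rho / 4)], hence at least
   [c / M ^+ 2 * W rho = k * 8] by doubling twice. *)
pose k := c / (8 * M ^+ 2) * W rho.
have k0 : 0 < k by rewrite /k !mulr_gt0 ?invr_gt0 ?mulr_gt0// exprn_gt0.
have W4 : W rho <= M ^+ 2 * W (rho / 4).
  have h1 : W rho <= M * W (rho / 2).
    by have := W2 (rho / 2); rewrite (_ : 2 * (rho / 2) = rho); [apply; lra|lra].
  have h2 : W (rho / 2) <= M * W (rho / 4).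
    by have := W2 (rho / 4); rewrite (_ : 2 * (rho / 4) = rho / 2); [apply; lra|lra].
  by rewrite (le_trans h1)// expr2 -mulrA ler_wpM2l// ltW.
have near_far p : rho / 2 <= enorm (p - a) -> enorm (p - a) <= rho ->
    forall h, h <= rho / 4 -> forall z, 0 <= enorm (z - p) <= h -> k * 8 <= w z.
  move=> p1 p2 h hr z /andP[_ zp].
  have h1 := ler_enorm_dist p z a; have h2 := ler_enorm_dist z p a.
  rewrite (enormBC p z) in h2.
  have zr : enorm (z - a) < r by lra.
  have zrho : rho / 4 <= enorm (z - a) by lra.
  have /andP[wz _] := wW z zr; apply: le_trans wz.
  have rho40 : 0 <= rho / 4 by lra.
  have := Wnd _ _ rho40 zrho; rewrite -(ler_pM2l c0); apply: le_trans.
  have -> : k * 8 = c / M ^+ 2 * W rho by rewrite /k; field; rewrite gt_eqF.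
  by rewrite mulrAC ler_pdivrMr ?exprn_gt0// -mulrA ler_wpM2l ?(ltW c0)// [leRHS]mulrC.
have step l : P l -> k * enorm (gamma (tau l.+1) - gamma (tau l)) <= wlen w gamma (tau l) (tau
  l.+1).
  move=> Pl; have [p1 q1 pq] := hP l Pl.
  set p := gamma (tau l) in p1 pq *; set q := gamma (tau l.+1) in q1 pq *.
  (* The chord is at most [2 * rho], so an eighth of it fits in the radius [rho / 4]; moving away by
     [h] costs [k * 8 * h], that is [k] times the chord. *)
  pose h := enorm (q - p) / 8.
  have h4 : h <= rho / 4.
    by have := ler_enorm_dist a q p; rewrite (enormBC a p) /h; lra.
  have /andP[tl0 _] := corner_chain_itv (ltnW (ltn_ord l)).
  have /andP[_ tl1] := corner_chain_itv (ltn_ord l).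
  have tll := corner_chain_mono (leqnSn l) (ltn_ord l).
  have k80 : 0 <= k * 8 by rewrite mulr_ge0// ltW.
  have -> : k * enorm (q - p) = k * 8 * (h - 0) by rewrite /h; field.
  have hq : h <= enorm (q - p) by rewrite /h; have := enorm_ge0 (q - p); lra.
  case: pq => pq.
    apply: (wlen_crossing (z := p) gN tl0 tll tl1 k80 (near_far p pq p1 h h4)).
    by left; rewrite subrr enorm0.
  apply: (wlen_crossing (z := q) gN tl0 tll tl1 k80 (near_far q pq q1 h h4)).
  by right; rewrite subrr enorm0 enormBC.
have [pi1 _ _] := hP i Pi; have [_ qj1 _] := hP j Pj.
have /andP[ti0 _] := corner_chain_itv (ltnW (ltn_ord i)).
have /andP[_ tj1] := corner_chain_itv (ltn_ord j).
have tij : tau i <= tau j.+1 by apply: corner_chain_mono => //; exact: leqW.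
have [adm gmin'] := gmin.
have up : wlen w gamma (tau i) (tau j.+1) <= W rho * enorm (gamma (tau j.+1) - gamma (tau i)).
  apply: (wlen_shortcut adm gmin' (tc i (ltnW (ltn_ord i))) (tc j.+1 (ltn_ord j)) ti0 tij tj1
    (ltW W_rho)).
  move=> l /andP[l0' l1]; set z := _ + _.
  have zrho : enorm (z - a) <= rho.
    have -> : z - a = (1 - l) *: (gamma (tau i) - a) + l *: (gamma (tau j.+1) - a).
      by rewrite /z; apply/rowP => m; rewrite !mxE; ring.
    rewrite (le_trans (ler_enormD _ _))// !enormZ !ger0_norm ?subr_ge0//.
    by nra.
  have zr : enorm (z - a) < r by lra.
  have /andP[_ wz] := wW z zr.
  by rewrite (le_trans wz)// Wnd// enorm_ge0.
rewrite -(ler_pM2l k0).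
apply: (@le_trans _ _ (W rho * (2 * rho))); last first.
  by rewrite le_eqVlt; apply/orP; left; apply/eqP; rewrite /k; field; rewrite !gt_eqF.
rewrite mulr_sumr; apply: le_trans (ler_sum _ step) _.
apply: le_trans S (le_trans up _).
rewrite ler_wpM2l ?(ltW W_rho)//.
by have := ler_enorm_dist a (gamma (tau j.+1)) (gamma (tau i)); rewrite (enormBC a); lra.
Qed.

Lemma sum_corner_ball (a : 'rV[R]_d) (r c M : R) (W : R -> R) (rho : R) (P : pred 'I_n) :
  [/\ 0 < r, 0 < c & 0 < M] -> (forall u v, 0 <= u -> u <= v -> W u <= W v) ->
  (forall u, 0 < u -> 0 < W u) ->
  (forall u, 0 <= u -> W (2 * u) <= M * W u) ->
  (forall z, enorm (z - a) < r -> c * W (enorm (z - a)) <= w z <= W (enorm (z - a))) ->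
  0 < rho -> rho <= r / 2 ->
  (forall l, P l -> enorm (gamma (tau l) - a) <= rho /\ enorm (gamma (tau l.+1) - a) <= rho) ->
  \sum_(l < n | P l) enorm (gamma (tau l.+1) - gamma (tau l)) <= 32 * M ^+ 2 / c * rho.
Proof.
move=> rcM Wnd Wp W2 wW rho0 rho_r hP; set C1 := 16 * M ^+ 2 / c.
have [r0 c0 M0] := rcM.
have -> : 32 * M ^+ 2 / c * rho = 2 * C1 * rho by rewrite /C1; ring.
pose D l := enorm (gamma (tau l.+1) - gamma (tau l)).
have D2 u (l : 'I_n) : enorm (gamma (tau l) - a) <= u -> enorm (gamma (tau l.+1) - a) <= u ->
    D l <= 2 * u.
  by move=> h1 h2; rewrite (le_trans (ler_enorm_dist a _ _))// (enormBC a); lra.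
have C10 : 0 <= C1 by rewrite !mulr_ge0 ?invr_ge0// ltW// ?exprn_gt0.
have ann u Q := @sum_corner_annulus a r c M W u Q rcM Wnd Wp W2 wW.
rewrite -/C1 in ann; clearbody C1.
(* Pieces with an end at distance at least [u / 2] are handled by the annulus estimate, the others
   lie in the ball of radius [u / 2]. After [k] halvings the remainder is bounded crudely, piece by
   piece. *)
have main k : forall u (Q : pred 'I_n), 0 < u -> u <= r / 2 ->
    (forall l, Q l -> enorm (gamma (tau l) - a) <= u /\ enorm (gamma (tau l.+1) - a) <= u) ->
    \sum_(l < n | Q l) D l <= 2 * C1 * u + n%:R * (2 * u) / 2 ^+ k.
  elim: k => [|k IH] u Q u0 ur hQ.
    rewrite expr0 divr1 (@le_trans _ _ (n%:R * (2 * u)))//; last first.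
      by rewrite lerDr !mulr_ge0// ltW.
    rewrite mulr_natl -[n in _ *+ n]card_ord -sumr_const big_mkcond/=.
    apply: ler_sum => l _; case: ifPn => [Ql|_]; last by rewrite mulr_ge0// ltW.
    by have [h1 h2] := hQ l Ql; exact: D2.
  pose far (l : 'I_n) := (u / 2 <= enorm (gamma (tau l) - a)) || (u / 2 <= enorm (gamma (tau
    l.+1) - a)).
  rewrite (bigID far)/=.
  have S1 : \sum_(l < n | Q l && far l) D l <= C1 * u.
    apply: (ann u _ u0 ur) => l /andP[Ql fl].
    by have [h1 h2] := hQ l Ql; split => //; exact/orP.
  have S2 : \sum_(l < n | Q l && ~~ far l) D l <= 2 * C1 * (u / 2) + n%:R * (2 * (u / 2)) / 2 ^+ k.
    apply: IH; [by rewrite divr_gt0|lra|].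
    by move=> l /andP[_]; rewrite negb_or -!ltNge => /andP[/ltW h1 /ltW h2].
  rewrite (le_trans (lerD S1 S2))// exprS invfM le_eqVlt; apply/orP; left; apply/eqP.
  by field; rewrite expf_neq0.
apply/ler_addgt0Pr => e e0.
pose X := n%:R * (2 * rho); have X0 : 0 <= X by rewrite !mulr_ge0// ltW.
(* The number [n] of pieces enters only through this remainder, which vanishes as [k] grows for a
   fixed chain; the resulting bound does not depend on the chain. *)
pose k := Num.bound (X / e).
apply: le_trans (main k rho P rho0 rho_r hP) _.
rewrite lerD2l ler_pdivrMr ?exprn_gt0// -ler_pdivrMl// mulrC.
have h : X / e < k%:R by apply: archi_boundP; rewrite divr_ge0// ltW.
rewrite (le_trans (ltW h))// -natrX ler_nat; exact/ltnW/ltn_expl.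
Qed.

End corner_chains.

(** Only the starting point of a piece is tested, so a finite cover of the range of [gamma] accounts
    for every piece. *)
Definition corner_sum gamma n (tau : nat -> R) (U : set 'rV[R]_d) : R :=
  \sum_(l < n | gamma (tau l) \in U) enorm (gamma (tau l.+1) - gamma (tau l)).

(** Going further out would mean crossing an annulus of width [K / c + 1] where the weight is at
    least [c], at a cost of at least [K + c]. *)
Lemma minimal_path_confined K R1 c N gamma : minimal_path N gamma ->
  wlen w gamma 0 1 <= K -> 0 <= K -> 0 < c -> (forall z, R1 <= enorm z -> c <= w z) ->
  forall t, 0 <= t <= 1 -> enorm (gamma t) <= Num.max R1 (enorm x) + K / c + 1.
Proof.
move=> [[gN g0 g1 _] _] gK K0 c0 wc t /andP[t0 t1]; rewrite leNgt; apply/negP => ht.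
set al := Num.max R1 (enorm x) in ht.
have wc' p : al <= enorm (p - 0) <= al + K / c + 1 -> c <= w p.
  by rewrite subr0 => /andP[h _]; apply: wc; rewrite (le_trans _ h)// le_max lexx.
have := wlen_crossing gN (lexx 0) t0 t1 (ltW c0) wc'; rewrite !subr0 g0.
move=> /(_ (or_introl (conj _ (ltW ht)))); rewrite {1}/al le_max lexx orbT => /(_ isT).
apply/negP; rewrite -ltNge; apply: (@le_lt_trans _ _ K).
  by rewrite (le_trans _ gK)// (wlen_mono gN).
by rewrite (_ : al + K / c + 1 - al = K / c + 1);
  [rewrite mulrDr mulrCA divff ?gt_eqF// !mulr1 ltrDl|ring].
Qed.

(** A piece that starts within [r / 4] of [a] either ends within [r / 2], and [sum_corner_ball]
    applies, or crosses the annulus in between at a cost of at least [e]. The total cost [K] allows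
    at most [K / e] of the latter, each with a chord of at most [2 * R2]. *)
Lemma corner_sum_local K R2 (a : 'rV[R]_d) : 0 <= K -> 0 <= R2 -> doubling_at a ->
  exists r C, [/\ 0 < r, 0 <= C & forall N gamma n tau, minimal_path N gamma ->
    wlen w gamma 0 1 <= K -> (forall t, 0 <= t <= 1 -> enorm (gamma t) <= R2) ->
    corner_chain gamma n tau ->
    corner_sum gamma n tau [set z | enorm (z - a) < r] <= C].
Proof.
move=> K0 R20 [r [c [M [W [rcM Wnd Wp W2 wW]]]]]; have [r0 c0 M0] := rcM.
pose e := c * W (r / 4) * (r / 4).
have W0 : 0 < W (r / 4) by apply: Wp; rewrite divr_gt0.
have e0 : 0 < e by rewrite !mulr_gt0.
have C10 : 0 <= 32 * M ^+ 2 / c * (r / 2) by rewrite !mulr_ge0 ?invr_ge0// ltW// ?exprn_gt0.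
have C20 : 0 <= 2 * R2 / e * K by rewrite !mulr_ge0 ?invr_ge0// ltW.
exists (r / 4), (32 * M ^+ 2 / c * (r / 2) + 2 * R2 / e * K); split => //.
- by rewrite divr_gt0.
- by rewrite addr_ge0.
move=> N gamma n tau gmin gK gR2 tauP; rewrite /corner_sum.
have gN : lipschitz_path gamma N by case: gmin => -[].
pose inn (l : 'I_n) := enorm (gamma (tau l.+1) - a) <= r / 2.
rewrite (bigID inn)/=; apply: lerD.
  apply: (sum_corner_ball gmin tauP rcM Wnd Wp W2 wW) => //; first by rewrite divr_gt0.
  move=> l /andP[]; rewrite inE/= => h1 h2; split => //; lra.
have [t0 t1 tS tc] := tauP.
apply: (@le_trans _ _ (2 * R2 / e * \sum_(l < n) wlen w gamma (tau l) (tau l.+1))); last first.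
  have tn0 : tau 0%N <= tau n by exact: corner_chain_mono tauP _ _ (leq0n n) (leqnn n).
  rewrite (wlen_sum gN)// ler_wpM2l// ?mulr_ge0 ?invr_ge0 ?(ltW e0)//.
  by rewrite (le_trans _ gK)// (wlen_mono gN).
rewrite mulr_sumr big_mkcond/=; apply: ler_sum => l _; case: ifPn; last first.
  by rewrite !mulr_ge0 ?invr_ge0 ?(ltW e0)// wlen_ge0.
move=> /andP[]; rewrite inE/= => h1; rewrite /inn -ltNge => h2.
have tl01 := corner_chain_itv tauP (ltnW (ltn_ord l)).
have tl11 := corner_chain_itv tauP (ltn_ord l).
have /andP[tl0 _] := tl01; have /andP[_ tl1] := tl11.
have ek : e <= wlen w gamma (tau l) (tau l.+1).
  rewrite /e (_ : r / 4 = r / 2 - r / 4) ?[in X in W X](_ : r / 2 - r / 4 = r / 4); try lra.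
  have cW0 : 0 <= c * W (r / 4) by rewrite mulr_ge0// ltW.
  apply: (wlen_crossing (z := a) gN tl0 (tS l (ltn_ord l)) tl1 cW0).
    move=> p /andP[p1 p2]; have pr : enorm (p - a) < r by lra.
    have /andP[h _] := wW p pr; apply: le_trans h; rewrite ler_wpM2l ?(ltW c0)// Wnd//; lra.
  by left; split; lra.
have D2 : enorm (gamma (tau l.+1) - gamma (tau l)) <= 2 * R2.
  by rewrite (le_trans (ler_enormB _ _))//; have := gR2 _ tl01; have := gR2 _ tl11; lra.
apply: le_trans D2 _; rewrite -mulrA ler_peMr ?mulr_ge0//.
by rewrite mulrC ler_pdivlMr// mul1r.
Qed.

Lemma eball_compact r : compact [set z : 'rV[R]_d | enorm z <= r].
Proof.
apply: bounded_closed_compact.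
  exists r; split; first exact: num_real.
  by move=> s rs z /= zr; rewrite (le_trans (ler_norm_enorm _))// (le_trans zr)// ltW.
have := @closed_eball_le 0 r.
by rewrite (_ : [set p | _] = [set z | enorm z <= r])//; apply/seteqP; split=> z /=; rewrite subr0.
Qed.

Lemma eball_open (a : 'rV[R]_d) r : open [set z : 'rV[R]_d | enorm (z - a) < r].
Proof.
rewrite (_ : [set z | _] = ~` [set z | r <= enorm (z - a)]).
  by apply: closed_openC; exact: closed_eball_ge.
by apply/seteqP; split => z /=; rewrite ltNge => /negP.
Qed.

Lemma corner_sum_bound K R2 : 0 <= K -> 0 <= R2 -> (forall a : 'rV[R]_d, doubling_at a) ->
  exists2 C, 0 <= C & forall N gamma n tau, minimal_path N gamma ->
    wlen w gamma 0 1 <= K -> (forall t, 0 <= t <= 1 -> enorm (gamma t) <= R2) ->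
    corner_chain gamma n tau ->
    \sum_(l < n) enorm (gamma (tau l.+1) - gamma (tau l)) <= C.
Proof.
move=> K0 R20 dbl.
have /choice[r /choice[C rC]] := fun a : 'rV[R]_d => corner_sum_local K0 R20 (dbl a).
have := @eball_compact R2; rewrite compact_cover => /(_ _ setT (fun a : 'rV[R]_d
  => [set z | enorm (z - a) < r a])).
case.
- by move=> a _; exact: eball_open.
- by move=> a _; exists a => //=; rewrite subrr enorm0; have [] := rC a.
move=> D _ Dcov; exists (\sum_(a <- finmap.enum_fset D) C a).
  by apply: sumr_ge0 => a _; have [] := rC a.
move=> N gamma n tau gmin gK gR tauP.
apply: (@le_trans _ _ (\sum_(a <- finmap.enum_fset D) corner_sum gamma n tau [set z | enorm (z
  - a) < r a])); last first.
  by apply: ler_sum => a _; have [_ _ h] := rC a; exact: (h N).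
rewrite /corner_sum; under [leRHS]eq_bigr do rewrite big_mkcond/=.
rewrite exchange_big/=; apply: ler_sum => l _.
have tl01 := corner_chain_itv tauP (ltnW (ltn_ord l)).
have [a aD pa] := Dcov (gamma (tau l)) (gR _ tl01).
rewrite (big_rem a)//= ifT ?inE//.
by rewrite lerDl; apply: sumr_ge0 => b _; case: ifP.
Qed.

(** * From chains of corners to the length of a minimal path *)

Lemma straight_closed gamma N a b s t r : lipschitz_path gamma N -> 0 <= a -> b <= 1 ->
  straight gamma a b -> a <= s -> s <= t -> t <= r -> r <= b ->
  enorm (gamma r - gamma s) = enorm (gamma t - gamma s) + enorm (gamma r - gamma t).
Proof.
move=> gN a0 b1 st as_ le_st tr rb.
have ab : a <= b by rewrite (le_trans as_)// (le_trans le_st)// (le_trans tr).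
move: ab; rewrite le_eqVlt => /predU1P[ab|ab].
  have -> : t = s by apply/le_anti; rewrite le_st andbT (le_trans tr)// (le_trans rb)// -ab.
  have -> : r = s by apply/le_anti; rewrite (le_trans le_st)// andbT (le_trans rb)// -ab.
  by rewrite subrr enorm0 addr0.
apply: le_anti; apply/andP; split; first by rewrite [leRHS]addrC ler_enorm_dist.
have N0 := lipschitz_path_ge0 gN.
apply/ler_addgt0Pr => e e0.
(* The map [f] below contracts [a, b] towards its midpoint, into the open interval, and moves each
   point of the path by at most [N * h]. Three chords with two ends each give the factor 6. *)
pose h := Num.min (2^-1) (e / (6 * (N + 1))).
have N1 : 0 < 6 * (N + 1) by rewrite mulr_gt0// ltr_wpDl.
have h0 : 0 < h by rewrite lt_min invr_gt0 ltr0n/= divr_gt0.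
have h1 : h < 1 by rewrite gt_min invf_lt1// ltr1n.
have he : 6 * (N * h) <= e.
  have : h <= e / (6 * (N + 1)) by rewrite ge_min lexx orbT.
  rewrite ler_pdivlMr// => hh; rewrite (le_trans _ hh)//; nra.
pose m := (a + b) / 2; pose f q := q + h * (m - q).
have fab q : a <= q <= b -> a < f q < b.
  by rewrite /f /m => /andP[q1 q2]; apply/andP; split; nra.
have fmono q q' : q <= q' -> f q <= f q' by rewrite /f; nra.
have fq q : a <= q <= b -> enorm (gamma (f q) - gamma q) <= N * h.
  move=> qab; have /andP[f1 f2] := fab q qab; have /andP[q1 q2] := qab.
  rewrite (le_trans (gN _ _ _ _))//; [apply/andP; split; lra|apply/andP; split; lra|].
  rewrite ler_wpM2l// /f addrAC subrr add0r normrM (gtr0_norm h0) ger_pMr//.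
  by rewrite ler_norml /m; apply/andP; split; lra.
have sab : a <= s <= b by apply/andP; split; lra.
have tab : a <= t <= b by apply/andP; split; lra.
have rab : a <= r <= b by apply/andP; split; lra.
have E : enorm (gamma (f r) - gamma (f s)) =
    enorm (gamma (f t) - gamma (f s)) + enorm (gamma (f r) - gamma (f t)).
  have /andP[? _] := fab s sab; have /andP[_ ?] := fab r rab.
  by apply: st => //; exact: fmono.
have tri p q : a <= p <= b -> a <= q <= b ->
   `|enorm (gamma (f p) - gamma (f q)) - enorm (gamma p - gamma q)| <= 2 * (N * h).
  move=> pab qab; rewrite (le_trans (ler_dist_enorm _ _))//.
  have -> : gamma (f p) - gamma (f q) - (gamma p - gamma q) =
     (gamma (f p) - gamma p) - (gamma (f q) - gamma q).
    by apply/rowP => i; rewrite !mxE; ring.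
  by rewrite (le_trans (ler_enormB _ _))//; have := fq p pab; have := fq q qab; lra.
have := tri r s rab sab; have := tri t s tab sab; have := tri r t rab tab.
rewrite !ler_norml => /andP[? ?] /andP[? ?] /andP[? ?]; lra.
Qed.

Lemma last_corner gamma N g : lipschitz_path gamma N -> 0 <= g <= 1 ->
  exists u, [/\ 0 <= u <= g, corner gamma u & forall s, 0 <= s <= g -> corner gamma s -> s <= u].
Proof.
move=> gN /andP[g0 g1].
have [->|gn1] := eqVneq g 1.
  by exists 1; split; [rewrite ler01 lexx|constructor 3|move=> s /andP[]].
have {gn1}g1 : g < 1 by rewrite lt_neqAle gn1.
have [[t tg Ft]|nF] := pselect (exists2 t, 0 <= t <= g & F (gamma t)).
  have [u [ug Fu hu]] := last_visit gN Fcl (lexx 0) (ltW g1) tg Ft.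
  exists u; split => //; first by constructor 1.
  move=> s sg [Fs|->|s1]; [exact: hu|by have /andP[] := ug|].
  by move: sg; rewrite s1 (leNgt 1 g) g1 andbF.
exists 0; split; [by rewrite lexx|by constructor 2|].
move=> s sg [Fs|->//|s1]; first by case: nF; exists s.
by move: sg; rewrite s1 (leNgt 1 g) g1 andbF.
Qed.

Lemma first_corner gamma N g : lipschitz_path gamma N -> 0 <= g <= 1 ->
  exists u, [/\ g <= u <= 1, corner gamma u & forall s, g <= s <= 1 -> corner gamma s -> u <= s].
Proof.
move=> gN /andP[g0 g1].
have [->|gn0] := eqVneq g 0.
  by exists 0; split; [rewrite ler01 lexx|constructor 2|move=> s /andP[]].
have {gn0}g0 : 0 < g by rewrite lt_neqAle eq_sym gn0.
have [[t tg Ft]|nF] := pselect (exists2 t, g <= t <= 1 & F (gamma t)).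
  have [u [ug Fu hu]] := first_visit gN Fcl (ltW g0) (lexx 1) tg Ft.
  exists u; split => //; first by constructor 1.
  move=> s sg [Fs|s0|->]; [exact: hu| |by have /andP[] := ug].
  by move: sg; rewrite s0 leNgt g0.
exists 1; split; [by rewrite lexx g1|by constructor 3|].
move=> s sg [Fs|s0|->//]; first by case: nF; exists s.
by move: sg; rewrite s0 (leNgt g 0) g0.
Qed.

(** The grid points need not be corners. Between consecutive corners the path is straight, so a
    chord between grid points is controlled by the corners next to them: the last one before, [u i],
    and the first one after, [v i]. *)
Lemma riemann_sum_le_corner N gamma C n : admissible N gamma ->
  (forall k tau, corner_chain gamma k tau ->
    \sum_(l < k) enorm (gamma (tau l.+1) - gamma (tau l)) <= C) ->
  riemann_sum (fun=> 1) gamma n.+1 <= C.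
Proof.
move=> [gN g0 g1 gst] hC.
pose g i : R := i%:R / n.+1%:R.
have n0 : 0 < n.+1%:R :> R by [].
have g01 i : (i <= n.+1)%N -> 0 <= g i <= 1.
  by move=> i_n; rewrite divr_ge0//= ler_pdivrMr// mul1r ler_nat.
have gS i : g i <= g i.+1 by rewrite ler_pM2r ?invr_gt0// ler_nat.
have /choice[u uP] : forall i, exists u, (i <= n.+1)%N ->
   [/\ 0 <= u <= g i, corner gamma u & forall s, 0 <= s <= g i -> corner gamma s -> s <= u].
  move=> i; have [i_n|] := leqP i n.+1; last by exists 0.
  by have [v vP] := last_corner gN (g01 i i_n); exists v.
have /choice[v vP] : forall i, exists u, (i <= n.+1)%N ->
   [/\ g i <= u <= 1, corner gamma u & forall s, g i <= s <= 1 -> corner gamma s -> u <= s].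
  move=> i; have [i_n|] := leqP i n.+1; last by exists 0.
  by have [v vP] := first_corner gN (g01 i i_n); exists v.
(* If no corner lies in ]g i, g i.+1], then [u i.+1 = u i] and the minimum discards [v i], keeping
   the chain nondecreasing. *)
pose m i := Num.min (v i) (u i.+1).
have uS i : (i <= n)%N -> u i <= u i.+1.
  move=> i_n; have [/andP[ui0 uig] cu _] := uP i (leqW i_n); have [_ _ h] := uP i.+1 i_n.
  by apply: h => //; rewrite ui0 (le_trans uig).
have um i : (i <= n)%N -> u i <= m i <= u i.+1.
  move=> i_n; have [/andP[_ uig] _ _] := uP i (leqW i_n).
  have [/andP[vg _] _ _] := vP i (leqW i_n).
  by rewrite /m le_min (le_trans uig vg) uS//= ge_min lexx orbT.
have cm i : (i <= n)%N -> corner gamma (m i).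
  move=> i_n; rewrite /m; have [_ cv _] := vP i (leqW i_n); have [_ cu _] := uP i.+1 i_n.
  by rewrite /Num.min; case: ifP.
(* Compare each grid point with the last corner before it; the defects telescope. *)
pose phi i := enorm (gamma (g i) - gamma (u i)).
have step i : (i <= n)%N -> enorm (gamma (g i.+1) - gamma (g i)) <=
   phi i.+1 - phi i + (enorm (gamma (m i) - gamma (u i)) + enorm (gamma (u i.+1) - gamma (m i))).
  move=> i_n; have i_n' := leqW i_n.
  have [/andP[ui0 uig] cui ui] := uP i i_n'; have [/andP[us0 usg] cus us] := uP i.+1 i_n.
  have [/andP[vg v1] cv vv] := vP i i_n'.
  have /andP[gi0 gi1] := g01 i i_n'; have /andP[gs0 gs1] := g01 i.+1 i_n.
  have [usgi|gius] := leP (u i.+1) (g i).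
    have uE : u i.+1 = u i.
      by apply/le_anti; rewrite uS// andbT; apply: ui => //; rewrite us0.
    have mE : m i = u i by rewrite /m uE (min_idPr _)// (le_trans uig).
    have st : straight gamma (u i) (g i.+1).
      have [ug|gu] := ltP (u i) (g i.+1); last first.
        move=> s t r h1 h2 h3 h4; exfalso.
        by have := lt_le_trans h4 gu; rewrite ltNge (le_trans (ltW h1))// (le_trans h2).
      apply: gst => // t /andP[t1 t2] Ft.
      have : t <= u i.+1 by apply: us; [rewrite (le_trans ui0 (ltW t1)) ltW|constructor 1].
      by rewrite uE leNgt t1.
    rewrite mE uE !subrr enorm0 addr0 addr0 /phi uE.
    by rewrite (straight_closed gN ui0 gs1 st (lexx _) uig (gS i) (lexx _)) addrAC subrr add0r.
  have vu : v i <= u i.+1.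
    by apply: vv => //; rewrite (ltW gius) (le_trans usg).
  have mE : m i = v i by rewrite /m (min_idPl vu).
  have st : straight gamma (u i) (v i).
    have [uv|vu'] := ltP (u i) (v i); last first.
      move=> s t r h1 h2 h3 h4; exfalso.
      by have := lt_le_trans h4 vu'; rewrite ltNge (le_trans (ltW h1))// (le_trans h2).
    apply: gst => // t /andP[t1 t2] Ft.
    have [tg|gt] := leP t (g i).
      have : t <= u i by apply: ui; [rewrite (le_trans ui0 (ltW t1))|constructor 1].
      by rewrite leNgt t1.
    have : v i <= t by apply: vv; [rewrite (ltW gt) (le_trans (ltW t2))|constructor 1].
    by rewrite leNgt t2.
  have := straight_closed gN ui0 v1 st (lexx _) uig vg (lexx _).
  rewrite mE /phi => ->.
  have h1 := ler_enorm_dist (gamma (u i.+1)) (gamma (g i.+1)) (gamma (g i)).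
  have h2 := ler_enorm_dist (gamma (v i)) (gamma (u i.+1)) (gamma (g i)).
  lra.
(* The interleaved chain u 0, m 0, u 1, m 1, ..., u n.+1, with two steps per cell. *)
pose tau l := if odd l then m l./2 else u l./2.
have chain : corner_chain gamma n.+1.*2 tau.
  split.
  - by rewrite /tau/=; have [/andP[]] := uP 0%N (leq0n _).
  - rewrite /tau odd_double doubleK; have [/andP[_ h] _ _] := uP n.+1 (leqnn _).
    by rewrite (le_trans h)//; have /andP[] := g01 n.+1 (leqnn _).
  - move=> l ln; rewrite /tau/= uphalf_half.
    have l2 : (l./2 <= n)%N by lia.
    by have /andP[h1 h2] := um _ l2; case: (odd l).
  - move=> l ln; rewrite /tau; case: ifPn => lo.
      by apply: cm; have := odd_double_half l; rewrite lo; lia.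
    by have [] := uP l./2 _; first lia.
have sumE k : \sum_(l < k.*2) enorm (gamma (tau l.+1) - gamma (tau l)) =
    \sum_(i < k) (enorm (gamma (m i) - gamma (u i)) + enorm (gamma (u i.+1) - gamma (m i))).
  elim: k => [|k IH]; first by rewrite !big_ord0.
  rewrite doubleS !big_ord_recr/= IH addrA; congr (_ + _ + _).
    by rewrite /tau/= odd_double/= uphalf_double doubleK.
  by rewrite /tau/= odd_double/= uphalf_double doubleK.
have := hC _ _ chain; rewrite sumE; apply: le_trans.
rewrite /riemann_sum; under eq_bigr do rewrite mul1r.
apply: (@le_trans _ _ (\sum_(i < n.+1) (phi i.+1 - phi i +
   (enorm (gamma (m i) - gamma (u i)) + enorm (gamma (u i.+1) - gamma (m i)))))).
  by apply: ler_sum => i _; exact: (step i (leq_ord i)).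
rewrite big_split/= gerDr -(big_mkord xpredT (fun i => phi i.+1 - phi i)) telescope_sumr//.
(* The telescoped defect is nonpositive because time 1 is itself a corner, so that
   [phi n.+1 = 0]. *)
have gn1 : g n.+1 = 1 by rewrite /g divff// gt_eqF.
have un1 : u n.+1 = 1.
  have [/andP[_ h1] _ h2] := uP n.+1 (leqnn _); apply/le_anti; rewrite -{1}gn1 h1/=.
  by apply: h2; [rewrite ler01 gn1 lexx|constructor 3].
by rewrite /phi gn1 un1 subrr enorm0 sub0r oppr_le0.
Qed.

Lemma nbhs_eball (p : 'rV[R]_d) (A : set 'rV[R]_d) :
  nbhs p A -> exists2 h, 0 < h & forall q, enorm (q - p) < h -> A q.
Proof.
move=> /(@nbhs_normP _ 'rV[R]_d)[h /= h0 hA]; exists h => // q qp; apply: hA.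
by rewrite /= distrC (le_lt_trans (ler_norm_enorm _)).
Qed.

Lemma eball_nbhs (p : 'rV[R]_d) h : 0 < h -> nbhs p [set q | enorm (q - p) < h].
Proof.
move=> h0; apply: open_nbhs_nbhs; split; first exact: eball_open.
by rewrite /= subrr enorm0.
Qed.

Lemma weight_unif_continuous (r e : R) : 0 < e -> exists2 h, 0 < h &
  forall p q : 'rV[R]_d, enorm p <= r -> enorm (p - q) < h -> `|w p - w q| <= e.
Proof.
move=> e0; have [wc _] := hw.
have : compact [set z : 'rV[R]_d | enorm z <= r] by exact: eball_compact.
move=> /compact_near_coveringP/(_ R (0^'+)
  (fun h p => forall q, enorm (p - q) < h -> `|w p - w q| <= e)) H.
have : \forall h \near 0^'+, [set z : 'rV[R]_d | enorm z <= r] `<=`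
    (fun p => forall q, enorm (p - q) < h -> `|w p - w q| <= e).
  apply: H => p pr.
  have e20 : 0 < e / 2 by rewrite divr_gt0.
  have /nbhs_eball[h h0 hp] : nbhs p [set q | `|w p - w q| <= e / 2].
    by have /cvgrPdist_le/(_ _ e20) := wc p.
  have h20 : 0 < h / 2 by rewrite divr_gt0.
  exists ([set q | enorm (q - p) < h / 2], [set k | 0 < k < h / 2]) => /=.
    split; first exact: eball_nbhs.
    near=> k; apply/andP; split; first by near: k; exact: nbhs_right_gt.
    by near: k; exact: nbhs_right_lt.
  move=> [p' k] /= [p'p /andP[k0 kh]] q p'q.
  have h1 : `|w p - w p'| <= e / 2 by apply: hp; lra.
  have h2 : `|w p - w q| <= e / 2.
    apply: hp; have := ler_enorm_dist p' q p; rewrite (enormBC q p'); lra.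
  rewrite distrC in h1; have := ler_distD (w p) (w p') (w q); lra.
move=> Hn; near (0:R)^'+ => h; exists h.
  by near: h; exact: nbhs_right_gt.
move=> p q pr pq; have := near Hn h; apply => //.
Unshelve. all: by end_near. Qed.

(** The bound on corner chains passes to Riemann sums of the weight 1, then to the length; the extra
    1 is the slack of [wlen_le_riemann]. *)
Lemma minimal_path_length K R1 c : 0 <= K -> 0 < c ->
  (forall z, R1 <= enorm z -> c <= w z) -> (forall a : 'rV[R]_d, doubling_at a) ->
  exists2 L, 0 <= L & forall N gamma, minimal_path N gamma -> wlen w gamma 0 1 <= K ->
    wlen (fun=> 1) gamma 0 1 <= L.
Proof.
move=> K0 c0 wc dbl; pose R2 := Num.max R1 (enorm x) + K / c + 1.
have R20 : 0 <= R2.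
  by rewrite !addr_ge0 ?divr_ge0 ?(ltW c0)// le_max enorm_ge0 orbT.
have [C C0 hC] := corner_sum_bound K0 R20 dbl.
exists (C + 1); first by rewrite addr_ge0.
move=> N gamma gmin gK; have [adm _] := gmin; have [gN _ _ _] := adm.
have gR := minimal_path_confined gmin gK K0 c0 wc.
have [n _ h] := wlen_le_riemann 0 gN (@weight1 R d) ltr01.
apply: (le_trans h); rewrite lerD2r; apply: (riemann_sum_le_corner _ adm) => k tau tauP.
exact: (hC N gamma k tau).
Qed.

Lemma admissible_bounded N gamma t : admissible N gamma -> 0 <= t <= 1 ->
  enorm (gamma t) <= enorm x + N.
Proof.
move=> [gN g0 _ _] t01; have := gN t 0 t01; rewrite lexx ler01 => /(_ isT).
have /andP[t0 t1] := t01; have N0 := lipschitz_path_ge0 gN.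
rewrite g0 subr0 ger0_norm// => h; have := lerB_enorm (gamma t) x.
have : N * t <= N by rewrite ler_piMr.
lra.
Qed.

Lemma riemann_sum_le_wlen N (e : R) : 0 < e -> exists n0, forall n gamma,
  (n0 <= n)%N -> admissible N gamma ->
  riemann_sum w gamma n.+1 <= wlen w gamma 0 1 + e.
Proof.
(* [N] is known to be nonnegative only once a path is given, but [n0] has to be chosen before; hence
   the absolute value. *)
move=> e0; have N1 : 0 < `|N| + 1 by rewrite ltr_wpDl.
have e10 : 0 < e / (`|N| + 1) by rewrite divr_gt0.
have [h h0 hw'] := weight_unif_continuous (enorm x + N) e10.
have h10 : 0 < h / (`|N| + 1) by rewrite divr_gt0.
have [n0 _ hn0] := near_infty_natSinv_lt (PosNum h10).
exists n0 => n gamma n0n adm; have [gN g0 g1 _] := adm.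
have n_gt0 : 0 < n.+1%:R :> R by [].
have N0 := lipschitz_path_ge0 gN.
have hn := hn0 n n0n; rewrite /= (ger0_norm N0) in hn.
pose tau i : R := i%:R / n.+1%:R.
have tau0 : tau 0%N = 0 by rewrite /tau mul0r.
have tau1 : tau n.+1 = 1 by rewrite /tau divff// gt_eqF.
have tS i : tau i <= tau i.+1 by rewrite ler_pM2r ?invr_gt0// ler_nat.
have t01 i : (i <= n.+1)%N -> 0 <= tau i <= 1.
  by move=> i_n; rewrite divr_ge0//= ler_pdivrMr// mul1r ler_nat.
have := @riemann_le_wlen R d gamma N gN w tau n.+1 (e / (`|N| + 1)) hw.
rewrite tau0 tau1 lexx => /(_ isT (lexx 1) (fun i _ => tS i)) H.
apply: le_trans (H _) _.
  move=> i t i_n /andP[ti1 ti2].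
  have ti01 := t01 i (ltnW i_n); have /andP[ti0 _] := ti01.
  have /andP[_ ts1] := t01 i.+1 i_n.
  have tt01 : 0 <= t <= 1 by rewrite (le_trans ti0) ?(le_trans ti2).
  have : `|w (gamma (tau i)) - w (gamma t)| <= e / (`|N| + 1).
    apply: hw'; first exact: admissible_bounded adm ti01.
    apply: le_lt_trans (gN _ _ ti01 tt01) _.
    apply: (@le_lt_trans _ _ (N * n.+1%:R^-1)).
      rewrite ler_wpM2l// ler0_norm ?subr_le0// opprB.
      have -> : n.+1%:R^-1 = tau i.+1 - tau i :> R.
        by rewrite /tau -mulrBl -natrB// subSnn mul1r.
      by rewrite lerD2r.
    move: hn; rewrite ltr_pdivlMr; last by rewrite ltr_wpDl.
    by apply: le_lt_trans; rewrite mulrC ler_wpM2l// lerDl.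
  by rewrite ler_norml lerBlDl => /andP[_].
rewrite lerD2l mulrAC ler_pdivrMr// ler_wpM2l ?(ltW e0)//.
rewrite (le_trans (wlen1_lip gN (lexx 0) ler01 (lexx 1)))// subr0 mulr1 ger0_norm//.
by rewrite lerDl.
Qed.

(** Arc length alone is not injective where the path rests. Adding the time itself makes [phi]
    strictly increasing and raises the Lipschitz constant of the reparametrized path only by 1. *)
Lemma admissible_reparam N gamma L : admissible N gamma -> 0 <= L ->
  wlen (fun=> 1) gamma 0 1 <= L -> exists2 sigma, admissible (1 + L) sigma &
    wlen w sigma 0 1 <= wlen w gamma 0 1.
Proof.
move=> adm L0 gL; have [gN g0 g1 gst] := adm; have N0 := lipschitz_path_ge0 gN.
pose l t := wlen (fun=> 1) gamma 0 t; pose l1 := l 1.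
have l10 : 0 <= l1 by rewrite /l1 /l (wlen_ge0 _ _ _ (@weight1 R d)).
have l1L : l1 <= L by [].
have w1 := @weight1 R d.
have lD s t : 0 <= s -> s <= t -> t <= 1 -> l t - l s = wlen (fun=> 1) gamma s t.
  by move=> s0 st t1; rewrite /l (wlenD gN w1 (lexx 0) s0 st t1) addrAC subrr add0r.
pose phi t := (t + l t) / (1 + l1).
have l1p : 0 < 1 + l1 by rewrite ltr_pwDl.
have phiB s t : 0 <= s -> s <= t -> t <= 1 ->
    (phi t - phi s) * (1 + l1) = (t - s) + wlen (fun=> 1) gamma s t.
  by move=> s0 st t1; rewrite -lD// /phi; field; rewrite gt_eqF.
have phi_lt s t : 0 <= s -> s < t -> t <= 1 -> phi s < phi t.
  move=> s0 st t1; rewrite -subr_gt0 -(pmulr_lgt0 _ l1p) phiB ?(ltW st)//.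
  by rewrite ltr_pwDl ?subr_gt0// wlen_ge0.
have phi_le s t : 0 <= s -> s <= t -> t <= 1 -> phi s <= phi t.
  by move=> s0; rewrite le_eqVlt => /predU1P[->//|st t1]; apply/ltW/phi_lt.
have phi0 : phi 0 = 0 by rewrite /phi /l wlen_refl addr0 mul0r.
have phi1 : phi 1 = 1 by rewrite /phi -/l1 divff// gt_eqF.
have phi_inj s t : 0 <= s <= 1 -> 0 <= t <= 1 -> phi s = phi t -> s = t.
  move=> /andP[s0 s1] /andP[t0 t1] E; apply/eqP; rewrite eq_le !leNgt.
  by apply/andP; split; apply/negP => h; have := phi_lt _ _ _ h; rewrite E ltxx;
    [move=> /(_ t0 s1)|move=> /(_ s0 t1)].
have phic : {within `[0, 1], continuous phi}.
  have lip s t : 0 <= s -> s <= t -> t <= 1 -> `|phi s - phi t| <= (1 + N) * `|s - t|.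
    move=> s0 st t1; rewrite ler0_norm ?subr_le0 ?phi_le// opprB ler0_norm ?subr_le0// opprB.
    have h := phiB s t s0 st t1; have h' := wlen1_lip gN s0 st t1.
    have : phi t - phi s <= (phi t - phi s) * (1 + l1).
      by rewrite ler_peMr ?subr_ge0 ?phi_le// lerDl.
    lra.
  have cc : continuous (phi \o clamp01).
    apply: (@normed_lipschitz_continuous _ R^o R^o _ (1 + N)) => s t.
    apply: (@le_trans _ _ ((1 + N) * `|clamp01 s - clamp01 t|)); last first.
      by rewrite ler_wpM2l ?clamp01_lip// addr_ge0.
    have /andP[s0 s1] := clamp01_itv s; have /andP[t0 t1] := clamp01_itv t.
    have [st|ts] := leP (clamp01 s) (clamp01 t); first exact: lip.
    by rewrite distrC (distrC (clamp01 s)); apply: lip => //; exact: ltW.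
  apply: (subspace_eq_continuous (f := phi \o clamp01)).
    by move=> t; rewrite inE/= in_itv/= => t01; rewrite /= clamp01_id.
  exact: continuous_subspaceT.
have /choice[tau tauP] : forall s, exists t, 0 <= s <= 1 -> 0 <= t <= 1 /\ phi t = s.
  move=> s; have [s01|ns] := boolP (0 <= s <= 1); last by exists 0.
  have [|t] := IVT ler01 phic (v := s);
    first by rewrite phi0 phi1 (min_idPl ler01) (max_idPr ler01).
  by rewrite in_itv/= => t01 ts; exists t.
have tau_phi t : 0 <= t <= 1 -> tau (phi t) = t.
  move=> t01; have /andP[t0 t1] := t01.
  have p01 : 0 <= phi t <= 1 by rewrite -{1}phi0 -phi1 !phi_le.
  by have [h1 h2] := tauP _ p01; exact: phi_inj.
have tau_le s t : 0 <= s -> s <= t -> t <= 1 -> tau s <= tau t.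
  move=> s0 st t1; have [s01 t01] : 0 <= s <= 1 /\ 0 <= t <= 1.
    by rewrite s0 t1 (le_trans st t1) (le_trans s0 st).
  have [/andP[h1 h2] h3] := tauP s s01; have [/andP[h4 h5] h6] := tauP t t01.
  by rewrite leNgt; apply/negP => h; have := phi_lt _ _ h4 h h2; rewrite h3 h6 ltNge st.
have tau0 : tau 0 = 0 by rewrite -{1}phi0 tau_phi// lexx ler01.
have tau1 : tau 1 = 1 by rewrite -{1}phi1 tau_phi// lexx ler01.
pose sigma := gamma \o tau.
have sN : lipschitz_path sigma (1 + l1).
  suff H s t : 0 <= s -> s <= t -> t <= 1 -> enorm (sigma t - sigma s) <= (1 + l1) * (t - s).
    move=> s t /andP[s0 s1] /andP[t0 t1]; have [st|ts] := leP s t.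
      by rewrite enormBC ler0_norm ?subr_le0// opprB H.
    by rewrite gtr0_norm ?subr_gt0// H// ltW.
  move=> s0 st t1; have [s01 t01] : 0 <= s <= 1 /\ 0 <= t <= 1.
    by rewrite s0 t1 (le_trans st t1) (le_trans s0 st).
  have [/andP[h1 h2] h3] := tauP s s01; have [/andP[h4 h5] h6] := tauP t t01.
  have tst := tau_le s t s0 st t1.
  rewrite /sigma/= (le_trans (chord_le_wlen gN h1 tst h5))//.
  have := phiB _ _ h1 tst h5; rewrite h3 h6 mulrC => ->.
  by rewrite lerDr subr_ge0.
have sst a b : 0 <= a -> a < b -> b <= 1 ->
    (forall t, a < t < b -> ~ F (sigma t)) -> straight sigma a b.
  move=> a0 ab b1 sF s t r las le_st tr rb.
  have [a01 b01] : 0 <= a <= 1 /\ 0 <= b <= 1.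
    by rewrite a0 b1 (le_trans (ltW ab) b1) (le_trans a0 (ltW ab)).
  have [/andP[ta0 ta1] pta] := tauP a a01; have [/andP[tb0 tb1] ptb] := tauP b b01.
  have tab : tau a <= tau b by apply: tau_le => //; exact: ltW.
  have [tab'|] := ltP (tau a) (tau b); last first.
    by move=> h; move: ab; rewrite -pta -ptb (_ : tau a = tau b) ?ltxx//; apply/le_anti;
      rewrite tab h.
  (* A time [t'] strictly between is [tau (phi t')] with [phi t'] in ]a, b[, so [gamma] avoids F
     there. *)
  have st : straight gamma (tau a) (tau b).
    apply: gst => // t' /andP[h1 h2].
    have t'01 : 0 <= t' <= 1 by rewrite (le_trans ta0 (ltW h1)) (le_trans (ltW h2) tb1).
    have /andP[t'0 t'1] := t'01.
    have := sF (phi t'); rewrite /sigma/= tau_phi//; apply.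
    by rewrite -{1}pta -ptb !phi_lt.
  have s0 := le_trans a0 (ltW las); have r1 := le_trans (ltW rb) b1.
  apply: (straight_closed gN ta0 tb1 st); apply: tau_le => //.
  - exact: ltW.
  - exact: le_trans (le_trans le_st tr) r1.
  - exact: le_trans tr r1.
  - exact: le_trans le_st.
  - exact: le_trans (le_trans s0 le_st) tr.
  - exact: ltW.
have adms : admissible (1 + l1) sigma.
  by split => //; rewrite /sigma/= ?tau0 ?tau1.
exists sigma.
  case: adms => h1 h2 h3 h4; split => // s t s01 t01.
  by rewrite (le_trans (h1 s t s01 t01))// ler_wpM2r// lerD2l.
(* In place of a change of variables: a Riemann sum of [sigma] on the uniform grid [q] is a Riemann
   sum of [gamma] on the subdivision [tau \o q]. Half of [e] is spent on each comparison;
   [e / 2 / (1 + l1)] gets multiplied by the length [l1]. *)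
apply/ler_addgt0Pr => e e0.
have e20 : 0 < e / 2 by rewrite divr_gt0.
have e30 : 0 < e / 2 / (1 + l1) by rewrite divr_gt0.
have [h h0 hw'] := weight_unif_continuous (enorm x + N) e30.
have h10 : 0 < h / (1 + l1) by rewrite divr_gt0.
have [n0 _ hn0] := near_infty_natSinv_lt (PosNum h10).
have [n n0n hn] := wlen_le_riemann n0 sN hw e20.
have hn' := hn0 n n0n; rewrite /= in hn'.
apply: (le_trans hn); rewrite [e in leRHS]splitr addrA lerD2r.
have n_gt0 : 0 < n.+1%:R :> R by [].
pose q i : R := i%:R / n.+1%:R.
have q0 : q 0%N = 0 by rewrite /q mul0r.
have q1 : q n.+1 = 1 by rewrite /q divff// gt_eqF.
have qS i : q i <= q i.+1 by rewrite ler_pM2r ?invr_gt0// ler_nat.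
have q01 i : (i <= n.+1)%N -> 0 <= q i <= 1.
  by move=> i_n; rewrite divr_ge0//= ler_pdivrMr// mul1r ler_nat.
have := @riemann_le_wlen R d gamma N gN w (tau \o q) n.+1 (e / 2 / (1 + l1)) hw.
rewrite /= q0 q1 tau0 tau1 lexx => /(_ isT (lexx 1)) H.
apply: le_trans (H _ _) _.
- move=> i i_n; have /andP[qi0 qi1] := q01 i (ltnW i_n); have /andP[_ qs1] := q01 i.+1 i_n.
  exact: tau_le.
- move=> i t i_n /andP[ti1 ti2].
  have qi01 := q01 i (ltnW i_n); have /andP[qi0 qi1] := qi01.
  have qs01 := q01 i.+1 i_n; have /andP[_ qs1] := qs01.
  have [/andP[h1 h2] h3] := tauP _ qi01; have [/andP[h4 h5] h6] := tauP _ qs01.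
  have t0 := le_trans h1 ti1; have t1 := le_trans ti2 h5.
  have t01 : 0 <= t <= 1 by rewrite t0.
  have p1 : q i <= phi t by rewrite -h3; exact: phi_le.
  have p2 : phi t <= q i.+1 by rewrite -h6; exact: phi_le.
  have p01 : 0 <= phi t <= 1 by rewrite (le_trans qi0 p1) (le_trans p2 qs1).
  have : `|w (gamma (tau (q i))) - w (gamma t)| <= e / 2 / (1 + l1).
    apply: hw'; first by apply: (admissible_bounded adm); rewrite h1.
    have -> : gamma t = sigma (phi t) by rewrite /sigma/= tau_phi.
    apply: le_lt_trans (sN _ _ qi01 p01) _.
    move: hn'; rewrite ltr_pdivlMr// mulrC; apply: le_lt_trans.
    rewrite ler_wpM2l ?(ltW l1p)// ler0_norm ?subr_le0// opprB.
    have -> : n.+1%:R^-1 = q i.+1 - q i :> R.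
      by rewrite /q -mulrBl -natrB// subSnn mul1r.
    by rewrite lerD2r.
  by rewrite ler_norml lerBlDl => /andP[_].
rewrite lerD2l mulrAC ler_pdivrMr// ler_wpM2l ?(ltW e20)// -/l1.
by rewrite lerDr.
Qed.

(** * Limits of admissible paths and existence of minimizers *)

Lemma ultra_fmap (T U : Type) (f : T -> U) (G : set_system T) :
  UltraFilter G -> UltraFilter (f @ G).
Proof.
move=> GU; have GP := @ultra_proper _ _ GU.
split; first exact: fmap_proper_filter.
move=> H HP fGH; apply/seteqP; split => [A HA|//].
rewrite /fmap/=; have [//|GnA] := in_ultra_setVsetC (f @^-1` A) GU.
have /fGH HnA : (f @ G) (~` A) by [].
have : H (A `&` ~` A) by exact: filterI.
by rewrite setICr => /filter_ex[].
Qed.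

(** The approximating paths may meet F near [a] and [b], so they are only assumed straight on
    smaller intervals, each for G-many indices. The additivity of three chords then passes to the
    limit, with an error of [e / 6] at each end. *)
Lemma straight_limit (gamma_ : nat -> R -> 'rV[R]_d) gamma (G : set_system nat) N a b
  : ProperFilter G ->
  (forall k, lipschitz_path (gamma_ k) N) -> lipschitz_path gamma N ->
  (forall e, 0 < e -> G [set k | forall t, 0 <= t <= 1 -> enorm (gamma_ k t - gamma t) <= e]) ->
  0 <= a -> b <= 1 ->
  (forall s r, a < s -> s <= r -> r < b -> G [set k | straight (gamma_ k) s r]) ->
  straight gamma a b.
Proof.
move=> GP gkN gN unif a0 b1 st s t r las le_st tr rb.
apply: le_anti; apply/andP; split; first by rewrite [leRHS]addrC ler_enorm_dist.
apply/ler_addgt0Pr => e e0; have e60 : 0 < e / 6 by rewrite divr_gt0.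
have sr := le_trans le_st tr.
have [k [hs hu]] := filter_ex (filterI (st s r las sr rb) (unif _ e60)).
have [s0 r1] : 0 <= s /\ r <= 1 by split; [exact: le_trans (ltW las)|exact: le_trans (ltW rb) b1].
have s01 : 0 <= s <= 1 by rewrite s0 (le_trans sr).
have t01 : 0 <= t <= 1 by rewrite (le_trans s0 le_st) (le_trans tr).
have r01 : 0 <= r <= 1 by rewrite r1 (le_trans s0).
have E := straight_closed (gkN k) s0 r1 hs (lexx s) le_st tr (lexx r).
have tri p q : 0 <= p <= 1 -> 0 <= q <= 1 ->
   `|enorm (gamma_ k p - gamma_ k q) - enorm (gamma p - gamma q)| <= e / 3.
  move=> p01 q01; rewrite (le_trans (ler_dist_enorm _ _))//.
  have -> : gamma_ k p - gamma_ k q - (gamma p - gamma q) =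
     (gamma_ k p - gamma p) - (gamma_ k q - gamma q).
    by apply/rowP => i; rewrite !mxE; ring.
  by rewrite (le_trans (ler_enormB _ _))//; have := hu p p01; have := hu q q01; lra.
have := tri r s r01 s01; have := tri t s t01 s01; have := tri r t r01 t01.
rewrite !ler_norml => /andP[? ?] /andP[? ?] /andP[? ?]; lra.
Qed.

(** A version of Arzela-Ascoli: the limit along an ultrafilter exists at every time at once, and the
    common Lipschitz constant makes the convergence uniform. *)
Lemma admissible_limit (gamma_ : nat -> R -> 'rV[R]_d) N : (forall k, admissible N (gamma_ k)) ->
  exists G : set_system nat, exists gamma : R -> 'rV[R]_d,
  [/\ UltraFilter G, \oo `<=` G, admissible N gamma &
    forall e, 0 < e -> G [set k | forall t, 0 <= t <= 1 -> enorm (gamma_ k t - gamma t) <= e]].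
Proof.
move=> adm; have N0 : 0 <= N by have [/lipschitz_path_ge0] := adm 0%N.
have [G [GU ooG]] := @ultraFilterLemma nat \oo _.
have GP := @ultra_proper _ _ GU.
have /choice[gamma gP] : forall t, exists p, 0 <= t <= 1 -> (gamma_ ^~ t) @ G --> (p : 'rV[R]_d).
  move=> t; have [t01|nt] := boolP (0 <= t <= 1); last by exists 0.
  have := @eball_compact (enorm x + N); rewrite compact_ultra.
  move=> /(_ _ (@ultra_fmap _ _ (gamma_ ^~ t) G GU)) [].
    suff : G [set k | enorm (gamma_ k t) <= enorm x + N] by [].
    by apply: filterE => k /=; exact: admissible_bounded (adm k) t01.
  by move=> p [_ pP]; exists p.
have lim t e : 0 <= t <= 1 -> 0 < e -> G [set k | enorm (gamma_ k t - gamma t) < e].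
  by move=> t01 e0; exact: gP t t01 _ (eball_nbhs (gamma t) e0).
have gN : lipschitz_path gamma N.
  move=> s t s01 t01; apply/ler_addgt0Pr => e e0; have e20 : 0 < e / 2 by rewrite divr_gt0.
  have [k [/= h1 h2]] := filter_ex (filterI (lim s _ s01 e20) (lim t _ t01 e20)).
  have [gkN _ _ _] := adm k; have h3 := gkN s t s01 t01.
  have h4 := ler_enorm_dist (gamma_ k s) (gamma s) (gamma t).
  have h5 := ler_enorm_dist (gamma_ k t) (gamma_ k s) (gamma t).
  rewrite (enormBC (gamma s) (gamma_ k s)) in h4; lra.
have endp t z : 0 <= t <= 1 -> (forall k, gamma_ k t = z) -> gamma t = z.
  move=> t01 gz; apply/eqP; rewrite eq_sym -subr_eq0; apply/eqP/enorm_eq0/le_anti.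
  rewrite enorm_ge0 andbT; apply/ler_addgt0Pr => e e0; rewrite add0r.
  by have [k /=] := filter_ex (lim t _ t01 e0); rewrite gz => /ltW.
have unif e : 0 < e -> G [set k | forall t, 0 <= t <= 1 -> enorm (gamma_ k t - gamma t) <= e].
  move=> e0; have e30 : 0 < e / 3 by rewrite divr_gt0.
  have h0 : 0 < e / 3 / (N + 1) by rewrite divr_gt0// ltr_wpDl.
  have [n _ /(_ n (leqnn n))/= hn] := near_infty_natSinv_lt (PosNum h0).
  have n0 : 0 < n.+1%:R :> R by [].
  pose q i : R := i%:R / n.+1%:R.
  have q01 i : (i <= n.+1)%N -> 0 <= q i <= 1.
    by move=> i_n; rewrite divr_ge0//= ler_pdivrMr// mul1r ler_nat.
  (* The grid 0, 1/(n+1), ..., 1 has n+2 points; every time is within 1/(n+1) of one of them. *)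
  have : G [set k | forall i : 'I_n.+2, enorm (gamma_ k (q i) - gamma (q i)) < e / 3].
    by apply: filter_forall => i; apply: lim => //; apply: q01; rewrite -ltnS.
  apply: filterS => k hk t t01; have /andP[t0 t1] := t01.
  pose i := Num.truncn (t * n.+1%:R).
  have /andP[i1 i2] : i%:R <= t * n.+1%:R < i.+1%:R by apply: truncn_itv; rewrite mulr_ge0.
  have i_n : (i <= n.+1)%N.
    by rewrite -(ler_nat R) (le_trans i1)// ger_pMl.
  have qi01 := q01 i i_n.
  have tq : `|t - q i| <= n.+1%:R^-1.
    have h1 : q i <= t by rewrite ler_pdivrMr.
    rewrite ger0_norm ?subr_ge0// lerBlDr -[_^-1]mul1r -mulrDl ler_pdivlMr//.
    by rewrite addrC natr1 ltW.
  have Nq : N * `|t - q i| <= e / 3.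
    apply: (@le_trans _ _ ((N + 1) * n.+1%:R^-1)).
      by apply: ler_pM => //; rewrite lerDl.
    by move: hn; rewrite ltr_pdivlMr ?ltr_wpDl// mulrC => /ltW.
  have [gkN _ _ _] := adm k.
  have h1 := gkN t (q i) t01 qi01; have h2 := gN t (q i) t01 qi01.
  have h3 := hk (Ordinal (i_n : (i < n.+2)%N)); rewrite /= in h3.
  have h4 := ler_enorm_dist (gamma_ k (q i)) (gamma_ k t) (gamma t).
  have h5 := ler_enorm_dist (gamma (q i)) (gamma_ k (q i)) (gamma t).
  rewrite (enormBC (gamma (q i)) (gamma t)) in h5; lra.
exists G, gamma; split => //; split => //.
- by apply: endp => [|k]; [rewrite lexx ler01|have [] := adm k].
- by apply: endp => [|k]; [rewrite lexx ler01|have [] := adm k].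
move=> a b a0 ab b1 gF.
apply: (straight_limit GP (fun k => let: And4 h _ _ _ := adm k in h) gN unif a0 b1).
move=> s r las sr rb.
have s0 := le_trans a0 (ltW las); have r1 := le_trans (ltW rb) b1.
(* Either G-many paths avoid F on [s, r] and are straight there, or G-many meet F at times [q k] in
   [s, r]. In the second case these times converge along [G] to some [t0], and [gamma t0] lies in
   the closed set F, against the hypothesis on [gamma]. *)
have [avoid|hit] := in_ultra_setVsetC [set k | forall t, s <= t <= r -> ~ F (gamma_ k t)] GU.
  apply: filterS avoid => k hk; have [_ _ _ gst] := adm k.
  have [lt_sr|rs] := ltP s r; last first.
    by move=> u v z h1 h2 h3 h4; have := lt_le_trans h4 (le_trans rs (le_trans (ltW h1) h2));
      rewrite ltNge h3.
  by apply: gst => // t /andP[t1 t2]; apply: hk; rewrite !ltW.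
have /choice[q qP] : forall k, exists t, ~ (forall t, s <= t <= r -> ~ F (gamma_ k t)) ->
    s <= t <= r /\ F (gamma_ k t).
  move=> k; have [h|h] := pselect (exists2 t, s <= t <= r & F (gamma_ k t)).
    by have [t h1 h2] := h; exists t.
  by exists 0 => h'; case: h' => t ht Ft; apply: h; exists t.
have := @segment_compact R s r; rewrite compact_ultra => /(_ _ (@ultra_fmap _ _ q G GU)) [].
  suff : G [set k | q k \in `[s, r]] by [].
  by apply: filterS hit => k /= /qP[+ _]; rewrite in_itv.
move=> t0 [/=]; rewrite in_itv/= => t0sr qt0.
have t0ab : a < t0 < b.
  by have /andP[h1 h2] := t0sr; rewrite (lt_le_trans las h1) (le_lt_trans h2 rb).
case: (gF t0 t0ab); apply: Fcl => A /nbhs_eball[e e0 eA].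
have e30 : 0 < e / 3 by rewrite divr_gt0.
have h0 : 0 < e / 3 / (N + 1) by rewrite divr_gt0// ltr_wpDl.
have Gq : G [set k | `|t0 - q k| < e / 3 / (N + 1)].
  by have /cvgrPdist_lt := qt0; apply.
have [k [[hq hu] hk]] := filter_ex (filterI (filterI Gq (unif _ e30)) hit).
have [qsr Fq] := qP k hk.
exists (gamma_ k (q k)); split => //; apply: eA.
have q01 : 0 <= q k <= 1 by have /andP[h1 h2] := qsr; rewrite (le_trans s0 h1) (le_trans h2 r1).
have t001 : 0 <= t0 <= 1 by have /andP[h1 h2] := t0sr; rewrite (le_trans s0 h1) (le_trans h2 r1).
have h1 := hu _ q01; have h2 := gN _ _ q01 t001.
have h3 : N * `|q k - t0| <= e / 3.
  rewrite distrC; apply: (@le_trans _ _ ((N + 1) * `|t0 - q k|)).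
    by rewrite ler_wpM2r// lerDl.
  by rewrite mulrC -ler_pdivlMr ?ltr_wpDl// ltW.
have h4 := ler_enorm_dist (gamma (q k)) (gamma_ k (q k)) (gamma t0).
lra.
Qed.

(** Lower semicontinuity along a minimizing sequence. The grid is fixed before the index [k]: its
    sum is above the weighted length of the limit up to [e / 3], is continuous along [G], and is
    below the weighted length of every [gamma_ k] up to [e / 3]; the last third is for the distance
    to the infimum. *)
Lemma exists_minimal_path N gamma0 : admissible N gamma0 ->
  exists gamma, minimal_path N gamma.
Proof.
move=> adm0; pose S := [set wlen w g 0 1 | g in admissible N].
have infS : has_inf S.
  split; first by exists (wlen w gamma0 0 1), gamma0.
  by exists 0 => _ [g _ <-]; rewrite wlen_ge0.
have /choice[gamma_ gP] : forall k
  : nat, exists g, admissible N g /\ wlen w g 0 1 < inf S + k.+1%:R^-1.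
  move=> k; have [|_ [g admg <-] h] := inf_adherent (eps := k.+1%:R^-1) _ infS;
    first by rewrite invr_gt0.
  by exists g.
have adm k : admissible N (gamma_ k) by have [] := gP k.
have [G [gamma [GU ooG admg unif]]] := admissible_limit adm.
have GP := @ultra_proper _ _ GU.
exists gamma; split; first exact: admg.
move=> g' admg'.
apply: (@le_trans _ _ (inf S)); last first.
  by apply: ge_inf; [case: infS|exists g'].
apply/ler_addgt0Pr => e e0; have e30 : 0 < e / 3 by rewrite divr_gt0.
have [gN _ _ _] := admg; have [wc _] := hw.
have [n0 hn0] := riemann_sum_le_wlen N e30.
have [n n0n hn] := wlen_le_riemann n0 gN hw e30.
apply: (le_trans hn).
have -> : inf S + e = inf S + e / 3 + e / 3 + e / 3 by field.
rewrite lerD2r.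
have n_gt0 : 0 < n.+1%:R :> R by [].
have q01 i : (i <= n.+1)%N -> 0 <= (i%:R / n.+1%:R : R) <= 1.
  by move=> i_n; rewrite divr_ge0//= ler_pdivrMr// mul1r ler_nat.
have cvt t : 0 <= t <= 1 -> (gamma_ ^~ t) @ G --> (gamma t : 'rV[R]_d).
  move=> t01 A /nbhs_eball[h h0 hA]; have h20 : 0 < h / 2 by rewrite divr_gt0.
  suff : G [set k | A (gamma_ k t)] by [].
  apply: filterS (unif _ h20) => k /= hk; apply: hA.
  by rewrite (le_lt_trans (hk t t01))// ltr_pdivrMr// ltr_pMr// ltr1n.
have cve p q : 0 <= p <= 1 -> 0 <= q <= 1 ->
    enorm (gamma_ k p - gamma_ k q) @[k --> G] --> enorm (gamma p - gamma q).
  move=> p01 q0; apply/cvgrPdist_le => h h0; have h20 : 0 < h / 2 by rewrite divr_gt0.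
  apply: filterS (unif _ h20) => k /= hk.
  rewrite distrC (le_trans (ler_dist_enorm _ _))//.
  have -> : gamma_ k p - gamma_ k q - (gamma p - gamma q) =
     (gamma_ k p - gamma p) - (gamma_ k q - gamma q).
    by apply/rowP => i; rewrite !mxE; ring.
  by rewrite (le_trans (ler_enormB _ _))//; have := hk p p01; have := hk q q0; lra.
have cvR : riemann_sum w (gamma_ k) n.+1 @[k --> G] --> riemann_sum w gamma n.+1.
  apply: (@cvg_big R^o _ _ _ _ (@add_continuous R^o)) => i _; have qi01 := q01 i (ltnW (ltn_ord i)).
  apply: cvgM; last by apply: cve => //; exact: q01.
  by apply: continuous_cvg; [exact: wc|exact: cvt].
have [m _ hm] := near_infty_natSinv_lt (PosNum e30).
have Gm : G [set k | (m <= k)%N] by apply: ooG; exists m.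
apply/ler_addgt0Pr => h h0.
have /cvgrPdist_le/(_ _ h0) Gh := cvR.
have [k [/= hk mk]] := filter_ex (filterI Gh Gm).
have h1 := hn0 n (gamma_ k) n0n (adm k); have [_ h2] := gP k.
have h3 := hm k mk; rewrite /= in h3.
move: hk; rewrite ler_norml lerBlDr => /andP[_ h4].
rewrite (le_trans h4)// addrC lerD2r (le_trans h1)// lerD2r.
by rewrite (le_trans (ltW h2))// lerD2l ltW.
Qed.

Lemma exists_global_minimal_path K R1 c N0 gamma0 : admissible N0 gamma0 ->
  0 <= K -> wlen w gamma0 0 1 <= K -> 0 < c ->
  (forall z, R1 <= enorm z -> c <= w z) -> (forall a : 'rV[R]_d, doubling_at a) ->
  exists N gamma, admissible N gamma /\
    forall N' gamma', admissible N' gamma' -> wlen w gamma 0 1 <= wlen w gamma' 0 1.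
Proof.
move=> adm0 K0 gK c0 wc dbl.
have [L L0 hL] := minimal_path_length K0 c0 wc dbl.
have admW N N' g : N <= N' -> admissible N g -> admissible N' g.
  move=> NN' [h1 h2 h3 h4]; split => // s t s01 t01.
  by rewrite (le_trans (h1 s t s01 t01))// ler_wpM2r.
(* The class is enlarged to contain [gamma0] as well as [g], so its minimizer costs at most [K] and
   has length at most [L]; reparametrized, it has the constant [1 + L], whatever [N] was. *)
have key N g : admissible N g -> exists2 s, admissible (1 + L) s & wlen w s 0 1 <= wlen w g 0 1.
  move=> admg; pose N1 := Num.max N N0.
  have adm1 : admissible N1 gamma0 by apply: admW adm0; rewrite le_max lexx orbT.
  have adm2 : admissible N1 g by apply: admW admg; rewrite le_max lexx.
  have [g1 g1min] := exists_minimal_path adm1; have [admg1 g1le] := g1min.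
  have g1K : wlen w g1 0 1 <= K by apply: le_trans (g1le _ adm1) gK.
  have [s adms hs] := admissible_reparam admg1 L0 (hL _ _ g1min g1K).
  by exists s; [exact: adms|exact: le_trans hs (g1le _ adm2)].
have [s0 adms0 _] := key N0 gamma0 adm0.
have [g [admg gle]] := exists_minimal_path adms0.
exists (1 + L), g; split; first exact: admg.
move=> N' g' admg'.
by have [s adms hs] := key N' g' admg'; apply: le_trans (gle _ adms) hs.
Qed.

End admissible_paths.

(** * The distance to measure *)

Section distance_to_measure.
Context {R : realType} {d : nat}.
Notation leb := (@lebesgue_measure R).
Variables (mu : probability (borelRd R d) R) (m p : R).
Hypotheses (m_gt0 : 0 < m) (m_le1 : m <= 1) (p_ge1 : 1 <= p).
Hypothesis dtm_fin : m = 1 -> forall x : 'rV[R]_d, (dtm mu m p x < +oo)%E.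
Implicit Types (x z : 'rV[R]_d) (u r : R).
Local Open Scope ereal_scope.

Lemma measurable_eball x r : measurable (eball x r : set (borelRd R d)).
Proof. by apply: sub_sigma_algebra; exact: eball_open. Qed.

Lemma le_mu_eball x z r s : eball x r `<=` eball z s -> mu (eball x r) <= mu (eball z s).
Proof. by move=> xz; apply: le_measure => //; rewrite inE; exact: measurable_eball. Qed.

Lemma delta_ge0 u x : 0 <= delta mu u x.
Proof. by apply: le_ereal_inf_tmp => _ [r [r0 _] <-]; rewrite lee_fin ltW. Qed.

Lemma delta_mono u v x : (u <= v)%R -> delta mu u x <= delta mu v x.
Proof.
move=> uv; apply: le_ereal_inf => _ [r [r0 hr] <-]; exists r => //; split => //.
by rewrite (le_lt_trans _ hr)// lee_fin.
Qed.

Lemma delta_lipschitz u x z : delta mu u z <= delta mu u x + (enorm (z - x))%:E.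
Proof.
rewrite -leeBlDr//; apply: le_ereal_inf_tmp => _ [r [r0 hr] <-].
rewrite leeBlDr// -EFinD; apply: ereal_inf_lbound; exists (r + enorm (z - x))%R => //.
split; first by rewrite ltr_wpDr.
apply: (lt_le_trans hr); apply: le_mu_eball => q; rewrite /eball/= => hq.
by rewrite (le_lt_trans (ler_enorm_dist x _ _))// (enormBC x) ltrD2r.
Qed.

Lemma delta_lty u x : (u < 1)%R -> delta mu u x < +oo.
Proof.
move=> u1; pose B (n : nat) : set (borelRd R d) := eball x n%:R.
have mB n : measurable (B n) by exact: measurable_eball.
have BT : \bigcup_n B n = setT.
  rewrite -subTset => z _; exists (Num.bound (enorm (z - x))) => //.
  by rewrite /B /eball/= archi_boundP.
have ndB : nondecreasing_seq B.
  by move=> i j ij; apply/subsetPset => z; rewrite /B /eball/= => /lt_le_trans; apply;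
    rewrite ler_nat.
have muT : mu setT = 1 by exact: probability_setT.
have cvB : mu (B n) @[n --> \oo] --> 1.
  rewrite -muT -BT.
  exact: (@nondecreasing_cvg_mu _ _ R mu _ mB (bigcupT_measurable _ mB) ndB).
have [n _ hn] : \forall n \near \oo, u%:E < mu (B n).
  by apply: (cvB [set e | u%:E < e]); apply: open_nbhs_nbhs; split;
    [exact: open_ereal_gt_ereal|rewrite /= lte_fin].
(* [n.+1] rather than [n], since the radius has to be positive. *)
apply: (@le_lt_trans _ _ (n.+1%:R%:E)); last exact: ltry.
apply: ereal_inf_lbound; exists n.+1%:R => //; split; first exact: ltr0Sn.
by have := hn n.+1 (leqnSn n).
Qed.

Lemma delta_fin_num u x : (u < 1)%R -> delta mu u x \is a fin_num.
Proof. by move=> u1; rewrite ge0_fin_numE ?delta_ge0// delta_lty. Qed.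

(** Some ball around 0 has mass above [1 - m / 2]. A ball around [z] of mass above [m / 2] must meet
    it, or the total mass would exceed 1. *)
Lemma delta_coercive : exists r0, forall u z, (m / 2 <= u)%R ->
  (enorm z - r0)%:E <= delta mu u z.
Proof.
have m2 : (1 - m / 2 < 1)%R by rewrite ltrBlDr ltrDl divr_gt0.
have := delta_lty 0 m2; move=> /ereal_inf_lt[_ [r [r0 hr] <-] _].
exists r => u z mu_; apply: le_ereal_inf_tmp => _ [s [s0 hs] <-]; rewrite lee_fin lerBlDr leNgt.
apply/negP => zsr.
have disj : eball z s `&` eball (0 : 'rV[R]_d) r = set0.
  apply/seteqP; split => // q [/=]; rewrite /eball/= subr0 => qz q0.
  by have := ler_enorm_dist q z 0; rewrite !subr0 (enormBC z); lra.
have mz := measurable_eball z s; have m0 := measurable_eball 0 r.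
have : mu (eball z s `|` eball 0 r) <= 1 by apply: probability_le1; exact: measurableU.
rewrite measureU//; apply/negP; rewrite -ltNge.
have -> : 1 = (m / 2)%:E + (1 - m / 2)%:E by rewrite -EFinD; congr EFin; ring.
by apply: lteD => //; apply: le_lt_trans hs; rewrite lee_fin.
Qed.

(* The ball of radius |z - a| around z misses a, and the punctured balls around a
   have mass tending to 0. *)
Lemma delta_lower (a : 'rV[R]_d) : exists2 r0, (0 < r0)%R &
  forall z u, (0 < enorm (z - a) < r0)%R -> (m / 2 <= u)%R -> (enorm (z - a))%:E <= delta mu u z.
Proof.
pose P (n : nat) : set (borelRd R d) :=
  eball a n.+1%:R^-1 `\` [set z | (enorm (z - a) <= 0)%R].
have mP n : measurable (P n).
  apply: measurableD; first exact: measurable_eball.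
  rewrite -[X in measurable X]setCK; apply: measurableC; apply: sub_sigma_algebra.
  exact/closed_openC/closed_eball_le.
have PT : \bigcap_n P n = set0.
  rewrite -subset0 => z Pz.
  have z0 : (0 < enorm (z - a))%R by have [_ /negP] := Pz 0%N I; rewrite -ltNge.
  have [n _ /(_ n (leqnn n))/= hn] := near_infty_natSinv_lt (PosNum z0).
  by have [+ _] := Pz n I; rewrite /eball/= => /lt_trans/(_ hn); rewrite ltxx.
have niP : nonincreasing_seq P.
  move=> i j ij; apply/subsetPset => z [hz z0]; split => //.
  by apply: (lt_le_trans hz); rewrite lef_pV2 ?posrE// ler_nat.
have cvP : mu (P n) @[n --> \oo] --> 0.
  rewrite -(measure0 mu) -PT; apply: nonincreasing_cvg_mu => //.
    by apply: (@le_lt_trans _ _ 1); [exact: probability_le1|exact: ltry].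
  by rewrite PT; exact: measurable0.
have [n _ /(_ n (leqnn n))/= hn] : \forall n \near \oo, mu (P n) < (m / 2)%:E.
  apply: (cvP [set e | e < (m / 2)%:E]); apply: open_nbhs_nbhs; split;
    first exact: open_ereal_lt_ereal.
  by rewrite /= lte_fin divr_gt0.
have n0 : (0 < n.+1%:R^-1 :> R)%R by rewrite invr_gt0.
(* Half the radius: a ball around [z] of radius less than |z - a| reaches no further than 2 |z - a|
   from [a]. *)
exists (n.+1%:R^-1 / 2)%R; first by rewrite divr_gt0.
move=> z u /andP[za zr] mu_; apply: le_ereal_inf_tmp => _ [s [s0 hs] <-]; rewrite lee_fin leNgt.
apply/negP => sza; have : eball z s `<=` P n.
  move=> q; rewrite /eball/= => qz; split; rewrite /eball/=.
    by move: (n.+1%:R^-1)%R zr => e zr; have := ler_enorm_dist z q a; lra.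
  by apply/negP; rewrite -ltNge; have := ler_enorm_dist q z a; rewrite (enormBC z q); lra.
move=> /(le_measure mu (mem_set (measurable_eball z s)) (mem_set (mP n))) h.
have : u%:E < (m / 2)%:E by exact: lt_trans (lt_le_trans hs h) hn.
by rewrite lte_fin ltNge mu_.
Qed.

Let p_gt0 : (0 < p)%R. Proof. exact: lt_le_trans p_ge1. Qed.

Let p_ge0 : (0 <= p)%R. Proof. exact: ltW. Qed.

Let p_neq0 : (p != 0)%R. Proof. by rewrite gt_eqF. Qed.

Let m_neq0 : (m != 0)%R. Proof. by rewrite gt_eqF. Qed.

(** What remains of a lower bound on [delta] that holds only for the levels [u] in [m/2, m], half of
    the range of integration. *)
Definition dtm_ratio := (2^-1 `^ p^-1)%R.

Lemma dtm_ratio_gt0 : (0 < dtm_ratio)%R.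
Proof. by rewrite /dtm_ratio powR_gt0. Qed.

Lemma powRK_p r : (0 <= r)%R -> ((r `^ p) `^ p^-1 = r)%R.
Proof. by move=> r0; rewrite -powRrM divff ?powRr1. Qed.

Lemma le_poweRV (e f : \bar R) : 0 <= e -> e <= f -> e `^ p^-1 <= f `^ p^-1.
Proof.
move=> e0 ef; have p0 : (0 <= p^-1)%R by rewrite invr_ge0.
apply: (gt0_ler_poweR p0 _ _ ef); rewrite in_itv/= leey andbT//.
exact: le_trans ef.
Qed.

Lemma le_dtm h z : (0 <= h)%R -> (forall u, (m / 2 <= u)%R -> h%:E <= delta mu u z) ->
  (dtm_ratio * h)%:E <= dtm mu m p z.
Proof.
move=> h0 hz.
pose E : set R := [set` `[(m / 2)%R, m]].
have -> : (dtm_ratio * h)%:E = (m^-1%:E * ((h `^ p * (m / 2))%R)%:E) `^ p^-1.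
  rewrite -EFinM poweR_EFin; congr EFin.
  rewrite [X in (X `^ _)%R](_ : _ = 2^-1 * h `^ p)%R; last by field.
  by rewrite powRM ?powR_ge0 ?invr_ge0// powRK_p.
apply: le_poweRV; first by rewrite -EFinM lee_fin !mulr_ge0 ?powR_ge0 ?invr_ge0 ?ltW.
apply: lee_wpmul2l; first by rewrite lee_fin invr_ge0 ltW.
have -> : (h `^ p * (m / 2))%:E = \int[leb]_(u in `[0%R, m]) ((cst (h `^ p)%:E) \_ E) u.
  rewrite -integral_mkcondr (_ : _ `&` E = E); last first.
    apply/seteqP; split => [u []//|u]; rewrite /E/= !in_itv/= => /andP[u1 u2]; split;
      last by rewrite u1.
    by rewrite u2 andbT; apply: le_trans u1; rewrite divr_ge0// ltW.
  have lebE : leb E = (m / 2)%:E.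
    rewrite lebesgue_measure_itv/= lte_fin ltr_pdivrMr// ltr_pMr// ltr1n -EFinB.
    by congr EFin; field.
  by rewrite EFinM -lebE; apply/esym/(integral_cst leb); exact: measurable_itv.
apply: ge0_le_lower_integral => u _; first by rewrite patchE; case: ifP => // _;
  rewrite lee_fin powR_ge0.
rewrite patchE; case: ifP => [|_]; last exact: poweR_ge0.
rewrite inE /E/= in_itv/= => /andP[/hz hu _]; rewrite -poweR_EFin.
by apply: (gt0_ler_poweR _ _ _ hu); rewrite ?in_itv/= ?leey ?andbT ?lee_fin ?delta_ge0.
Qed.

Lemma dtm_lty x : dtm mu m p x < +oo.
Proof.
have [/dtm_fin//|m1] := eqVneq m 1%R.
have {}m1 : (m < 1)%R by rewrite lt_neqAle m1.
have dm := delta_fin_num x m1; pose M := fine (delta mu m x).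
rewrite /dtm poweR_lty// lte_mul_pinfty// ?lee_fin ?invr_ge0 ?ltW//.
apply: (@le_lt_trans _ _ (\int[leb]_(u in `[0%R, m]) cst (M `^ p)%:E u)).
  apply: ge0_le_lower_integral => u; first by move=> _; exact: poweR_ge0.
  rewrite /= in_itv/= => /andP[_ um]; rewrite -poweR_EFin fineK//.
  by apply: (gt0_ler_poweR p_ge0); rewrite ?in_itv/= ?leey ?andbT ?delta_ge0//; exact: delta_mono.
rewrite (integral_cst leb)//.
by rewrite [X in _ * X]lebesgue_measure_itv/= lte_fin m_gt0 sube0 -EFinM ltry.
Qed.

Definition real_dtm x : R := fine (dtm mu m p x).

Lemma dtm_ge0 x : 0 <= dtm mu m p x.
Proof. exact: poweR_ge0. Qed.

Lemma real_dtmE x : (real_dtm x)%:E = dtm mu m p x.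
Proof. by rewrite fineK// ge0_fin_numE ?dtm_ge0// dtm_lty. Qed.

Lemma real_dtm_ge0 x : (0 <= real_dtm x)%R.
Proof. by rewrite fine_ge0// dtm_ge0. Qed.

(** Half-open: when [m = 1], [delta] is +oo at the level 1, which no ball can exceed in mass. Below
    [m] it is finite, and the end point is a null set. *)
Let D : set R := [set` `[0%R, m[].
Let delta_fine x u := fine (delta mu u x).

Let delta_fineK x u : D u -> (delta_fine x u)%:E = delta mu u x.
Proof.
rewrite /D/= in_itv/= => /andP[_ um].
by rewrite fineK// delta_fin_num// (lt_le_trans um).
Qed.

(** The preimage of a ray is an interval. *)
Lemma measurable_nondecreasing_itv (i : interval R) (f : R -> R) :
  {in [set` i] &, {homo f : u v / (u <= v)%R}} -> measurable_fun [set` i] f.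
Proof.
move=> f_nd; apply: (measurability (@RGenCInfty.G R)) => [|/= _ [_] [r] -> <-].
  exact: RGenCInfty.measurableE.
apply: is_interval_measurable => s t [si fs] [ti ft] u sut.
have ui : [set` i] u by exact: (interval_is_interval si ti sut).
split; first exact: ui.
move: fs sut; rewrite /= !in_itv/= !andbT => fs /andP[su _].
by rewrite (le_trans fs)// f_nd// inE.
Qed.

Let measurable_delta_fine x : measurable_fun D (delta_fine x).
Proof.
apply: measurable_nondecreasing_itv => u v; rewrite !inE => uD vD uv.
by rewrite -lee_fin !delta_fineK//; exact: delta_mono.
Qed.

(** Written as a scaled L^p norm, [dtm] is open to Minkowski's inequality. *)
Let dtm_Lnorm x :
  dtm mu m p x = ((m^-1) `^ p^-1)%:E * 'N[leb]_p%:E[EFin \o (delta_fine x \_ D)].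
Proof.
have mdp : measurable_fun D (fun u => delta mu u x `^ p).
  have -> : measurable_fun D (fun u => delta mu u x `^ p) = measurable_fun D (fun u
    => (delta_fine x u)%:E `^ p).
    apply: propext; split; apply: eq_measurable_fun => u; rewrite inE => uD; by rewrite delta_fineK.
  apply: (@measurableT_comp _ _ _ _ _ _ (fun e => e `^ p)); first exact: measurable_poweR.
  by apply/measurable_EFinP; exact: measurable_delta_fine.
rewrite /dtm -(integral_itv_bndo_bndc mdp) Lnorm.unlock /Lnorm.body poweRM ?lee_fin ?invr_ge0
  ?(ltW m_gt0)//; last first.
  by apply: integral_ge0 => u _; exact: poweR_ge0.
rewrite poweR_EFin; congr (_ * _ `^ _); rewrite [LHS]integral_mkcond; apply: eq_integral => u _ /=.
rewrite !patchE; case: ifPn => uD; last by rewrite /= normr0 powR0.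
rewrite -delta_fineK; last by move: uD; rewrite inE.
by rewrite ger0_norm// fine_ge0// delta_ge0.
Qed.

(** Because of the normalization by [m], the shift |z - x| between [delta] at [x] and at [z] comes
    out of the norm unchanged, whence the Lipschitz constant 1. *)
Let Lnorm_cst (h : R) : (0 <= h)%R ->
  ((m^-1) `^ p^-1)%:E * 'N[leb]_p%:E[EFin \o (cst h \_ D)] = h%:E.
Proof.
move=> h0; rewrite Lnorm.unlock /Lnorm.body.
have -> : \int[leb]_u (`|(EFin \o (cst h \_ D)) u| `^ p) = (h `^ p * m)%:E.
  have lebD : leb D = m%:E by rewrite lebesgue_measure_itv/= lte_fin m_gt0 sube0.
  rewrite EFinM -lebD -(integral_cst leb)//; last exact: measurable_itv.
  rewrite [RHS]integral_mkcond; apply: eq_integral => u _ /=.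
  rewrite !patchE; case: ifPn => uD; last by rewrite /= normr0 powR0.
  by rewrite /= ger0_norm.
rewrite poweR_EFin -EFinM powRM ?powR_ge0 ?ltW// powRK_p//; congr EFin.
by rewrite mulrCA -powRM ?invr_ge0 ?ltW// mulVf// powR1 mulr1.
Qed.

Let le_scaled_sum (e f g c N1 N2 N3 : \bar R) : e = c * N1 -> f = c * N2 -> g = c * N3 ->
  0 <= c -> 0 <= N2 -> 0 <= N3 -> N1 <= N2 + N3 -> e <= f + g.
Proof. by move=> -> -> -> c0 N20 N30 N123; rewrite -ge0_muleDr// lee_wpmul2l. Qed.

Lemma dtm_lipschitz x z : dtm mu m p z <= dtm mu m p x + (enorm (z - x))%:E.
Proof.
have D_m : measurable D by exact: measurable_itv.
apply: (le_scaled_sum (dtm_Lnorm z) (dtm_Lnorm x) (esym (Lnorm_cst (enorm_ge0 (z - x))))).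
- by rewrite lee_fin powR_ge0.
- exact: Lnorm_ge0.
- exact: Lnorm_ge0.
have mT (f : R -> R) : measurable_fun D f -> measurable_fun setT (f \_ D).
  by move=> mf; apply/(measurable_restrictT f).
have mx := mT _ (measurable_delta_fine x); have mz := mT _ (measurable_delta_fine z).
have mc : measurable_fun setT (cst (enorm (z - x)) \_ D) by apply: mT; exact: measurable_cst.
apply: le_trans (minkowski_EFin leb mx mc p_ge1).
rewrite Lnorm.unlock /Lnorm.body; apply: le_poweRV; first by apply: integral_ge0 => u _;
  exact: poweR_ge0.
apply: ge0_le_lower_integral => u _; first exact: poweR_ge0.
apply: (gt0_ler_poweR p_ge0); rewrite ?in_itv/= ?leey ?andbT ?lee_fin//.
rewrite /= /patch; case: (boolP (u \in D)) => uD; last by rewrite addr0.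
move: uD; rewrite inE => uD.
have dz0 y : (0 <= delta_fine y u)%R by rewrite fine_ge0// delta_ge0.
rewrite /cst [leLHS]ger0_norm// [leRHS]ger0_norm ?addr_ge0//.
by have := delta_lipschitz u x z; rewrite -(delta_fineK x uD) -(delta_fineK z uD) -EFinD lee_fin.
Qed.

Let le_fine_add (e f : \bar R) (h : R) : e \is a fin_num -> f \is a fin_num ->
  e <= f + h%:E -> (fine e <= fine f + h)%R.
Proof. by case: e f => [e| |] [f| |]. Qed.

Lemma dtm_fin_num x : dtm mu m p x \is a fin_num.
Proof. by rewrite ge0_fin_numE ?dtm_lty ?dtm_ge0. Qed.

Lemma real_dtm_lipschitz x z : (real_dtm z <= real_dtm x + enorm (z - x))%R.
Proof. exact: le_fine_add (dtm_fin_num z) (dtm_fin_num x) (dtm_lipschitz x z). Qed.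

Local Close Scope ereal_scope.

Lemma le_real_dtm h z : 0 <= h -> (forall u, m / 2 <= u -> (h%:E <= delta mu u z)%E) ->
  dtm_ratio * h <= real_dtm z.
Proof. by move=> h0 /(le_dtm h0); rewrite -real_dtmE lee_fin. Qed.

Lemma real_dtm_coercive : exists r1, forall z, r1 <= enorm z -> 1 <= real_dtm z.
Proof.
have [r0 hr0] := delta_coercive; have k0 := dtm_ratio_gt0.
exists (r0 + dtm_ratio^-1) => z hz.
have h0 : 0 <= enorm z - r0 by rewrite subr_ge0 (le_trans _ hz)// lerDl invr_ge0 ltW.
apply: le_trans (le_real_dtm h0 _); last by move=> u; exact: hr0.
by rewrite -ler_pdivrMl// mulr1 lerBrDl.
Qed.

Lemma real_dtm_lower a : exists r0, 0 < r0 /\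
  forall z, enorm (z - a) < r0 -> dtm_ratio * enorm (z - a) <= real_dtm z.
Proof.
have [r0 r00 hr0] := delta_lower a; exists r0; split => // z zr.
have := enorm_ge0 (z - a); rewrite le_eqVlt => /predU1P[<-|za].
  by rewrite mulr0 real_dtm_ge0.
by apply: le_real_dtm; [exact: ltW|move=> u; apply: hr0; rewrite za zr].
Qed.

End distance_to_measure.

(** * Powers of a 1-Lipschitz function bounded below by a cone at each point *)

Section power_of_distance.
Context {R : realType} {d : nat}.
Variables (rho : 'rV[R]_d -> R) (k beta : R).
Hypotheses (rho_ge0 : forall z, 0 <= rho z)
  (rho_lipschitz : forall x z, rho z <= rho x + enorm (z - x))
  (k_gt0 : 0 < k)
  (rho_lower : forall a, exists r0, 0 < r0 /\
    forall z, enorm (z - a) < r0 -> k * enorm (z - a) <= rho z)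
  (beta_ge1 : 1 <= beta).

Lemma rho_continuous : continuous (rho : 'rV[R]_d -> R).
Proof.
apply: (@normed_lipschitz_continuous _ _ _ _ d%:R) => x z.
apply: le_trans (enorm_ler_norm _); rewrite ler_norml.
by have := rho_lipschitz x z; have := rho_lipschitz z x; rewrite (enormBC z); lra.
Qed.

Let beta_ge0 : 0 <= beta. Proof. exact: le_trans beta_ge1. Qed.

Let beta_neq0 : beta != 0. Proof. by rewrite gt_eqF// (lt_le_trans _ beta_ge1). Qed.

Let le_powR_beta r s : 0 <= r -> r <= s -> r `^ beta <= s `^ beta.
Proof. by move=> r0 rs; apply: ge0_ler_powR; rewrite ?nnegrE//; exact: le_trans rs. Qed.

Lemma power_weight : weight (fun z => rho z `^ beta).
Proof.
split; last by move=> z; exact: powR_ge0.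
move=> a; have := rho_ge0 a; rewrite le_eqVlt => /predU1P[a0|a0].
  move=> A /nbhs_ballP[e /= e0 eA].
  (* At a zero of [rho], continuity comes from [r ^ beta <= r] for [r] in ]0, 1], as the power is
     differentiated only at positive points. *)
  have r0 : 0 < Num.min 1 e by rewrite lt_min ltr01.
  apply: filterS (eball_nbhs a r0) => z /=; rewrite lt_min => /andP[z1 ze].
  apply: eA; rewrite -ball_normE/=.
  have := rho_lipschitz a z; rewrite -a0 add0r => hz.
  rewrite powR0// sub0r normrN ger0_norm ?powR_ge0//.
  apply: le_lt_trans (le_lt_trans hz ze).
  have := rho_ge0 z; rewrite le_eqVlt => /predU1P[<-|z0]; first by rewrite powR0.
  by apply: ge1r_powR => //; rewrite z0 (le_trans hz)// ltW.
have dp : derivable (fun r : R => r `^ beta) (rho a) 1 by case: (is_derive1_powR beta a0).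
apply: (@continuous_comp _ _ _ rho (fun r => r `^ beta)); first exact: rho_continuous.
exact/differentiable_continuous/derivable1_diffP.
Qed.

Lemma power_doubling a : doubling_at (fun z => rho z `^ beta) a.
Proof.
have := rho_ge0 a; rewrite le_eqVlt => /predU1P[a0|a0].
  have [r [r0 hr]] := rho_lower a.
  exists r, (k `^ beta), (2 `^ beta), (fun u => u `^ beta); split.
  - by split; rewrite ?powR_gt0// k_gt0.
  - by move=> u v u0; exact: le_powR_beta.
  - by move=> u u0; rewrite powR_gt0.
  - by move=> u u0; rewrite powRM.
  - move=> z /hr hz; rewrite -powRM ?enorm_ge0// ?(ltW k_gt0)//; apply/andP; split.
      by apply: le_powR_beta => //; rewrite mulr_ge0// ltW// k_gt0.
    apply: le_powR_beta; first exact: rho_ge0.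
    by have := rho_lipschitz a z; rewrite -a0 add0r.
have wa : 0 < rho a `^ beta by rewrite powR_gt0.
have [wc _] := power_weight.
have /nbhs_eball[r r0 hr] : nbhs a [set z | `|rho a `^ beta - rho z `^ beta| < rho a `^ beta / 2].
  by apply: (@cvgr_dist_lt _ _ _ _ _ _ _ (wc a)); rewrite divr_gt0.
(* Near [a] the weight stays between 1/2 and 3/2 of its value at [a], hence between [W / 4] and [W]
   for the constant [W] equal to twice that value. *)
exists r, 4^-1, 1, (fun=> 2 * rho a `^ beta); split.
- by split=> //; rewrite invr_gt0.
- by [].
- by move=> u _; rewrite mulr_gt0.
- by move=> u _; rewrite mul1r.
- by move=> z /hr/=; rewrite ltr_norml => /andP[h1 h2]; apply/andP; split; lra.
Qed.

End power_of_distance.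

(** * The Fermat distance *)

Section fermat_distance.
Context {R : realType} {d : nat}.
Variables (F : set 'rV[R]_d) (x y : 'rV[R]_d).
Implicit Types gamma : R -> 'rV[R]_d.

(** A segment is straight whatever F is; its cost is the bound [K] that starts the minimization. *)
Lemma segment_admissible :
  admissible F x y (enorm (y - x)) (fun t => x + t *: (y - x)).
Proof.
have segB (s t : R) : x + s *: (y - x) - (x + t *: (y - x)) = (s - t) *: (y - x).
  by rewrite opprD addrACA subrr add0r -scalerBl.
split.
- by move=> s t _ _; rewrite segB enormZ mulrC.
- by rewrite scale0r addr0.
- by rewrite scale1r addrC subrK.
- move=> a b _ _ _ _ s t r _ st tr _; rewrite !segB !enormZ -mulrDl.
  by rewrite !ger0_norm ?subr_ge0 ?(le_trans st tr)//; congr (_ * _); ring.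
Qed.

Lemma Gamma_admissible gamma : (0 < d)%N ->
  Gamma F x y gamma <-> exists N, admissible F x y N gamma.
Proof.
move=> d0; split=> [[[_ _ [N gN]] g0 g1 gF]|[N [gN g0 g1 gF]]].
  exists N; split => // a b a0 ab b1 abF.
  have [u [u1 hu]] := gF a b a0 ab b1 abF.
  exact: (straight_of_direction gN a0 b1 u1 hu).
split => //; last first.
  by move=> a b a0 ab b1 abF; apply: (direction_of_straight d0); exact: gF.
split; last by exists N.
- apply: (subspace_eq_continuous (f := gamma \o clamp01)).
    by move=> t; rewrite inE/= in_itv/= => t01; rewrite /= clamp01_id.
  exact: continuous_subspaceT (lipschitz_path_clamp_continuous gN).
- have := wlenE gN weight1 (lexx 0) ler01 (lexx 1).
  under eq_integral do rewrite mul1r.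
  by rewrite /path_length => ->; exact: ltry.
Qed.

End fermat_distance.

Lemma fdtm_lengthE (R : realType) (d : nat) (mu : probability (borelRd R d) R)
    (m p beta N : R) (gamma : R -> 'rV[R]_d) :
  (forall z, (real_dtm mu m p z)%:E = dtm mu m p z) ->
  weight (fun z => real_dtm mu m p z `^ beta) -> lipschitz_path gamma N ->
  fdtm_length mu m p beta gamma = (wlen (fun z => real_dtm mu m p z `^ beta) gamma 0 1)%:E.
Proof.
move=> rE hw gN; rewrite -(wlenE gN hw (lexx 0) ler01 (lexx 1)).
by apply: eq_integral => t _; rewrite -rE.
Qed.

Theorem theorem3 (R : realType) (d : nat) (d_gt0 : (0 < d)%N)
    (m p beta : R) (m_gt0 : 0 < m) (m_le1 : m <= 1)
    (p_ge1 : 1 <= p) (beta_ge1 : 1 <= beta)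
    (mu : probability (borelRd R d) R)
    (dtm_fin : m = 1 -> forall x : 'rV[R]_d, (dtm mu m p x < +oo)%E)
    (F : set 'rV[R]_d) (F_closed : closed F) :
  forall x y : 'rV[R]_d, exists gamma : R -> 'rV[R]_d,
    Gamma F x y gamma /\
    fermat_dtm mu m p beta F x y = fdtm_length mu m p beta gamma.
Proof.
move=> x y.
have r_ge0 z : 0 <= real_dtm mu m p z by exact: real_dtm_ge0.
have rE := real_dtmE m_gt0 m_le1 p_ge1 dtm_fin.
have r_lip := real_dtm_lipschitz m_gt0 m_le1 p_ge1 dtm_fin.
have r_low := real_dtm_lower m_gt0 m_le1 p_ge1 dtm_fin.
have [r1 r_coe] := real_dtm_coercive m_gt0 m_le1 p_ge1 dtm_fin.
have hw := power_weight r_ge0 r_lip beta_ge1.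
have w_dbl := power_doubling r_ge0 r_lip (dtm_ratio_gt0 p) r_low beta_ge1.
have gE gamma N := @fdtm_lengthE R d mu m p beta N gamma rE hw.
set w := fun z => real_dtm mu m p z `^ beta in hw w_dbl gE.
have w_coe z : r1 <= enorm z -> 1 <= w z.
  by move=> /r_coe h; apply: (le_trans h); exact: le1r_powR.
have adm0 := segment_admissible F x y.
have len0 : 0 <= wlen w (fun t => x + t *: (y - x)) 0 1 by exact: wlen_ge0.
(* [K] is the cost of the segment, and [c = 1] bounds the weight from below outside the ball of
   radius [r1]. *)
have [N [gamma [gadm gmin]]] :=
  exists_global_minimal_path hw F_closed adm0 len0 (lexx _) ltr01 w_coe w_dbl.
exists gamma; split; first by apply/(Gamma_admissible _ _ _ _ d_gt0); exists N.
have gG : Gamma F x y gamma by apply/(Gamma_admissible _ _ _ _ d_gt0); exists N.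
apply/le_anti/andP; split; first by apply: ereal_inf_lbound; exists gamma.
apply: le_ereal_inf_tmp => _ [g /(Gamma_admissible _ _ _ _ d_gt0)[N' gadm'] <-].
have [gN _ _ _] := gadm; have [gN' _ _ _] := gadm'.
by rewrite (gE _ _ gN) (gE _ _ gN') lee_fin; exact: gmin gadm'.
Qed.
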